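(* Let $(\Gamma,\mu)$ be an infinite, connected, locally uniformly finite weighted graph satisfying the following three conditions. (i) There exists $\varepsilon>0$ such that $p(x,x)>\varepsilon$ for all $x\in\Gamma$. (ii) There exists $C>0$ such that $V(x,2r)\le C\,V(x,r)$ for all $x\in\Gamma$ and $r>0$. (iii) For some $m>2$ there exist $C,c>0$ such that for all $x,y\in\Gamma$ and all integers $k\ge 1$, $$p_{k-1}(x,y)\le \frac{C\,\mathfrak m(y)}{V(y,k^{1/m})}\exp\left(-c\left(\frac{d^m(x,y)}{k}\right)^{\frac1{m-1}}\right).$$ Then the Riesz transform $\nabla_\Gamma\Delta_\Gamma^{-1/2}$ is weak $(1,1)$ and is $L^p$ bounded for all $p\in(1,2]$.
   Context: A weighted graph $(\Gamma,\mu)$ consists of an infinite countable set $\Gamma$ and a symmetric weight $\mu_{xy}=\mu_{yx}\ge 0$ on $\Gamma\times\Gamma$; $x\sim y$ means $\mu_{xy}>0$ (in particular $x\sim x$ is allowed). Connected: any two vertices are joined by a finite path $x=x_0\sim x_1\sim\dots\sim x_n=y$. Locally uniformly finite: there is $M_0\in\mathbb N$ with $\#\{y: y\sim x\}\le M_0$ for all $x$. $d(x,y)$ is the length of the shortest path joining $x$ and $y$. The vertex weight is $\mathfrak m(x)=\sum_{y\sim x}\mu_{xy}$, and $\mathfrak m(E)=\sum_{x\in E}\mathfrak m(x)$ for $E\subset\Gamma$. $B(x,r)=\{y: d(x,y)<r\}$ and $V(x,r)=\mathfrak m(B(x,r))$. Norms: $\|f\|_p=\left(\sum_x|f(x)|^p\mathfrak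 m(x)\right)^{1/p}$. The Markov kernel is $p(x,y)=\mu_{xy}/\mathfrak m(x)$, with iterates $p_0(x,y)=\delta(x,y)$ (equal to $1$ if $x=y$ and $0$ otherwise) and $p_{k+1}(x,y)=\sum_z p(x,z)p_k(z,y)$. $Pf(x)=\sum_y p(x,y)f(y)$, $\Delta_\Gamma=I-P$ (non-negative self-adjoint on $L^2(\Gamma,\mathfrak m)$), and $$\nabla_\Gamma g(x)=\left(\tfrac12\sum_{y\in\Gamma}p(x,y)|g(y)-g(x)|^2\right)^{1/2}.$$ $c_0(\Gamma)$ is the space of finitely supported functions on $\Gamma$. Since $\|\nabla_\Gamma g\|_2=\|\Delta_\Gamma^{1/2}g\|_2$, the sublinear operator $T=\nabla_\Gamma\Delta_\Gamma^{-1/2}$ (the Riesz transform) is defined and bounded on $L^2(\Gamma,\mathfrak m)$. $L^p$ bounded means: there is $C_p$ such that $\|\nabla_\Gamma g\|_p\le C_p\|\Delta_\Gamma^{1/2}g\|_p$ for all $g\in c_0(\Gamma)$. Weak $(1,1)$ means: there is $C$ such that for all $\lambda>0$ and all $f\in L^1\cap L^2$ (hence, by extension, all $f\in L^1$), $\mathfrak m(\{x: |Tf(x)|>\lambda\})\le\frac C\lambda\|f\|_1$. *)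

(* Defs.v *)
From HB Require Import structures.
From mathcomp Require Import all_boot all_order all_algebra.
From mathcomp Require Import all_classical all_reals all_analysis.

Set Implicit Arguments.
Unset Strict Implicit.
Unset Printing Implicit Defensive.

Import Order.TTheory GRing.Theory Num.Theory.
Import numFieldNormedType.Exports.

Local Open Scope classical_set_scope.
Local Open Scope ring_scope.

Section WeightedGraph.
Context {R : realType} {G : countType}.
Variable mu : G -> G -> R.
Implicit Types (x y : G) (f g h : G -> R) (E : set G) (p r : R).

Definition adj x y : bool := 0 < mu x y.

Definition walk x y (n : nat) : Prop :=
  exists s : seq G, [/\ path adj x s, last x s = y & size s = n].

Definition weighted_graph : Prop :=
  [/\ infinite_set [set: G],
      forall x y, mu x y = mu y x &
      forall x y, 0 <= mu x y].

Definition connected_graph : Prop := forall x y, exists n, walk x y n.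

Definition locally_uniformly_finite : Prop :=
  exists M0 : nat, forall x, ([set y | adj x y] #<= `I_M0)%card.

(* Junk value 0 when y cannot be reached from x. *)
Definition gdist x y : nat :=
  xget 0%N [set n | walk x y n /\ forall k, walk x y k -> (n <= k)%N].

(* The sums \sum_(y \in A) below have finite support when the graph is locally
   finite; sums that may be infinite are written with \esum, in \bar R. *)
Definition vweight x : R := \sum_(y \in [set y | adj x y]) mu x y.

Definition vmeasure E : \bar R := \esum_(x in E) (vweight x)%:E.

Definition gball x r : set G := [set y | (gdist x y)%:R < r].

(* Balls are finite under local uniform finiteness, so fine loses nothing. *)
Definition volume x r : R := fine (vmeasure (gball x r)).

Definition Lpnorm p f : \bar R :=
  ((\esum_(x in [set: G]) (`|f x| `^ p * vweight x)%:E) `^ p^-1)%E.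

Definition inLp p f : Prop := (Lpnorm p f < +oo)%E.

Definition finitely_supported f : Prop := finite_set [set x | f x != 0].

(* The inner product of L^2(G, vweight), as the difference of the sums of the
   positive and negative parts; meaningful when f and g are in L^2. *)
Definition dotL2 f g : R :=
  let F x := (f x * g x * vweight x)%:E in
  fine (\esum_(x in [set: G]) (F^\+)%E x) -
  fine (\esum_(x in [set: G]) (F^\-)%E x).

Definition pker x y : R := mu x y / vweight x.

Fixpoint pker_iter (k : nat) x y : R :=
  if k is k'.+1 then \sum_(z \in [set: G]) pker x z * pker_iter k' z y
  else (x == y)%:R.

Definition Pop f : G -> R := fun x => \sum_(y \in [set: G]) pker x y * f y.

Definition laplacian f : G -> R := fun x => f x - Pop f x.

Definition gradient f : G -> R := fun x =>
  Num.sqrt (2^-1 * \sum_(y \in [set: G]) pker x y * `|f y - f x| ^+ 2).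

(* S restricts to a bounded, self-adjoint, non-negative linear operator on L^2
   whose square is A. For a bounded non-negative self-adjoint A such an S exists
   and its restriction to L^2 is unique: it is the A^{1/2} of the functional
   calculus. The values of S outside L^2 are unconstrained. *)
Definition is_sqrt_op (A S : (G -> R) -> (G -> R)) : Prop :=
  [/\ forall f, inLp 2 f -> inLp 2 (S f),
      forall (a : R) f g, inLp 2 f -> inLp 2 g ->
        S (fun x => a * f x + g x) = (fun x => a * S f x + S g x),
      exists K : R, forall f, inLp 2 f -> (Lpnorm 2 (S f) <= K%:E * Lpnorm 2 f)%E,
      (forall f g, inLp 2 f -> inLp 2 g -> dotL2 (S f) g = dotL2 f (S g)) /\
      (forall f, inLp 2 f -> 0 <= dotL2 (S f) f) &
      forall f, inLp 2 f -> S (S f) = A f].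

Definition sqrt_laplacian : (G -> R) -> (G -> R) :=
  xget (fun f => f) [set S | is_sqrt_op laplacian S].

(* sqrt_laplacian is injective on L^2 with dense range, and the map
   sqrt_laplacian g |-> gradient g, that is, gradient composed with the inverse
   of sqrt_laplacian, is norm-preserving and 1-Lipschitz from this range to L^2;
   h is the image of f under its extension by continuity to the whole of L^2. *)
Definition is_riesz f h : Prop :=
  inLp 2 h /\
  exists g : nat -> G -> R,
    [/\ forall n, inLp 2 (g n),
        (fun n => Lpnorm 2 (fun x => sqrt_laplacian (g n) x - f x))
          @ \oo --> 0%E &
        (fun n => Lpnorm 2 (fun x => gradient (g n) x - h x)) @ \oo --> 0%E].

Definition riesz f : G -> R := xget (fun _ => 0) [set h | is_riesz f h].

Definition weak11 (T : (G -> R) -> (G -> R)) : Prop :=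
  exists C : R, forall (lambda : R) f, 0 < lambda -> inLp 1 f -> inLp 2 f ->
    (vmeasure [set x | (lambda < `|T f x|)%R] <= (C / lambda)%:E * Lpnorm 1 f)%E.

Definition riesz_Lp_bounded p : Prop :=
  exists Cp : R, forall g, finitely_supported g ->
    (Lpnorm p (gradient g) <= Cp%:E * Lpnorm p (sqrt_laplacian g))%E.

Definition uniformly_lazy : Prop :=
  exists2 eps : R, 0 < eps & forall x, eps < pker x x.

Definition volume_doubling : Prop :=
  exists2 C : R, 0 < C &
    forall x r, 0 < r -> volume x (2 * r) <= C * volume x r.

Definition subgaussian_upper_bound (m : R) : Prop :=
  exists C c : R, [/\ 0 < C, 0 < c &
    forall x y (k : nat), (1 <= k)%N ->
      pker_iter k.-1 x y <=
        C * vweight y / volume y (k%:R `^ m^-1) *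
        expR (- c * ((gdist x y)%:R `^ m / k%:R) `^ (m - 1)^-1)].

End WeightedGraph.

(* Main.v *)
Require Import Defs.
From HB Require Import structures.
From mathcomp Require Import all_boot all_order all_algebra finmap.
From mathcomp Require Import all_classical all_reals all_analysis.
From mathcomp Require Import ring lra zify.

Set Implicit Arguments.
Unset Strict Implicit.
Unset Printing Implicit Defensive.

Import Order.TTheory GRing.Theory Num.Theory.
Import numFieldNormedType.Exports.

Local Open Scope classical_set_scope.
Local Open Scope ring_scope.

(** The Riesz transform is approximated by the operators [truncated_riesz mu N f
    = gradient mu (dinv mu N f)], where [dinv mu N] is the sum of the first [N]
    terms of the series [Delta^(-1/2) = sum_l binv l * P^l]. They are given by
    finite sums, so every estimate can be proved for finitely supported
    functions, with constants that do not depend on [N], and read on finite sets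
    of vertices.

    On [L^2], integration by parts gives [||gradient (dinv N f)||^2 = <(1 - P)
    (dinv N)^2 f, f>]. The squared partial sum has coefficients 1 up to degree
    [N - 1] and decreasing ones afterwards, so this operator is the identity
    minus an average of powers of [P] ([nsq_truncated_riesz]).

    For the weak type (1,1) bound, a function is cut at height [lam] into a
    bounded part and pieces living on balls where its mean is about [lam]
    ([calderon_zygmund]). Each piece is compared with its average under the walk
    at times about [r ^ m], with [r] the radius of the ball and [m] the walk
    dimension. The averages have small [L^2] norm, because a piece spread at its
    own scale is dominated by one integrable kernel, and the balls are disjoint
    ([overlap], [nsq_averages]). The differences are integrable away from the
    balls ([riesz_far]), by an off-diagonal [L^1] bound on the gradient of the
    transition kernels [u l = P^l delta], with [delta] a Dirac mass.

    Pointwise Gaussian bounds for this gradient cannot be expected when the walk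
    is slower than diffusive; an exponent below 2 takes their place. Convexity
    of [t ^ (3/2)] and laziness give [|gradient (u l)|^2 <= C * max (sqrt (u l))
    * loss], where the maximum is over the neighbours and the loss has integral
    [e l - e (l + 1)] for the energy [e l], the integral of [u l ^ (3/2)]
    ([gradient_sqr_le_energy]). By Cauchy-Schwarz the square of the [L^1] norm
    of the gradient far from the centre is at most a constant times the integral
    of [sqrt (u l)] there, which the sub-Gaussian bound makes small, times [e l
    - e (l + 1)]. Over a dyadic block of times the energies telescope
    ([gradient_hk_block]); the coefficients of [dinv N] minus its average are
    square summable over such blocks in a way that leaves a geometric series
    ([riesz_kernel_far]).

    The bounds for [1 < p < 2] follow by interpolation ([strong_truncated]).
    Finally the truncations are compared with the transform itself: if [S] is a
    positive square root of [Delta], then [Delta * dinv N] is a positive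
    operator commuting with [S] whose square differs little from [S^2] on any
    given function, so [truncated_riesz N (S g)] tends to [gradient g]
    ([sqrt_dinv_cvg]). *)

(** * Absolutely convergent sums over a countable set *)

(** This has the form in which [dotL2] is defined, so that the inner product
    is such a sum by definition. *)
HB.lock Definition tsum {R : realType} {T : choiceType} (F : T -> R) : R :=
  let F' x := (F x)%:E in
  fine (\esum_(x in [set: T]) (F'^\+)%E x) -
  fine (\esum_(x in [set: T]) (F'^\-)%E x).

Section Sums.
Context {R : realType} {T : choiceType}.
Implicit Types (F H : T -> R) (K c : R).

Definition sums_le F K := forall A : seq T, uniq A -> \sum_(x <- A) F x <= K.

Definition absum F := exists K, sums_le (fun x => `|F x|) K.

Lemma esum_leP F K : (forall x, 0 <= F x) ->
  (\esum_(x in [set: T]) (F x)%:E <= K%:E)%E <-> sums_le F K.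
Proof.
move=> F0; split=> [h A uA|h].
  rewrite -lee_fin; apply: le_trans h; apply: esum_ge.
  exists [set` A]; first by split => //; exact: finite_seq.
  by rewrite -sumEFin fsbig_seq.
apply: ge_ereal_sup => _ [X [finX _] <-].
by rewrite fsbig_finite//= sumEFin lee_fin h// fset_uniq.
Qed.

Lemma absum_ge0P F : (forall x, 0 <= F x) -> absum F <-> exists K, sums_le F K.
Proof.
move=> F0; have e : (fun x => `|F x|) = F by apply: funext => x; rewrite ger0_norm.
by rewrite /absum e.
Qed.

Lemma absum_le H F : (forall x, `|F x| <= H x) -> absum H -> absum F.
Proof.
move=> FH [K h]; exists K => A uA; apply: le_trans (h A uA).
by apply: ler_sum => x _; rewrite (le_trans (FH x))// ler_norm.
Qed.

Lemma absum_abs F : absum F -> absum (fun x => `|F x|).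
Proof.
have e : (fun x : T => `| `|F x| |) = (fun x => `|F x|) by apply: funext => x; rewrite normr_id.
by rewrite /absum e.
Qed.

Lemma absumD F H : absum F -> absum H -> absum (fun x => F x + H x).
Proof.
move=> [K h] [L g]; exists (K + L) => A uA.
rewrite (le_trans _ (lerD (h A uA) (g A uA)))// -big_split/=.
by apply: ler_sum => x _; exact: ler_normD.
Qed.

Lemma absumZ c F : absum F -> absum (fun x => c * F x).
Proof.
move=> [K h]; exists (`|c| * K) => A uA.
under eq_bigr do rewrite normrM.
by rewrite -mulr_sumr ler_wpM2l// h.
Qed.


Lemma absum_pos F : absum F -> absum (fun x => Num.max (F x) 0).
Proof.
move=> /absum_abs; apply: absum_le => x.
by case: (leP (F x) 0) => ?; rewrite ?normr0.
Qed.

Lemma absum_neg F : absum F -> absum (fun x => Num.max (- F x) 0).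
Proof.
move=> /absum_abs; apply: absum_le => x.
by case: (leP (- F x) 0) => ?; rewrite ?normr0 ?normrN.
Qed.

Lemma esum_fin F : (forall x, 0 <= F x) -> absum F ->
  (fine (\esum_(x in [set: T]) (F x)%:E))%:E = \esum_(x in [set: T]) (F x)%:E.
Proof.
move=> F0 /(absum_ge0P F0)[K /(esum_leP _ F0) h]; rewrite fineK//.
rewrite ge0_fin_numE; first exact: le_lt_trans h (ltry _).
by apply: esum_ge0 => x _; rewrite lee_fin.
Qed.

Lemma tsum_ge0E F : (forall x, 0 <= F x) ->
  tsum F = fine (\esum_(x in [set: T]) (F x)%:E).
Proof.
move=> F0; rewrite tsum.unlock /= [X in _ - fine X]esum1 ?subr0.
  by congr fine; apply: eq_esum => x _; rewrite funeposE -EFin_max max_l.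
by move=> x _; rewrite funenegE -EFinN -EFin_max max_r// oppr_le0.
Qed.

Lemma tsum_esum F : (forall x, 0 <= F x) -> absum F ->
  (tsum F)%:E = \esum_(x in [set: T]) (F x)%:E.
Proof. by move=> F0 aF; rewrite tsum_ge0E// esum_fin. Qed.

Lemma tsum_posneg F :
  tsum F = tsum (fun x => Num.max (F x) 0) - tsum (fun x => Num.max (- F x) 0).
Proof.
rewrite [in RHS]tsum_ge0E; last by move=> x; rewrite le_max lexx orbT.
rewrite [in RHS]tsum_ge0E; last by move=> x; rewrite le_max lexx orbT.
by rewrite tsum.unlock /=; congr (fine _ - fine _); apply: eq_esum => x _;
  rewrite ?funeposE ?funenegE -?EFinN -EFin_max.
Qed.

Lemma eq_tsum F H : F =1 H -> tsum F = tsum H.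
Proof. by move=> /funext ->. Qed.

Lemma tsumD_ge0 F H : (forall x, 0 <= F x) -> (forall x, 0 <= H x) ->
  absum F -> absum H -> tsum (fun x => F x + H x) = tsum F + tsum H.
Proof.
move=> F0 H0 aF aH; apply: EFin_inj; rewrite [RHS]EFinD !tsum_esum//.
- by rewrite -esumD// => x _; rewrite lee_fin.
- by move=> x; rewrite addr_ge0.
- exact: absumD.
Qed.

(** All of linearity comes from this: the value of [tsum] does not depend on
    how a function is written as a difference of nonnegative ones. *)
Lemma tsumB_ge0 F A B : (forall x, 0 <= A x) -> (forall x, 0 <= B x) ->
  absum A -> absum B -> (forall x, F x = A x - B x) -> tsum F = tsum A - tsum B.
Proof.
move=> A0 B0 aA aB FAB.
have aF : absum F.
  apply: (absum_le _ (absumD aA aB)) => x.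
  by rewrite FAB (le_trans (ler_normB _ _))// !ger0_norm.
have p0 x : 0 <= Num.max (F x) 0 by rewrite le_max lexx orbT.
have n0 x : 0 <= Num.max (- F x) 0 by rewrite le_max lexx orbT.
rewrite tsum_posneg; apply/eqP; rewrite subr_eq addrAC eq_sym subr_eq; apply/eqP.
rewrite -!tsumD_ge0//; try solve [exact: absum_pos|exact: absum_neg].
apply: eq_tsum => x; have := FAB x.
by case: (leP (F x) 0); case: (leP (- F x) 0) => *; lra.
Qed.

Lemma tsumD F H : absum F -> absum H ->
  tsum (fun x => F x + H x) = tsum F + tsum H.
Proof.
move=> aF aH; rewrite (tsum_posneg F) (tsum_posneg H).
rewrite (@tsumB_ge0 _ (fun x => Num.max (F x) 0 + Num.max (H x) 0)
  (fun x => Num.max (- F x) 0 + Num.max (- H x) 0)).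
- rewrite !tsumD_ge0; try solve [exact: absum_pos|exact: absum_neg|
    by move=> x; rewrite le_max lexx orbT].
  by ring.
- by move=> x; rewrite addr_ge0// le_max lexx orbT.
- by move=> x; rewrite addr_ge0// le_max lexx orbT.
- by apply: absumD; exact: absum_pos.
- by apply: absumD; exact: absum_neg.
- move=> x; case: (leP (F x) 0); case: (leP (- F x) 0);
   case: (leP (H x) 0); case: (leP (- H x) 0) => *; lra.
Qed.

Lemma tsumN F : tsum (fun x => - F x) = - tsum F.
Proof.
rewrite tsum_posneg [in RHS]tsum_posneg opprB; congr (tsum _ - tsum _).
by apply: funext => x; rewrite opprK.
Qed.

Lemma tsum_sums_le F K : (forall x, 0 <= F x) -> sums_le F K -> tsum F <= K.
Proof.
move=> F0 h; rewrite -lee_fin tsum_esum//; last by apply/absum_ge0P => //; exists K.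
exact/esum_leP.
Qed.

Lemma sums_le_tsum F : (forall x, 0 <= F x) -> absum F -> sums_le F (tsum F).
Proof. by move=> F0 aF; apply/esum_leP => //; rewrite tsum_esum. Qed.

Lemma tsum_ge0 F : (forall x, 0 <= F x) -> 0 <= tsum F.
Proof.
by move=> F0; rewrite tsum_ge0E// fine_ge0//; apply: esum_ge0 => x _; rewrite lee_fin.
Qed.

Lemma tsumB F H : absum F -> absum H ->
  tsum (fun x => F x - H x) = tsum F - tsum H.
Proof.
move=> aF aH; rewrite tsumD//; last by apply: (absum_le _ (absum_abs aH)) => x; rewrite normrN.
by rewrite tsumN.
Qed.

Lemma le_tsum F H : absum F -> absum H -> (forall x, F x <= H x) ->
  tsum F <= tsum H.
Proof.
move=> aF aH FH; rewrite -subr_ge0 -tsumB//.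
by apply: tsum_ge0 => x; rewrite subr_ge0.
Qed.

Lemma tsumZ c F : absum F -> tsum (fun x => c * F x) = c * tsum F.
Proof.
have ge0 d H : 0 <= d -> (forall x, 0 <= H x) -> absum H ->
    tsum (fun x => d * H x) = d * tsum H.
  move=> d0 H0 aH; have dH0 x : 0 <= d * H x by rewrite mulr_ge0.
  apply/eqP; rewrite eq_le; apply/andP; split.
    apply: tsum_sums_le => // A uA; rewrite -mulr_sumr ler_wpM2l//.
    exact: sums_le_tsum.
  case: (eqVneq d 0) => [->|dn0]; first by rewrite mul0r tsum_ge0// => x; rewrite mul0r.
  have {dn0}d0 : 0 < d by rewrite lt_def dn0.
  rewrite mulrC -ler_pdivlMr//; apply: tsum_sums_le => // A uA.
  rewrite ler_pdivlMr// mulrC mulr_sumr.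
  by apply: sums_le_tsum => //; exact: absumZ.
have ge0' d H : 0 <= d -> absum H -> tsum (fun x => d * H x) = d * tsum H.
  move=> d0 aH; rewrite (tsum_posneg H) mulrBr -!ge0//;
   try solve [exact: absum_pos|exact: absum_neg|by move=> x; rewrite le_max lexx orbT].
  apply: tsumB_ge0 => [x|x|||x]; try by rewrite mulr_ge0// le_max lexx orbT.
  - exact/absumZ/absum_pos.
  - exact/absumZ/absum_neg.
  - rewrite -mulrBr; congr (_ * _).
    by case: (leP (H x) 0); case: (leP (- H x) 0) => *; lra.
move=> aF; case: (leP 0 c) => [/ge0'->//|c0].
rewrite -[LHS]opprK -tsumN -[c]opprK mulNr -ge0'// ?oppr_ge0 1?ltW//.
by congr (- tsum _); apply: funext => x; rewrite opprK mulNr.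
Qed.

Lemma absum_finsupp F (A : seq T) : (forall x, x \notin A -> F x = 0) -> absum F.
Proof.
move=> FA; exists (\sum_(x <- undup A) `|F x|) => B uB.
rewrite [leLHS](bigID (mem A))/= [X in _ + X]big1 ?addr0; last first.
  by move=> x /FA ->; rewrite normr0.
rewrite -big_filter.
have -> : \sum_(i <- [seq i <- B | i \in A]) `|F i| =
    \sum_(i <- undup A | i \in B) `|F i|.
  rewrite -[RHS]big_filter; apply: perm_big; apply: uniq_perm.
  - exact: filter_uniq.
  - exact/filter_uniq/undup_uniq.
  - by move=> x; rewrite !mem_filter mem_undup andbC.
rewrite [leRHS](bigID (mem B))/= lerDl sumr_ge0//.
Qed.

Lemma tsum_finsupp F (A : seq T) : uniq A -> (forall x, x \notin A -> F x = 0) ->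
  tsum F = \sum_(x <- A) F x.
Proof.
move=> uA FA.
have ge0 H : (forall x, 0 <= H x) -> (forall x, x \notin A -> H x = 0) ->
    tsum H = \sum_(x <- A) H x.
  move=> H0 HA; apply/eqP; rewrite eq_le; apply/andP; split; last first.
    by apply: sums_le_tsum => //; exact: absum_finsupp HA.
  apply: tsum_sums_le => // B uB.
  rewrite [leLHS](bigID (mem A))/= [X in _ + X]big1 ?addr0; last by move=> x /HA.
  rewrite -big_filter.
  have -> : \sum_(i <- [seq i <- B | i \in A]) H i = \sum_(i <- A | i \in B) H i.
    rewrite -[RHS]big_filter; apply: perm_big; apply: uniq_perm.
    - exact: filter_uniq.
    - exact/filter_uniq.
    - by move=> x; rewrite !mem_filter andbC.
  by rewrite [leRHS](bigID (mem B))/= lerDl sumr_ge0.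
rewrite tsum_posneg !ge0 -?sumrB.
- apply: eq_bigr => x _.
  by case: (leP (F x) 0); case: (leP (- F x) 0) => *; lra.
- by move=> x; rewrite le_max lexx orbT.
- by move=> x /FA ->; rewrite oppr0 maxxx.
- by move=> x; rewrite le_max lexx orbT.
- by move=> x /FA ->; rewrite maxxx.
Qed.

Lemma ler_tsum_point F x : (forall x, 0 <= F x) -> absum F -> F x <= tsum F.
Proof. by move=> F0 aF; have := sums_le_tsum F0 aF (A := [:: x]) isT; rewrite big_seq1. Qed.

End Sums.

(** * The Markov operator of a reversible graph *)

(** Bundling the properties with the weight lets them be inferred from the
    graph. Positivity of [vweight] comes from laziness: every vertex has a loop. *)
Record reversible_graph (R : realType) (G : countType) := ReversibleGraph {
  rg_mu :> G -> G -> R;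
  mu_sym : forall x y, rg_mu x y = rg_mu y x;
  mu_ge0 : forall x y, 0 <= rg_mu x y;
  nbh_finite : forall x, finite_set [set y | adj rg_mu x y];
  vweight_gt0 : forall x, 0 < vweight rg_mu x }.

Lemma esum_swap {R : realType} {T T' : choiceType} (a : T -> T' -> \bar R) :
  (forall x y, 0 <= a x y)%E ->
  \esum_(x in [set: T]) \esum_(y in [set: T']) a x y =
  \esum_(y in [set: T']) \esum_(x in [set: T]) a x y.
Proof.
move=> a0; rewrite !esum_esum//.
rewrite (@reindex_esum _ _ _ ([set: T'] `*`` (fun=> [set: T])) _ (fun k => (k.2, k.1)))//.
by split => [[]|[x y] [x' y'] _ _ [-> ->]|[x y] _]//; exists (y, x).
Qed.

Section Markov.
Context {R : realType} {G : countType} {mu : reversible_graph R G}.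
Implicit Types (x y z : G) (f g h F : G -> R) (c : R).

Local Notation m := (vweight mu).
Local Notation P := (Pop mu).
Local Notation p := (pker mu).

Definition nbh x : seq G := fset_set [set y | adj mu x y].

Lemma nbh_uniq x : uniq (nbh x). Proof. exact: fset_uniq. Qed.

Lemma mem_nbh x y : (y \in nbh x) = adj mu x y.
Proof. by rewrite /nbh in_fset_set ?mem_setE//; exact: nbh_finite. Qed.

Lemma adj_sym x y : adj mu x y = adj mu y x.
Proof. by rewrite /adj mu_sym. Qed.

Lemma nadj_mu x y : ~~ adj mu x y -> mu x y = 0.
Proof. by rewrite /adj lt_def mu_ge0 andbT negbK => /eqP. Qed.

Lemma vweightE x : m x = \sum_(y <- nbh x) mu x y.
Proof. by rewrite /vweight fsbig_finite//; exact: nbh_finite. Qed.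

Lemma pker_ge0 x y : 0 <= p x y.
Proof. by rewrite divr_ge0 ?mu_ge0// ltW// vweight_gt0. Qed.

Lemma PopE f x : P f x = \sum_(y <- nbh x) p x y * f y.
Proof.
rewrite /Pop [RHS]fsbig_seq ?nbh_uniq//; apply/esym/fsbig_widen => // y [_ /= /negP]; rewrite mem_nbh => /nadj_mu.
by rewrite /pker => ->; rewrite !mul0r.
Qed.

Lemma sum_pker x : \sum_(y <- nbh x) p x y = 1.
Proof.
rewrite /pker -mulr_suml -vweightE divff// gt_eqF//.
exact: vweight_gt0.
Qed.

Lemma eq_Pop f g x : (forall y, adj mu x y -> f y = g y) -> P f x = P g x.
Proof.
by move=> fg; rewrite !PopE; apply: eq_big_seq => y; rewrite mem_nbh => /fg ->.
Qed.

Lemma le_Pop f g x : (forall y, adj mu x y -> f y <= g y) -> P f x <= P g x.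
Proof.
move=> fg; rewrite !PopE !big_seq; apply: ler_sum => y; rewrite mem_nbh => /fg ?.
by rewrite ler_wpM2l// pker_ge0.
Qed.

Lemma PopD f g x : P (fun y => f y + g y) x = P f x + P g x.
Proof. by rewrite !PopE -big_split; apply: eq_bigr => y _; rewrite mulrDr. Qed.

Lemma PopZ c f x : P (fun y => c * f y) x = c * P f x.
Proof. by rewrite !PopE mulr_sumr; apply: eq_bigr => y _; rewrite mulrCA. Qed.

Lemma PopZr c f x : P (fun y => f y * c) x = P f x * c.
Proof. by rewrite mulrC -PopZ; congr P; apply: funext => y; rewrite mulrC. Qed.

Lemma Pop_cst c x : P (fun=> c) x = c.
Proof. by rewrite PopE -mulr_suml sum_pker mul1r. Qed.

Lemma PopB f g x : P (fun y => f y - g y) x = P f x - P g x.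
Proof. by rewrite !PopE -sumrB; apply: eq_bigr => y _; rewrite mulrBr. Qed.

Lemma Pop_ge0 f x : (forall y, adj mu x y -> 0 <= f y) -> 0 <= P f x.
Proof. by move=> f0; rewrite -(Pop_cst 0 x); exact: le_Pop. Qed.

Lemma Pop_point f x y : (forall y, 0 <= f y) -> p x y * f y <= P f x.
Proof.
move=> f0; rewrite PopE; have [xy|/nadj_mu] := boolP (adj mu x y); last first.
  move=> xy; rewrite {1}/pker xy !mul0r sumr_ge0// => z _.
  by rewrite mulr_ge0// pker_ge0.
rewrite (bigD1_seq y) ?nbh_uniq ?mem_nbh//= lerDl sumr_ge0// => z _.
by rewrite mulr_ge0// pker_ge0.
Qed.

Lemma Pop_sum I (r : seq I) (F : I -> G -> R) x :
  P (fun y => \sum_(i <- r) F i y) x = \sum_(i <- r) P (F i) x.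
Proof.
elim: r => [|i r IH]; first by under eq_Pop do rewrite big_nil; rewrite big_nil Pop_cst.
rewrite big_cons -IH -PopD; apply: eq_Pop => y _; by rewrite big_cons.
Qed.

Lemma Pop_norm f x : `|P f x| <= P (fun y => `|f y|) x.
Proof.
rewrite !PopE (le_trans (ler_norm_sum _ _ _))//; apply: ler_sum => y _.
by rewrite normrM (ger0_norm (pker_ge0 _ _)).
Qed.

Lemma Pop_var f x : P (fun y => (f y - P f x) ^+ 2) x =
  P (fun y => f y ^+ 2) x - P f x ^+ 2.
Proof.
have -> : (fun y => (f y - P f x) ^+ 2) =
    (fun y => (f y ^+ 2 - (2 * P f x) * f y) + P f x ^+ 2).
  by apply: funext => y; ring.
by rewrite PopD PopB PopZ Pop_cst; ring.
Qed.

Lemma Pop_sqr f x : P f x ^+ 2 <= P (fun y => f y ^+ 2) x.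
Proof. by rewrite -subr_ge0 -Pop_var; apply: Pop_ge0 => y _; exact: sqr_ge0. Qed.

(** ** Integration against the vertex weight *)

Definition integrable F := absum (fun x => F x * m x).

Definition mint F : R := tsum (fun x => F x * m x).

Lemma vweight_ge0 x : 0 <= m x. Proof. exact/ltW/vweight_gt0. Qed.

Lemma integrable_le g f : (forall x, `|f x| <= g x) -> integrable g -> integrable f.
Proof.
move=> fg; apply: absum_le => x.
by rewrite normrM (ger0_norm (vweight_ge0 x)) ler_wpM2r// vweight_ge0.
Qed.

Lemma integrable_abs f : integrable f -> integrable (fun x => `|f x|).
Proof.
move=> /absum_abs; apply: absum_le => x.
by rewrite !normrM normr_id.
Qed.

Lemma integrable_leabs g f : (forall x, `|f x| <= `|g x|) -> integrable g -> integrable f.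
Proof. by move=> fg /integrable_abs; exact: integrable_le. Qed.

Lemma integrableD f g : integrable f -> integrable g ->
  integrable (fun x => f x + g x).
Proof.
move=> hf hg; have := absumD hf hg; rewrite /integrable.
by under [X in absum X]eq_fun do rewrite -mulrDl.
Qed.

Lemma integrableZ c f : integrable f -> integrable (fun x => c * f x).
Proof.
move=> /(absumZ c); rewrite /integrable.
by under [X in absum X]eq_fun do rewrite mulrA.
Qed.

Lemma integrableB f g : integrable f -> integrable g ->
  integrable (fun x => f x - g x).
Proof.
move=> hf hg; apply: integrableD => //.
by apply: integrable_leabs hg => x; rewrite normrN.
Qed.

Lemma mintD f g : integrable f -> integrable g ->
  mint (fun x => f x + g x) = mint f + mint g.
Proof.
move=> hf hg; rewrite /mint -tsumD//; apply: eq_tsum => x; exact: mulrDl.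
Qed.

Lemma mintZ c f : integrable f -> mint (fun x => c * f x) = c * mint f.
Proof.
move=> hf; rewrite /mint -tsumZ//; apply: eq_tsum => x; exact/esym/mulrA.
Qed.

Lemma mintB f g : integrable f -> integrable g ->
  mint (fun x => f x - g x) = mint f - mint g.
Proof.
move=> hf hg; rewrite /mint -tsumB//; apply: eq_tsum => x; exact: mulrBl.
Qed.

Lemma eq_mint f g : f =1 g -> mint f = mint g.
Proof. by move=> /funext ->. Qed.

Lemma mint_ge0 f : (forall x, 0 <= f x) -> 0 <= mint f.
Proof. by move=> f0; apply: tsum_ge0 => x; rewrite mulr_ge0// vweight_ge0. Qed.

Lemma le_mint f g : integrable f -> integrable g -> (forall x, f x <= g x) ->
  mint f <= mint g.
Proof.
by move=> hf hg fg; apply: le_tsum => // x; rewrite ler_wpM2r// vweight_ge0.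
Qed.

Lemma sum_le_mint f (A : seq G) : uniq A -> (forall x, 0 <= f x) -> integrable f ->
  \sum_(x <- A) f x * m x <= mint f.
Proof.
move=> uA f0 hf; apply: sums_le_tsum => // x.
by rewrite mulr_ge0// vweight_ge0.
Qed.

Lemma mint_le f K : (forall x, 0 <= f x) ->
  (forall A : seq G, uniq A -> \sum_(x <- A) f x * m x <= K) -> mint f <= K.
Proof.
by move=> f0; apply: tsum_sums_le => x; rewrite mulr_ge0// vweight_ge0.
Qed.

Lemma integrable_ge0P f : (forall x, 0 <= f x) ->
  (exists K, forall A : seq G, uniq A -> \sum_(x <- A) f x * m x <= K) -> integrable f.
Proof.
by move=> f0 h; apply/absum_ge0P => // x; rewrite mulr_ge0// vweight_ge0.
Qed.

Lemma integrable_finsupp f (A : seq G) : (forall x, x \notin A -> f x = 0) ->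
  integrable f.
Proof. by move=> fA; apply: (absum_finsupp (A := A)) => x /fA ->; rewrite mul0r. Qed.

Lemma mint_finsupp f (A : seq G) : uniq A -> (forall x, x \notin A -> f x = 0) ->
  mint f = \sum_(x <- A) f x * m x.
Proof. by move=> uA fA; apply: tsum_finsupp => // x /fA ->; rewrite mul0r. Qed.

Lemma mint_point f x : (forall x, 0 <= f x) -> integrable f -> f x * m x <= mint f.
Proof.
move=> f0 hf; apply: (ler_tsum_point (F := fun x => f x * m x)) => // y.
by rewrite mulr_ge0// vweight_ge0.
Qed.

(** ** Reversibility *)

Lemma Pop_vweight F x : P F x * m x = \sum_(y <- nbh x) mu x y * F y.
Proof.
rewrite PopE mulr_suml; apply: eq_bigr => y _; rewrite /pker mulrAC divfK//.
by rewrite gt_eqF// vweight_gt0.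
Qed.

Lemma esum_Pop (H : G -> G -> R) : (forall x y, 0 <= H x y) ->
  \esum_(x in [set: G]) (P (H x) x * m x)%:E =
  \esum_(x in [set: G]) \esum_(y in [set: G]) (mu x y * H x y)%:E.
Proof.
move=> H0; apply: eq_esum => x _.
have H0' y : 0 <= mu x y * H x y by rewrite mulr_ge0// mu_ge0.
have supp y : y \notin nbh x -> mu x y * H x y = 0.
  by rewrite mem_nbh => /nadj_mu ->; rewrite mul0r.
rewrite -tsum_esum//; last exact: absum_finsupp supp.
by rewrite (tsum_finsupp (nbh_uniq x) supp) Pop_vweight.
Qed.

Lemma esum_Pop_flip (H : G -> G -> R) : (forall x y, 0 <= H x y) ->
  \esum_(x in [set: G]) (P (H x) x * m x)%:E =
  \esum_(x in [set: G]) (P (H^~ x) x * m x)%:E.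
Proof.
move=> H0; rewrite !esum_Pop// esum_swap; last first.
  by move=> x y; rewrite lee_fin mulr_ge0// mu_ge0.
by apply: eq_esum => x _; apply: eq_esum => y _; rewrite mu_sym.
Qed.

Lemma integrable_flip_ge0 (H : G -> G -> R) : (forall x y, 0 <= H x y) ->
  integrable (fun x => P (H x) x) -> integrable (fun x => P (H^~ x) x).
Proof.
move=> H0 hH.
have h1 x : 0 <= P (H x) x * m x by rewrite mulr_ge0 ?vweight_ge0// Pop_ge0.
have h2 x : 0 <= P (H^~ x) x * m x by rewrite mulr_ge0 ?vweight_ge0// Pop_ge0.
move/absum_ge0P: hH => /(_ h1)[K /(esum_leP _ h1) hK].
by apply/(absum_ge0P h2); exists K; apply/(esum_leP _ h2); rewrite -esum_Pop_flip.
Qed.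

Lemma mint_flip_ge0 (H : G -> G -> R) : (forall x y, 0 <= H x y) ->
  mint (fun x => P (H x) x) = mint (fun x => P (H^~ x) x).
Proof.
move=> H0; rewrite /mint [LHS]tsum_ge0E; last first.
  by move=> x; rewrite mulr_ge0 ?vweight_ge0// Pop_ge0.
rewrite esum_Pop_flip// [RHS]tsum_ge0E// => x.
by rewrite mulr_ge0 ?vweight_ge0// Pop_ge0.
Qed.

Lemma integrable_Popabs (H H' : G -> G -> R) :
  (forall x y, `|H' x y| <= `|H x y|) ->
  integrable (fun x => P (fun y => `|H x y|) x) -> integrable (fun x => P (H' x) x).
Proof.
move=> HH'; apply: integrable_le => x; rewrite (le_trans (Pop_norm _ _))//.
by apply: le_Pop.
Qed.

(** Reversibility says that the measure [m x * p x y] on pairs is invariant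
    under exchanging [x] and [y]. Self-adjointness, invariance of [m] under [P],
    and the Dirichlet form are all instances of this. *)
Lemma mint_flip (H : G -> G -> R) :
  integrable (fun x => P (fun y => `|H x y|) x) ->
  mint (fun x => P (H x) x) = mint (fun x => P (H^~ x) x).
Proof.
move=> hH.
pose A x y := Num.max (H x y) 0; pose B x y := Num.max (- H x y) 0.
have A0 x y : 0 <= A x y by rewrite le_max lexx orbT.
have B0 x y : 0 <= B x y by rewrite le_max lexx orbT.
have AH x y : `|A x y| <= `|H x y|.
  by rewrite /A; case: (leP (H x y) 0); rewrite ?normr0.
have BH x y : `|B x y| <= `|H x y|.
  by rewrite /B; case: (leP (- H x y) 0); rewrite ?normr0 ?normrN.
have HAB x y : H x y = A x y - B x y.
  by rewrite /A /B; case: (leP (H x y) 0); case: (leP (- H x y) 0) => *; lra.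
have hA := integrable_Popabs AH hH; have hB := integrable_Popabs BH hH.
have -> : (fun x => P (H x) x) = (fun x => P (A x) x - P (B x) x).
  by apply: funext => x; rewrite -PopB; apply: eq_Pop => y _.
have -> : (fun x => P (H^~ x) x) = (fun x => P (A^~ x) x - P (B^~ x) x).
  by apply: funext => x; rewrite -PopB; apply: eq_Pop => y _.
rewrite mintB// mintB.
- by congr (_ - _); exact: mint_flip_ge0.
- exact: integrable_flip_ge0.
- exact: integrable_flip_ge0.
Qed.

Lemma integrable_Pop F : integrable F -> integrable (P F).
Proof.
move=> /integrable_abs hF.
have : integrable (fun x => P (fun=> `|F x|) x).
  by under [X in integrable X]eq_fun do rewrite Pop_cst.
move=> /(@integrable_flip_ge0 (fun x _ => `|F x|))/= h.
by apply: integrable_le (h _) => // x; exact: Pop_norm.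
Qed.

Lemma mint_Pop F : integrable F -> mint (P F) = mint F.
Proof.
move=> hF; have -> : mint F = mint (fun x => P (fun=> F x) x).
  by apply: eq_mint => x; rewrite Pop_cst.
apply/esym/(@mint_flip (fun x _ => F x)).
under [X in integrable X]eq_fun do rewrite Pop_cst.
exact: integrable_abs.
Qed.

Lemma mint_sum I (r : seq I) (F : I -> G -> R) :
  (forall i, integrable (F i)) ->
  integrable (fun x => \sum_(i <- r) F i x) /\
  mint (fun x => \sum_(i <- r) F i x) = \sum_(i <- r) mint (F i).
Proof.
move=> hF; elim: r => [|i r [IH1 IH2]].
  have -> : (fun x => \sum_(i <- [::]) F i x) = (fun=> 0).
    by apply: funext => x; rewrite big_nil.
  split; first exact: (@integrable_finsupp _ [::]).
  by rewrite big_nil (@mint_finsupp _ [::])// big_nil.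
have -> : (fun x => \sum_(i <- i :: r) F i x) =
    (fun x => F i x + \sum_(i <- r) F i x).
  by apply: funext => x; rewrite big_cons.
by split; [exact: integrableD|rewrite mintD// IH2 big_cons].
Qed.

End Markov.

Arguments Pop_cst {R G} mu c x.
Arguments nbh {R G} mu x.
Arguments mint {R G} mu F.
Arguments integrable {R G} mu F.

(** * The Hilbert space of square-integrable functions, and the gradient *)

Lemma discriminant_le {R : realFieldType} (a b c : R) : 0 <= b ->
  (forall t, 0 <= a + 2 * t * c + t ^+ 2 * b) -> c ^+ 2 <= a * b.
Proof.
move=> b0 h; have [b_eq0|b_neq0] := eqVneq b 0.
  have [->|c0] := eqVneq c 0; first by rewrite b_eq0 expr0n/= mulr0.
  have := h (- (a + 1) / (2 * c)); rewrite b_eq0 mulr0 addr0.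
  have -> : 2 * (- (a + 1) / (2 * c)) * c = - (a + 1) by field.
  by move=> *; lra.
have := h (- c / b).
have -> : a + 2 * (- c / b) * c + (- c / b) ^+ 2 * b = (a * b - c ^+ 2) / b.
  by field.
by rewrite pmulr_lge0 ?invr_gt0 ?lt_def ?b_neq0// subr_ge0.
Qed.

Lemma normM_le_sqr {R : realDomainType} (a b : R) : 2 * `|a * b| <= a ^+ 2 + b ^+ 2.
Proof.
by case: (ger0P (a * b)) => _; have := sqr_ge0 (a - b); have := sqr_ge0 (a + b); lra.
Qed.

Section L2.
Context {R : realType} {G : countType} {mu : reversible_graph R G}.
Implicit Types (x y z : G) (f g h F : G -> R) (c : R) (l : nat).

Local Notation m := (vweight mu).
Local Notation P := (Pop mu).
Local Notation p := (pker mu).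
Local Notation mint := (mint mu).
Local Notation integrable := (integrable mu).

Definition L2 f := integrable (fun x => f x ^+ 2).

Definition ip f g := mint (fun x => f x * g x).

Definition nsq f := ip f f.

Lemma nsqE f : nsq f = mint (fun x => f x ^+ 2).
Proof. by apply: eq_mint => x; rewrite expr2. Qed.

Lemma L2_mul f g : L2 f -> L2 g -> integrable (fun x => f x * g x).
Proof.
move=> hf hg; apply: integrable_le (integrableD hf hg) => x.
have := normM_le_sqr (f x) (g x); have := normr_ge0 (f x * g x); lra.
Qed.

Lemma L2_le f g : (forall x, `|f x| <= `|g x|) -> L2 g -> L2 f.
Proof.
move=> fg; apply: integrable_le => x; rewrite normrX -[leRHS]ger0_norm ?sqr_ge0//.
by rewrite normrX lerXn2r// nnegrE.
Qed.

Lemma L2D f g : L2 f -> L2 g -> L2 (fun x => f x + g x).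
Proof.
move=> hf hg; apply: integrable_le (integrableZ 2 (integrableD hf hg)) => x.
by rewrite ger0_norm ?sqr_ge0//; have := sqr_ge0 (f x - g x); nra.
Qed.

Lemma L2Z c f : L2 f -> L2 (fun x => c * f x).
Proof.
by move=> /(integrableZ (c ^+ 2)); apply: integrable_leabs => x; rewrite exprMn.
Qed.

Lemma L2B f g : L2 f -> L2 g -> L2 (fun x => f x - g x).
Proof. by move=> hf hg; apply: L2D => //; apply: L2_le hg => x; rewrite normrN. Qed.

Lemma L2_Pop f : L2 f -> L2 (P f).
Proof.
move=> /integrable_Pop; apply: integrable_le => x.
by rewrite ger0_norm ?sqr_ge0//; exact: Pop_sqr.
Qed.

Lemma L2_iter l f : L2 f -> L2 (iter l P f).
Proof. by move=> hf; elim: l => //= l; exact: L2_Pop. Qed.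

Lemma L2_finsupp f (A : seq G) : (forall x, x \notin A -> f x = 0) -> L2 f.
Proof. by move=> fA; apply: (integrable_finsupp (A := A)) => x /fA ->; rewrite expr0n. Qed.

Lemma L2_sum I (r : seq I) (F : I -> G -> R) : (forall i, L2 (F i)) ->
  L2 (fun x => \sum_(i <- r) F i x).
Proof.
move=> hF; elim: r => [|i r IH].
  by apply: (L2_finsupp (A := [::])) => x _; rewrite big_nil.
have -> : (fun x => \sum_(i <- i :: r) F i x) =
    (fun x => F i x + \sum_(i <- r) F i x).
  by apply: funext => x; rewrite big_cons.
exact: L2D.
Qed.

Lemma ipC f g : ip f g = ip g f.
Proof. by apply: eq_mint => x; rewrite mulrC. Qed.

Lemma ipDl f g h : L2 f -> L2 g -> L2 h ->
  ip (fun x => f x + g x) h = ip f h + ip g h.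
Proof.
move=> hf hg hh; rewrite /ip -mintD; try exact: L2_mul.
by apply: eq_mint => x; rewrite mulrDl.
Qed.

Lemma ipZl c f h : L2 f -> L2 h -> ip (fun x => c * f x) h = c * ip f h.
Proof.
move=> hf hh; rewrite /ip -mintZ; last exact: L2_mul.
by apply: eq_mint => x; rewrite mulrA.
Qed.

Lemma ipBl f g h : L2 f -> L2 g -> L2 h ->
  ip (fun x => f x - g x) h = ip f h - ip g h.
Proof.
move=> hf hg hh; rewrite /ip -mintB; try exact: L2_mul.
by apply: eq_mint => x; rewrite mulrBl.
Qed.

Lemma ipDr f g h : L2 f -> L2 g -> L2 h ->
  ip h (fun x => f x + g x) = ip h f + ip h g.
Proof. by move=> *; rewrite ipC ipDl// !(ipC h). Qed.

Lemma ipZr c f h : L2 f -> L2 h -> ip h (fun x => c * f x) = c * ip h f.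
Proof. by move=> *; rewrite ipC ipZl// ipC. Qed.

Lemma ipBr f g h : L2 f -> L2 g -> L2 h ->
  ip h (fun x => f x - g x) = ip h f - ip h g.
Proof. by move=> *; rewrite ipC ipBl// !(ipC h). Qed.

Lemma ip_suml I (r : seq I) (F : I -> G -> R) h : (forall i, L2 (F i)) -> L2 h ->
  ip (fun x => \sum_(i <- r) F i x) h = \sum_(i <- r) ip (F i) h.
Proof.
move=> hF hh; elim: r => [|i r IH].
  rewrite big_nil /ip (mint_finsupp (A := [::]))// ?big_nil// => x _.
  by rewrite big_nil mul0r.
have -> : (fun x => \sum_(i <- i :: r) F i x) =
    (fun x => F i x + \sum_(i <- r) F i x).
  by apply: funext => x; rewrite big_cons.
by rewrite ipDl ?IH ?big_cons//; exact: L2_sum.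
Qed.

Lemma nsq_ge0 f : 0 <= nsq f.
Proof. by rewrite nsqE mint_ge0// => x; exact: sqr_ge0. Qed.

Lemma nsqD f g : L2 f -> L2 g ->
  nsq (fun x => f x + g x) = nsq f + 2 * ip f g + nsq g.
Proof.
move=> hf hg; rewrite /nsq ipDl ?ipDr// ?(ipC g f); try exact: L2D.
by ring.
Qed.

Lemma nsqB f g : L2 f -> L2 g ->
  nsq (fun x => f x - g x) = nsq f - 2 * ip f g + nsq g.
Proof.
move=> hf hg; rewrite /nsq ipBl ?ipBr// ?(ipC g f); try exact: L2B.
by ring.
Qed.

Lemma nsqZ c f : L2 f -> nsq (fun x => c * f x) = c ^+ 2 * nsq f.
Proof. by move=> hf; rewrite /nsq ipZl ?ipZr// ?mulrA ?expr2//; exact: L2Z. Qed.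

Lemma cauchy_schwarz f g : L2 f -> L2 g -> ip f g ^+ 2 <= nsq f * nsq g.
Proof.
move=> hf hg; apply: discriminant_le => [|t]; first exact: nsq_ge0.
have := nsq_ge0 (fun x => f x + t * g x); rewrite nsqD ?nsqZ ?ipZr//; last exact: L2Z.
by move=> h; rewrite -mulrA.
Qed.

Lemma nsqD_le f g : L2 f -> L2 g -> nsq (fun x => f x + g x) <= 2 * (nsq f + nsq g).
Proof.
move=> hf hg; have := nsq_ge0 (fun x => f x - g x).
by rewrite nsqB ?nsqD// => *; lra.
Qed.

Lemma nsqB_le f g : L2 f -> L2 g -> nsq (fun x => f x - g x) <= 2 * (nsq f + nsq g).
Proof.
move=> hf hg; have := nsq_ge0 (fun x => f x + g x).
by rewrite nsqB ?nsqD// => *; lra.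
Qed.

Lemma nsq_point f x : L2 f -> f x ^+ 2 * m x <= nsq f.
Proof.
move=> hf; rewrite nsqE; apply: (mint_point (f := fun x => f x ^+ 2)) => // y.
exact: sqr_ge0.
Qed.

Lemma ip_Pop f g : L2 f -> L2 g -> ip (P f) g = ip f (P g).
Proof.
move=> hf hg; have -> : ip (P f) g = mint (fun x => P (fun y => g x * f y) x).
  by apply: eq_mint => x; rewrite PopZ mulrC.
have -> : ip f (P g) = mint (fun x => P (fun y => g y * f x) x).
  by apply: eq_mint => x; rewrite PopZr mulrC.
apply: (@mint_flip _ _ mu (fun x y => g x * f y)).
have /integrable_le : integrable (fun x => g x ^+ 2 + P (fun y => f y ^+ 2) x).
  by apply: integrableD => //; exact: integrable_Pop.
apply => x; rewrite ger0_norm; last exact: Pop_ge0.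
rewrite -[X in X + _](Pop_cst mu (g x ^+ 2) x) -PopD; apply: le_Pop => y _.
have := normM_le_sqr (g x) (f y); have := normr_ge0 (g x * f y); lra.
Qed.

Lemma ip_iter l f g : L2 f -> L2 g -> ip (iter l P f) g = ip f (iter l P g).
Proof.
move=> hf hg; elim: l => //= l IH in g hg *.
by rewrite ip_Pop ?IH -?iterSr//; [exact: L2_Pop|exact: L2_iter].
Qed.

Lemma nsq_Pop f : L2 f -> nsq (P f) <= nsq f.
Proof.
move=> hf; rewrite !nsqE -(mint_Pop hf); apply: le_mint => [||x].
- exact: L2_Pop.
- exact: integrable_Pop.
- exact: Pop_sqr.
Qed.

Lemma nsq_iter l f : L2 f -> nsq (iter l P f) <= nsq f.
Proof.
move=> hf; elim: l => //= l; apply: le_trans; apply: nsq_Pop; exact: L2_iter.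
Qed.

Lemma ip_iter_le l f : L2 f -> `|ip (iter l P f) f| <= nsq f.
Proof.
move=> hf; rewrite -(ler_pXn2r (n := 2))// ?nnegrE ?nsq_ge0// real_normK ?num_real//.
rewrite (le_trans (cauchy_schwarz _ _))//; first exact: L2_iter.
by rewrite expr2 ler_wpM2r ?nsq_ge0// nsq_iter.
Qed.

(** ** The gradient *)

Lemma gradientE f x : gradient mu f x =
  Num.sqrt (2^-1 * P (fun y => (f y - f x) ^+ 2) x).
Proof.
rewrite /gradient; congr (Num.sqrt (_ * _)).
by apply: eq_fsbigr => y _; rewrite real_normK ?num_real.
Qed.

Lemma gradient_ge0 f x : 0 <= gradient mu f x.
Proof. exact: sqrtr_ge0. Qed.

Lemma gradient_sqr f x :
  gradient mu f x ^+ 2 = 2^-1 * P (fun y => (f y - f x) ^+ 2) x.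
Proof.
rewrite gradientE sqr_sqrtr// mulr_ge0// Pop_ge0// => y _; exact: sqr_ge0.
Qed.

Lemma gradientZ c f x : gradient mu (fun y => c * f y) x = `|c| * gradient mu f x.
Proof.
rewrite !gradientE -sqrtr_sqr -sqrtrM ?sqr_ge0// [in RHS]mulrCA -[c ^+ 2 * _]PopZ.
by congr (Num.sqrt (_ * _)); congr Pop; apply: funext => y; ring.
Qed.

Lemma gradientD f g x :
  gradient mu (fun y => f y + g y) x <= gradient mu f x + gradient mu g x.
Proof.
rewrite -(ler_pXn2r (n := 2)) ?nnegrE ?addr_ge0 ?gradient_ge0// sqrrD !gradient_sqr.
set a := P _ x; set b := P _ x; set d := P _ x.
pose c := P (fun y => (f y - f x) * (g y - g x)) x.
have b0 : 0 <= b by apply: Pop_ge0 => y _; exact: sqr_ge0.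
have d0 : 0 <= d by apply: Pop_ge0 => y _; exact: sqr_ge0.
have aE t : P (fun y => ((f y - f x) + t * (g y - g x)) ^+ 2) x =
    b + 2 * t * c + t ^+ 2 * d.
  by rewrite /b /c /d -!PopZ -!PopD; congr Pop; apply: funext => y; ring.
have cs : c ^+ 2 <= b * d.
  apply: discriminant_le => // t; rewrite -aE.
  by apply: Pop_ge0 => y _; exact: sqr_ge0.
have {}aE : a = b + 2 * c + d.
  have -> : a = P (fun y => ((f y - f x) + 1 * (g y - g x)) ^+ 2) x.
    by congr Pop; apply: funext => y; ring.
  by rewrite aE; ring.
have {cs} : c <= 2 * (gradient mu f x * gradient mu g x).
  rewrite (le_trans (ler_norm _))// -(ler_pXn2r (n := 2)) ?nnegrE//; last first.
    by rewrite !mulr_ge0 ?gradient_ge0.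
  rewrite real_normK ?num_real// !exprMn !gradient_sqr -/b -/d.
  by apply: le_trans cs _; rewrite le_eqVlt; apply/orP; left; apply/eqP; field.
by rewrite aE => *; lra.
Qed.

Lemma gradient_sum I (r : seq I) (F : I -> G -> R) x :
  gradient mu (fun y => \sum_(i <- r) F i y) x <= \sum_(i <- r) gradient mu (F i) x.
Proof.
elim: r => [|i r IH].
  rewrite big_nil; have -> : (fun y => \sum_(i <- [::]) F i y) = (fun y => 0 * 0).
    by apply: funext => y; rewrite big_nil mul0r.
  by rewrite (gradientZ 0 (fun=> 0)) normr0 mul0r.
have -> : (fun x => \sum_(i <- i :: r) F i x) =
    (fun x => F i x + \sum_(i <- r) F i x).
  by apply: funext => y; rewrite big_cons.
by rewrite big_cons (le_trans (gradientD _ _ _))// lerD2l.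
Qed.

Lemma gradient_dist f g x :
  `|gradient mu f x - gradient mu g x| <= gradient mu (fun y => f y - g y) x.
Proof.
have e1 : (fun y => f y + (-1) * (f y - g y)) = g by apply: funext => y; ring.
have e2 : (fun y => g y + (f y - g y)) = f by apply: funext => y; ring.
have := gradientD f (fun y => (-1) * (f y - g y)) x.
have := gradientD g (fun y => f y - g y) x.
rewrite e1 e2 gradientZ normrN1 mul1r => h1 h2.
by rewrite ler_norml; apply/andP; split; lra.
Qed.

Lemma gradient_sqr_le f x :
  gradient mu f x ^+ 2 <= P (fun y => f y ^+ 2) x + f x ^+ 2.
Proof.
rewrite gradient_sqr -[X in _ + X](Pop_cst mu (f x ^+ 2) x) -PopD -PopZ.
apply: le_Pop => y _; have := sqr_ge0 (f y + f x); nra.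
Qed.

Lemma L2_gradient f : L2 f -> L2 (gradient mu f).
Proof.
move=> hf; apply: integrable_le (integrableD (integrable_Pop hf) hf) => x.
rewrite ger0_norm ?sqr_ge0//; exact: gradient_sqr_le.
Qed.

(** Integration by parts. *)
Lemma nsq_gradient f : L2 f -> nsq (gradient mu f) = ip (laplacian mu f) f.
Proof.
move=> hf; have hPf := integrable_Pop hf.
have hfPf : integrable (fun x => f x * P f x) by apply: L2_mul => //; exact: L2_Pop.
have -> : nsq (gradient mu f) =
    mint (fun x => 2^-1 * ((P (fun y => f y ^+ 2) x + f x ^+ 2) - 2 * (f x * P f x))).
  rewrite nsqE; apply: eq_mint => x; rewrite gradient_sqr; congr (_ * _).
  rewrite -[in RHS](Pop_cst mu (f x ^+ 2) x) -!PopZ -PopD -PopB.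
  by congr Pop; apply: funext => y; ring.
have hD := integrableD hPf hf; have hZ := integrableZ 2 hfPf.
rewrite mintZ; last exact: (integrableB hD hZ).
rewrite (mintB hD hZ) (mintD hPf hf) (mintZ _ hfPf) (mint_Pop hf).
rewrite /laplacian ipBl//; last exact: L2_Pop.
rewrite -/(nsq f) nsqE (ipC _ f) /ip.
by field.
Qed.

Lemma L2_laplacian f : L2 f -> L2 (laplacian mu f).
Proof. by move=> hf; apply: L2B => //; exact: L2_Pop. Qed.

(** The energy lost in one step of the walk controls the increment, because a
    lazy step keeps a fixed share of the variance at the current vertex. *)
Lemma nsq_laplacian_lazy eps f : (forall x, eps <= p x x) -> L2 f ->
  eps * nsq (laplacian mu f) <= nsq f - nsq (P f).
Proof.
move=> lazy hf; have hPf := integrable_Pop hf; have hPf2 := L2_Pop hf.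
rewrite !nsqE -[X in _ <= X - _](mint_Pop hf) -(mintZ _ (L2_laplacian hf)) -(mintB hPf hPf2).
apply: le_mint => [||x]; [exact/integrableZ/L2_laplacian|exact: integrableB|].
rewrite -Pop_var.
have := @Pop_point _ _ mu (fun y => (f y - P f x) ^+ 2) x x (fun y => sqr_ge0 _).
by apply: le_trans; rewrite ler_wpM2r// sqr_ge0.
Qed.

End L2.
Arguments L2 {R G} mu f.
Arguments ip {R G} mu f g.
Arguments nsq {R G} mu f.

(** * Polynomials in the Markov operator *)

Section Polynomials.
Context {R : realType} {G : countType} {mu : reversible_graph R G}.
Implicit Types (x y z : G) (f g h F : G -> R) (c : R) (q : {poly R}) (l n N : nat).

Local Notation P := (Pop mu).
Local Notation L2 := (L2 mu).
Local Notation ip := (ip mu).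

Lemma iterPD l f g :
  iter l P (fun y => f y + g y) = (fun y => iter l P f y + iter l P g y).
Proof. by elim: l => //= l ->; apply: funext => y; rewrite PopD. Qed.

Lemma iterPZ l c f : iter l P (fun y => c * f y) = (fun y => c * iter l P f y).
Proof. by elim: l => //= l ->; apply: funext => y; rewrite PopZ. Qed.

Lemma iterP_sum l I (r : seq I) (F : I -> G -> R) :
  iter l P (fun y => \sum_(i <- r) F i y) = (fun y => \sum_(i <- r) iter l P (F i) y).
Proof. by elim: l => //= l ->; apply: funext => y; rewrite Pop_sum. Qed.

Lemma iterP_ge0 l f x : (forall y, 0 <= f y) -> 0 <= iter l P f x.
Proof. by move=> f0; elim: l x => //= l IH x; apply: Pop_ge0 => y _. Qed.

Lemma iterP_norm l f x : `|iter l P f x| <= iter l P (fun y => `|f y|) x.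
Proof.
elim: l x => //= l IH x; rewrite (le_trans (Pop_norm _ _))//.
by apply: le_Pop => y _.
Qed.

(** With this, an estimate for finitely supported functions applies to arbitrary
    functions as long as it is read on a finite set of vertices. *)
Lemma iterP_local l x : exists D : seq G, forall f g,
  {in D, f =1 g} -> iter l P f x = iter l P g x.
Proof.
elim: l x => [|l IH] x.
  by exists [:: x] => f g fg; rewrite /= fg// mem_head.
have [D hD] := choice IH.
exists (flatten [seq D y | y <- nbh mu x]) => f g fg /=.
apply: eq_Pop => y xy; apply: hD => z zD; apply: fg.
by apply/flattenP; exists (D y) => //; apply: map_f; rewrite mem_nbh.
Qed.

Lemma iterP_finsupp l f (A : seq G) : (forall x, x \notin A -> f x = 0) ->
  exists B : seq G, forall x, x \notin B -> iter l P f x = 0.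
Proof.
move=> fA; elim: l => [|l [B hB]]; first by exists A.
exists (flatten [seq nbh mu y | y <- B]) => x xB /=.
rewrite -(Pop_cst mu 0 x); apply: eq_Pop => y xy; apply: hB.
apply: contra xB => yB; apply/flattenP; exists (nbh mu y); first exact: map_f.
by rewrite mem_nbh adj_sym.
Qed.

Definition pop q f : G -> R := fun x => \sum_(i < size q) q`_i * iter i P f x.

Lemma popE n q f : (size q <= n)%N ->
  pop q f = (fun x => \sum_(i < n) q`_i * iter i P f x).
Proof.
move=> qn; apply: funext => x; rewrite /pop.
rewrite (big_ord_widen n (fun i => q`_i * iter i P f x) qn) big_mkcond/=.
by apply: eq_bigr => i _; case: ltnP => // /(nth_default 0) ->; rewrite mul0r.
Qed.

Lemma popD q q' f : pop (q + q') f = (fun x => pop q f x + pop q' f x).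
Proof.
pose n := maxn (size q) (size q').
rewrite (@popE n q) ?leq_maxl// (@popE n q') ?leq_maxr// (@popE n) ?size_polyD//.
by apply: funext => x; rewrite -big_split; apply: eq_bigr => i _; rewrite coefD mulrDl.
Qed.

Lemma popZ c q f : pop (c *: q) f = (fun x => c * pop q f x).
Proof.
rewrite (@popE (size q)) ?size_scale_leq//; apply: funext => x.
by rewrite /pop mulr_sumr; apply: eq_bigr => i _; rewrite coefZ mulrA.
Qed.

Lemma popC c f : pop c%:P f = (fun x => c * f x).
Proof.
rewrite (@popE 1) ?size_polyC ?leq_b1//; apply: funext => x.
by rewrite big_ord_recl big_ord0 addr0 coefC.
Qed.

Lemma popXM q f : pop ('X * q) f = P (pop q f).
Proof.
rewrite (@popE (size q).+1); last first.
  by rewrite (leq_trans (size_polyMleq _ _))// size_polyX.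
apply: funext => x; rewrite big_ord_recl coefXM/= mul0r add0r.
rewrite /pop Pop_sum; apply: eq_bigr => i _.
by rewrite coefXM/= PopZ.
Qed.

Lemma pop_linear q c f g :
  pop q (fun x => c * f x + g x) = (fun x => c * pop q f x + pop q g x).
Proof.
apply: funext => x; rewrite /pop mulr_sumr -big_split; apply: eq_bigr => i _.
by rewrite iterPD iterPZ mulrDr mulrCA.
Qed.

Lemma popM q q' f : pop (q * q') f = pop q (pop q' f).
Proof.
elim/poly_ind: q => [|q c IH].
  rewrite mul0r -(scale0r 0) !popZ; apply: funext => x; rewrite !mul0r//.
have -> : (q * 'X + c%:P) * q' = 'X * (q * q') + c *: q'.
  by rewrite -mul_polyC; ring.
by rewrite popD popXM IH popZ mulrC popD popXM popC.
Qed.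

Lemma pop_comm q q' f : pop q (pop q' f) = pop q' (pop q f).
Proof. by rewrite -!popM mulrC. Qed.

Lemma pop1 f : pop 1 f = f.
Proof. by rewrite -polyC1 popC; apply: funext => x; rewrite mul1r. Qed.

Lemma pop_laplacian f : pop (1 - 'X) f = laplacian mu f.
Proof.
have -> : 1 - 'X = 1 + (-1) *: ('X * 1) :> {poly R} by rewrite mulr1 scaleN1r.
by rewrite popD popZ popXM !pop1; apply: funext => x; rewrite mulN1r.
Qed.

Lemma pop_iter k f : pop 'X^k f = iter k P f.
Proof. by elim: k f => [|k IH] f; [rewrite expr0 pop1|rewrite exprS popXM IH]. Qed.

Lemma L2_pop q f : L2 f -> L2 (pop q f).
Proof. by move=> hf; apply: L2_sum => i; exact/L2Z/L2_iter. Qed.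

Lemma ip_pop q f g : L2 f -> L2 g -> ip (pop q f) g = ip f (pop q g).
Proof.
have hZ i h : L2 h -> L2 (fun x => q`_i * iter i P h x).
  by move=> hh; exact/L2Z/L2_iter.
move=> hf hg; rewrite /pop ip_suml//; last by move=> i; exact: hZ.
rewrite ipC ip_suml//; last by move=> i; exact: hZ.
apply: eq_bigr => i _; rewrite !ipZl; try exact: L2_iter.
- by rewrite ip_iter// ipC.
- by [].
- by [].
Qed.

Lemma pop_local q x : exists D : seq G, forall f g,
  {in D, f =1 g} -> pop q f x = pop q g x.
Proof.
have [D hD] := choice (fun l => iterP_local l x).
exists (flatten [seq D i | i <- iota 0 (size q)]) => f g fg.
rewrite /pop; apply: eq_bigr => i _; congr (_ * _); apply: hD => y yD; apply: fg.
by apply/flattenP; exists (D i) => //; apply: map_f; rewrite mem_iota ltn_ord.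
Qed.

End Polynomials.

Arguments pop {R G} mu q f.
Arguments pop1 {R G} mu f.

(** * The coefficients of the inverse square root *)

Section Coefficients.
Context {R : realType}.
Implicit Types (k l n N : nat).

(** [binv l] is the coefficient of [z ^ l] in the power series of
    [(1 - z) ^ (- 1 / 2)]. *)
Definition binv l : R := \prod_(i < l) ((2 * i + 1)%:R / (2 * i + 2)%:R).

Lemma binv0 : binv 0 = 1. Proof. by rewrite /binv big_ord0. Qed.

Lemma binvS l : binv l.+1 = binv l * ((2 * l + 1)%:R / (2 * l + 2)%:R).
Proof. by rewrite /binv big_ord_recr. Qed.

Lemma binv_gt0 l : 0 < binv l.
Proof. by apply: prodr_gt0 => i _; rewrite divr_gt0// ltr0n; lia. Qed.

Lemma binv_decr l : binv l.+1 <= binv l.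
Proof.
rewrite binvS ler_piMr//; first exact/ltW/binv_gt0.
have h : 0 < (2 * l + 2)%:R :> R by rewrite ltr0n; lia.
by rewrite ler_pdivrMr// mul1r ler_nat; lia.
Qed.

Lemma binv_sqr l : binv l ^+ 2 * l.+1%:R <= 1.
Proof.
elim: l => [|l IH]; first by rewrite binv0 expr1n mulr1.
apply: le_trans IH; rewrite binvS exprMn -mulrA ler_wpM2l ?sqr_ge0//.
have e : (2 * l + 2)%:R = 2 * l.+1%:R :> R by rewrite -natrM mulnS addnC.
have -> : l.+2%:R = l.+1%:R + 1 :> R by rewrite -natr1.
have -> : (2 * l + 1)%:R = 2 * l.+1%:R - 1 :> R by rewrite -e natrD natrD; ring.
have l1 : 1 <= l.+1%:R :> R by rewrite ler1n.
rewrite e; set t := l.+1%:R in l1 *; have t0 : 0 < t by lra.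
rewrite expr_div_n mulrAC ler_pdivrMr; last by rewrite exprn_gt0// mulr_gt0.
by nra.
Qed.

Lemma binv_conv k : \sum_(i < k.+1) binv i * binv (k - i) = 1.
Proof.
elim: k => [|k IH]; first by rewrite big_ord_recl big_ord0 subnn binv0 mulr1 addr0.
pose c n := \sum_(i < n.+1) binv i * binv (n - i).
(* Exchanging [i] and [n - i] replaces the factor [i] by its mean [n / 2]. *)
have sym n : 2 * \sum_(i < n.+1) i%:R * (binv i * binv (n - i)) = n%:R * c n.
  rewrite [2]/(1 + 1) mulrDl mul1r {2}(reindex_inj rev_ord_inj)/= -big_split/=.
  rewrite /c mulr_sumr; apply: eq_bigr => i _; rewrite subSS subKn 1?leq_ord//.
  rewrite [X in _ + _ * X]mulrC -mulrDl -natrD subnKC// -ltnS//.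
have := sym k.+1; rewrite big_ord_recl mul0r add0r.
have -> : 2 * \sum_(i < k.+1) (bump 0 i)%:R * (binv (bump 0 i) * binv (k.+1 - bump 0 i))
    = \sum_(i < k.+1) (2 * i%:R * (binv i * binv (k - i)) + binv i * binv (k - i)).
  rewrite mulr_sumr; apply: eq_bigr => i _; rewrite /bump/= add1n subSS binvS.
  have -> : (2 * i + 2)%:R = 2 * i.+1%:R :> R by rewrite -natrM mulnS addnC.
  have -> : (2 * i + 1)%:R = 2 * i%:R + 1 :> R by rewrite natrD natrM.
  by have i0 : i.+1%:R != 0 :> R; [rewrite pnatr_eq0|field].
under eq_bigr do rewrite -mulrA.
rewrite big_split/= -mulr_sumr sym -/(c k) [c k]IH mulr1 natr1 => /esym.
by rewrite -{2}[k.+1%:R]mulr1 => /mulfI; apply; rewrite pnatr_eq0.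
Qed.

End Coefficients.

Lemma sqr_wsum_le {R : realFieldType} I (r : seq I) (Q : pred I) (w b : I -> R) :
  (forall i, Q i -> 0 <= w i) ->
  (\sum_(i <- r | Q i) w i * b i) ^+ 2 <=
  (\sum_(i <- r | Q i) w i) * (\sum_(i <- r | Q i) w i * b i ^+ 2).
Proof.
move=> w0; apply: discriminant_le => [|t].
  by apply: sumr_ge0 => i /w0 ?; rewrite mulr_ge0 ?sqr_ge0.
have -> : \sum_(i <- r | Q i) w i + 2 * t * \sum_(i <- r | Q i) w i * b i +
    t ^+ 2 * \sum_(i <- r | Q i) w i * b i ^+ 2 =
    \sum_(i <- r | Q i) w i * (1 + t * b i) ^+ 2.
  by rewrite !mulr_sumr -!big_split/=; apply: eq_bigr => i _; ring.
by apply: sumr_ge0 => i /w0 ?; rewrite mulr_ge0 ?sqr_ge0.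
Qed.

Lemma sqr_sum_le {R : realFieldType} I (r : seq I) (Q : pred I) (a b : I -> R) :
  (\sum_(i <- r | Q i) a i * b i) ^+ 2 <=
  (\sum_(i <- r | Q i) a i ^+ 2) * (\sum_(i <- r | Q i) b i ^+ 2).
Proof.
apply: discriminant_le => [|t]; first by apply: sumr_ge0 => i _; exact: sqr_ge0.
have -> : \sum_(i <- r | Q i) a i ^+ 2 + 2 * t * \sum_(i <- r | Q i) a i * b i +
    t ^+ 2 * \sum_(i <- r | Q i) b i ^+ 2 =
    \sum_(i <- r | Q i) (a i + t * b i) ^+ 2.
  by rewrite !mulr_sumr -!big_split/=; apply: eq_bigr => i _; ring.
by apply: sumr_ge0 => i _; exact: sqr_ge0.
Qed.

Section InvRoot.
Context {R : realType}.
Implicit Types (k l n N : nat).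

Definition invroot N : {poly R} := \poly_(l < N) binv l.

Lemma coef_invroot N l : (invroot N)`_l = if (l < N)%N then binv l else 0.
Proof. by rewrite coef_poly. Qed.

Lemma invroot_ge0 N l : 0 <= (invroot N)`_l.
Proof. by rewrite coef_invroot; case: ifP => // _; exact/ltW/binv_gt0. Qed.

Lemma invrootS_le N l : (invroot N)`_l.+1 <= (invroot N)`_l.
Proof.
rewrite !coef_invroot; case: ltnP => h1; case: ltnP => h2 //.
- exact: binv_decr.
- by exfalso; lia.
- exact/ltW/binv_gt0.
Qed.

Lemma invroot_le N l n : (l <= n)%N -> (invroot N)`_n <= (invroot N)`_l.
Proof.
move=> /subnK <-; elim: (n - l)%N => // k; apply: le_trans; exact: invrootS_le.
Qed.

Lemma invroot_sqr N l : (invroot N)`_l ^+ 2 * l.+1%:R <= 1.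
Proof.
rewrite coef_invroot; case: ifP => _; first exact: binv_sqr.
by rewrite expr0n mul0r ler01.
Qed.

Lemma invroot0 N : (0 < N)%N -> (invroot N)`_0 = 1.
Proof. by rewrite coef_invroot => ->; rewrite binv0. Qed.

(** A polynomial whose coefficients form a probability distribution on the
    exponents: its value at the Markov operator is again an averaging operator. *)
Definition is_pgf (w : {poly R}) := (forall k, 0 <= w`_k) /\ w.[1] = 1.

Lemma pgf_sum w n : is_pgf w -> (size w <= n)%N -> \sum_(k < n) w`_k = 1.
Proof.
move=> [_ <-] wn; rewrite (horner_coef_wide _ wn).
by apply: eq_bigr => i _; rewrite expr1n mulr1.
Qed.

Lemma coef1BXM (q : {poly R}) k :
  ((1 - 'X) * q)`_k = q`_k - (if k is k'.+1 then q`_k' else 0).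
Proof. by rewrite mulrBl mul1r coefB coefXM; case: k. Qed.

Lemma pgf_1BX (q : {poly R}) : q`_0 = 1 -> (forall k, q`_k.+1 <= q`_k) ->
  is_pgf (1 - (1 - 'X) * q).
Proof.
move=> q0 qS; split=> [k|]; last by rewrite !hornerE subrr mul0r subr0.
rewrite coefB coef1 coef1BXM; case: k => [|k]; first by rewrite q0 subr0 subrr.
by rewrite sub0r opprB subr_ge0 qS.
Qed.

Lemma coef_sqr_invroot N k : (invroot N ^+ 2)`_k =
  \sum_(i < k.+1) (invroot N)`_i * (invroot N)`_(k - i).
Proof. by rewrite expr2 coefM. Qed.

Lemma sqr_invroot_lt N k : (k < N)%N -> (invroot N ^+ 2)`_k = 1.
Proof.
move=> kN; rewrite coef_sqr_invroot -[RHS](binv_conv k); apply: eq_bigr => i _.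
rewrite !coef_invroot (leq_ltn_trans _ kN); last by rewrite -ltnS.
by rewrite (leq_ltn_trans _ kN)// leq_subr.
Qed.

(** From degree [N] on, the next coefficient of the square loses one term, and
    the others have one index raised, hence a smaller factor. *)
Lemma sqr_invrootS_le N k : (invroot N ^+ 2)`_k.+1 <= (invroot N ^+ 2)`_k.
Proof.
case: (ltnP k.+1 N) => kN; first by rewrite !sqr_invroot_lt ?lexx// (ltn_trans _ kN).
have z : (invroot N : {poly R})`_k.+1 = 0 by rewrite coef_invroot ltnNge kN.
rewrite !coef_sqr_invroot big_ord_recl subn0 z mulr0 add0r.
apply: ler_sum => i _; rewrite lift0 subSS ler_wpM2r ?invroot_ge0//.
exact: invrootS_le.
Qed.

(** The distance from [(1 - z) * invroot N ^ 2] to its limit, the constant 1. It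
    is an average of powers of exponent at least [N], because the coefficients of
    the square are 1 below degree [N] and decrease afterwards. *)
Definition defect N : {poly R} := 1 - (1 - 'X) * invroot N ^+ 2.

Lemma pgf_defect N : (0 < N)%N -> is_pgf (defect N).
Proof.
by move=> N0; apply: pgf_1BX; [exact: sqr_invroot_lt|exact: sqr_invrootS_le].
Qed.

Lemma defect_lt N k : (k < N)%N -> (defect N)`_k = 0.
Proof.
move=> kN; rewrite /defect coefB coef1 coef1BXM sqr_invroot_lt//.
case: k kN => [|k] kN; first by rewrite subr0 subrr.
by rewrite sqr_invroot_lt ?subrr// (ltn_trans _ kN).
Qed.

Lemma pgf_invroot N : (0 < N)%N -> is_pgf (1 - (1 - 'X) * invroot N).
Proof.
by move=> N0; apply: pgf_1BX; [exact: invroot0|exact: invrootS_le].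
Qed.

End InvRoot.

Section InvRootOperator.
Context {R : realType} {G : countType} {mu : reversible_graph R G}.
Implicit Types (x y z : G) (f g h F : G -> R) (c : R) (w q : {poly R}) (l n N : nat).

Local Notation P := (Pop mu).
Local Notation L2 := (L2 mu).
Local Notation ip := (ip mu).
Local Notation nsq := (nsq mu).
Local Notation pop := (pop mu).

Lemma nsq_iter_le n k f : L2 f -> (n <= k)%N -> nsq (iter k P f) <= nsq (iter n P f).
Proof.
by move=> hf nk; rewrite -(subnK nk) iterD; apply: nsq_iter; exact: L2_iter.
Qed.

Lemma nsq_pop_pgf w N f : is_pgf w -> (forall k, (k < N)%N -> w`_k = 0) -> L2 f ->
  nsq (pop w f) <= nsq (iter N P f).
Proof.
move=> wP wN hf; have [w0 _] := wP.
have hI k := L2_iter k hf.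
pose F x := \sum_(k < size w) w`_k * iter k P f x ^+ 2.
have hF (k : 'I_(size w)) : integrable mu (fun x => w`_k * iter k P f x ^+ 2).
  exact: integrableZ (hI k).
have [intF mintF] := mint_sum (index_enum 'I_(size w)) hF.
apply: (@le_trans _ _ (mint mu F)).
  rewrite nsqE; apply: le_mint => //; first exact: L2_pop.
  move=> x; apply: le_trans (sqr_wsum_le _ _ _) _ => //.
  by rewrite (pgf_sum wP)// mul1r.
rewrite mintF -[leRHS]mul1r -(pgf_sum wP (leqnn _)) mulr_suml.
apply: ler_sum => k _; rewrite mintZ; last exact: hI.
have [kN|kN] := ltnP k N; first by rewrite wN// !mul0r.
by rewrite -nsqE ler_wpM2l// nsq_iter_le.
Qed.

Lemma ip_pop_pgf w f : is_pgf w -> L2 f -> `|ip (pop w f) f| <= nsq f.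
Proof.
move=> wP hf; have [w0 _] := wP.
rewrite ip_suml//; last by move=> i; exact/L2Z/L2_iter.
rewrite (le_trans (ler_norm_sum _ _ _))// -[leRHS]mul1r -(pgf_sum wP (leqnn _)).
rewrite mulr_suml; apply: ler_sum => k _.
rewrite ipZl//; last exact: L2_iter.
by rewrite normrM (ger0_norm (w0 _)) ler_wpM2l// ip_iter_le.
Qed.

(** [dinv N] is a partial sum of the series for [Delta^(-1/2)]. Being a polynomial
    in [P] it makes sense on all functions and keeps supports finite. *)
Definition dinv N f : G -> R := pop (invroot N) f.

Definition truncated_riesz N f : G -> R := gradient mu (dinv N f).

Lemma popB q q' f : pop (q - q') f = (fun x => pop q f x - pop q' f x).
Proof.
by rewrite -scaleN1r popD popZ; apply: funext => x; rewrite mulN1r.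
Qed.

Lemma pop1B q f : pop (1 - q) f = (fun x => f x - pop q f x).
Proof. by rewrite popB pop1. Qed.

(** [|| gradient (dinv N f) ||^2 = < (1 - P) (dinv N)^2 f, f >], and this operator
    is the identity minus an average of powers of [P]. *)
Lemma nsq_truncated_riesz N f : (0 < N)%N -> L2 f ->
  nsq (truncated_riesz N f) <= 2 * nsq f.
Proof.
move=> N0 hf; rewrite /truncated_riesz nsq_gradient; last exact: L2_pop.
rewrite -pop_laplacian /dinv -popM -ip_pop//; last exact: L2_pop.
rewrite -popM.
have -> : invroot N * ((1 - 'X) * invroot N) = 1 - defect N :> {poly R}.
  by rewrite /defect; ring.
rewrite pop1B ipBl//; last exact: L2_pop.
have := ip_pop_pgf (pgf_defect N0) hf; rewrite ler_norml -/(nsq f) => /andP[? ?].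
by lra.
Qed.

Lemma dinv1 f : dinv 1 f = f.
Proof.
rewrite /dinv -[RHS](pop1 mu); congr (pop _ f); apply/polyP => i.
by rewrite coef_invroot coef1; case: i => //; rewrite binv0.
Qed.

(** ** Comparison with an abstract square root of the Laplacian *)

Definition bounded_positive (A : (G -> R) -> G -> R) (k : R) :=
  [/\ forall f, L2 f -> L2 (A f),
      forall c f g, L2 f -> L2 g ->
        A (fun x => c * f x + g x) = (fun x => c * A f x + A g x),
      forall f, L2 f -> nsq (A f) <= k ^+ 2 * nsq f,
      forall f g, L2 f -> L2 g -> ip (A f) g = ip f (A g) &
      forall f, L2 f -> 0 <= ip (A f) f].

(** Cauchy-Schwarz for the positive form [< A f, g >]. *)
Lemma bounded_positive_le A k f : 0 <= k -> bounded_positive A k -> L2 f ->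
  nsq (A f) <= k * ip (A f) f.
Proof.
move=> k0 [AL2 Alin Abd Asym Apos] hf.
have hA := AL2 _ hf; have hAA := AL2 _ hA.
have cs : ip (A f) (A f) ^+ 2 <= ip (A (A f)) (A f) * ip (A f) f.
  rewrite mulrC; apply: discriminant_le => [|t]; first exact: Apos.
  have hS : L2 (fun x => t * A f x + f x) by apply: L2D => //; exact: L2Z.
  have := Apos _ hS; rewrite Alin// ipDl// ?(ipDr _ _ hS)//; try exact: L2Z.
  rewrite !ipDr//; try exact: L2Z.
  rewrite !ipZl// ?ipZr//; try exact: L2Z.
  rewrite (Asym (A f) f)//; nra.
have cs2 : ip (A (A f)) (A f) <= k * nsq (A f).
  rewrite (le_trans (ler_norm _))// -(ler_pXn2r (n := 2)) ?nnegrE ?mulr_ge0 ?nsq_ge0//.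
  rewrite real_normK ?num_real// (le_trans (cauchy_schwarz _ _))//.
  by rewrite exprMn [nsq _ ^+ 2]expr2 mulrA ler_wpM2r ?nsq_ge0// Abd.
have a0 := Apos _ hf; have n0 := nsq_ge0 (mu := mu) (A f).
have [->|nn0] := eqVneq (nsq (A f)) 0; first by rewrite mulr_ge0.
have {n0}nn0 : 0 < nsq (A f) by rewrite lt_def nn0.
rewrite -(ler_pM2l nn0) -expr2 (le_trans cs)// mulrCA mulrA ler_wpM2r//.
Qed.

(** The losses of energy telescope, and each of the [N] increments is at least
    the one at time [N]. *)
Lemma nsq_laplacian_iter eps N f : 0 <= eps -> (forall x, eps <= pker mu x x) ->
  L2 f -> N%:R * (eps * nsq (laplacian mu (iter N P f))) <= nsq f.
Proof.
move=> eps0 lazy hf.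
have step n : \sum_(i < n) eps * nsq (laplacian mu (iter i P f)) <=
    nsq f - nsq (iter n P f).
  elim: n => [|n IH]; first by rewrite big_ord0 subrr.
  have := nsq_laplacian_lazy lazy (L2_iter n hf).
  by rewrite big_ord_recr/= => *; lra.
apply: le_trans (le_trans (step N) _); last by rewrite gerBl nsq_ge0.
rewrite mulr_natl -[X in _ *+ X]card_ord -sumr_const; apply: ler_sum => i _.
rewrite ler_wpM2l// -!pop_laplacian -!pop_iter !(pop_comm _ 'X^_) !pop_iter.
by apply: nsq_iter_le; [exact: L2_pop|exact/ltnW].
Qed.

Lemma laplacian_bounded_positive_dinv N : (0 < N)%N ->
  bounded_positive (pop ((1 - 'X) * invroot N)) 2.
Proof.
move=> N0; split=> [f|c f g _ _|f hf|f g|f hf].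
- exact: L2_pop.
- exact: pop_linear.
- have -> : (1 - 'X) * invroot N = 1 - (1 - (1 - 'X) * invroot N) :> {poly R} by ring.
  rewrite pop1B (le_trans (nsqB_le hf _))//; first exact: L2_pop.
  have := nsq_pop_pgf (N := 0) (pgf_invroot N0) _ hf => /(_ _)/= h.
  by have {}h := h (fun k (k0 : (k < 0)%N) => False_ind _ (Bool.diff_false_true k0)); lra.
- exact: ip_pop.
- have -> : (1 - 'X) * invroot N = 1 - (1 - (1 - 'X) * invroot N) :> {poly R} by ring.
  rewrite pop1B ipBl//; last exact: L2_pop.
  have := ip_pop_pgf (pgf_invroot N0) hf; rewrite ler_norml -/(nsq f) => /andP[? ?].
  by lra.
Qed.

Section SquareRoot.
Variables (S : (G -> R) -> G -> R) (K eps : R).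
Hypotheses (K0 : 0 <= K) (SP : bounded_positive S K).
Hypothesis SS : forall f, L2 f -> S (S f) = laplacian mu f.
Hypotheses (eps0 : 0 < eps) (lazy : forall x, eps <= pker mu x x).

Lemma sqrt_pop q f : L2 f -> S (pop q f) = pop q (S f).
Proof.
have [SL2 Slin _ _ _] := SP.
have SPop h : L2 h -> S (P h) = P (S h).
  move=> hh; have hSh := SL2 _ hh; have hSSh := SL2 _ hSh.
  have PE h' : L2 h' -> P h' = (fun x => (-1) * S (S h') x + h' x).
    by move=> hh'; rewrite SS//; apply: funext => x; rewrite /laplacian; ring.
  by rewrite PE// Slin// [RHS]PE.
move=> hf; elim/poly_ind: q => [|q c IH].
  have pop0 h : pop 0 h = (fun x => 0 * h x + 0 * h x).
    by apply: funext => x; rewrite -(scale0r 0) popZ !mul0r addr0.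
  have S0 : S (fun x => 0 * f x + 0 * f x) = (fun x => 0 * S f x + 0 * S f x).
    rewrite Slin//; last exact: L2Z.
    apply: funext => x; rewrite mul0r add0r.
    have := Slin (-1) _ _ (L2Z 0 hf) (L2Z 0 hf) => /(congr1 (fun u => u x)).
    rewrite (_ : (fun x => -1 * (0 * f x) + 0 * f x) = (fun x => 0 * f x)).
      by move=> ->; ring.
    by apply: funext => y; ring.
  by rewrite !pop0 S0.
have -> : q * 'X + c%:P = c%:P + 'X * q by ring.
rewrite !popD !popXM !popC Slin ?SPop ?IH//; first exact: L2_pop.
exact/L2_Pop/L2_pop.
Qed.

(** Uniqueness of the positive square root, made quantitative. Write [Q] for
    [Delta * dinv N], which is positive and commutes with [S], and [y] for
    [(S - Q) f]. Then [<S y, y> + <Q y, y> = <(S^2 - Q^2) f, y>] is small, since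
    [S^2 - Q^2 = Delta * defect N] only involves powers of [P] of exponent at
    least [N]. By positivity [S y] and [Q y] are small, hence also
    [||y||^2 = <(S - Q) y, f>]. *)
Lemma sqrt_dinv_cvg N f : (0 < N)%N -> L2 f ->
  nsq (fun x => gradient mu f x - truncated_riesz N (S f) x) ^+ 3 * (N%:R * eps)
  <= (2 * (K + 2)) ^+ 2 * nsq f ^+ 3.
Proof.
move=> N0 hf; have [SL2 Slin Sbd Ssym Spos] := SP.
pose Q := pop ((1 - 'X) * invroot N).
have QP : bounded_positive Q 2 := laplacian_bounded_positive_dinv N0.
have [_ _ _ Qsym Qpos] := QP.
have SlinB g h : L2 g -> L2 h -> S (fun x => g x - h x) = (fun x => S g x - S h x).
  move=> hg hh; have -> : (fun x => g x - h x) = (fun x => -1 * h x + g x).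
    by apply: funext => x; ring.
  by rewrite Slin//; apply: funext => x; ring.
have QB g h : Q (fun x => g x - h x) = (fun x => Q g x - Q h x).
  have -> : (fun x => g x - h x) = (fun x => -1 * h x + g x).
    by apply: funext => x; ring.
  by rewrite /Q pop_linear; apply: funext => x; ring.
have hSf := SL2 _ hf; have hQf : L2 (Q f) := L2_pop _ hf.
pose y x := S f x - Q f x; have hy : L2 y := L2B hSf hQf.
have hSy := SL2 _ hy; have hQy : L2 (Q y) := L2_pop _ hy.
(* The gradient of f minus its approximation has the norm of y. *)
have le_y : nsq (fun x => gradient mu f x - truncated_riesz N (S f) x) <= nsq y.
  pose u x := f x - dinv N (S f) x.
  have hd : L2 (dinv N (S f)) := L2_pop _ hSf.
  have hu : L2 u := L2B hf hd.
  apply: (@le_trans _ _ (nsq (gradient mu u))).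
    rewrite !nsqE; apply: le_mint => [||x]; last 1 first.
    - rewrite -[leLHS]real_normK ?num_real// lerXn2r ?nnegrE ?gradient_ge0//.
      exact: gradient_dist.
    - by apply: (@L2B _ _ mu); exact: L2_gradient.
    - exact: L2_gradient.
  rewrite nsq_gradient// -SS// Ssym//; last exact: SL2.
  have -> // : S u = y.
  rewrite /u SlinB// /dinv sqrt_pop// SS// -pop_laplacian -popM mulrC.
  by [].
have Ne : 0 <= N%:R * eps by rewrite mulr_ge0// ltW.
apply: (@le_trans _ _ (nsq y ^+ 3 * (N%:R * eps))).
  by rewrite ler_wpM2r// lerXn2r// nnegrE nsq_ge0.
pose z := pop (defect N) (laplacian mu f).
have hz : L2 z by apply/L2_pop/L2_laplacian.
have zE : (fun x => S y x + Q y x) = z.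
  rewrite /y SlinB// QB SS// /Q sqrt_pop//; apply: funext => x.
  have -> : z = pop ((1 - 'X) - ((1 - 'X) * invroot N) * ((1 - 'X) * invroot N)) f.
    by rewrite /z -pop_laplacian -popM; congr (pop _ f); rewrite /defect; ring.
  rewrite popB (popM ((1 - 'X) * invroot N)) (pop_laplacian f); ring.
have e_z : ip z y = ip (S y) y + ip (Q y) y by rewrite -ipDl// zE.
have nz : nsq z <= nsq (laplacian mu (iter N P f)).
  apply: le_trans (nsq_pop_pgf (pgf_defect N0) (defect_lt (N := N)) _) _.
    exact: L2_laplacian.
  by rewrite -!pop_laplacian -!pop_iter pop_comm.
have cs := cauchy_schwarz hz hy.
have nSy := bounded_positive_le K0 SP hy; have nQy := bounded_positive_le (ler0n _ 2) QP hy.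
have := Spos _ hy; have := Qpos _ hy => Qy0 Sy0.
pose w x := S y x - Q y x; have hw : L2 w := L2B hSy hQy.
have nw : nsq w <= 2 * (K + 2) * ip z y.
  apply: le_trans (nsqB_le hSy hQy) _; rewrite e_z -mulrA ler_wpM2l//.
  rewrite mulrDl lerD//; [apply: le_trans nSy _|apply: le_trans nQy _].
    by rewrite ler_wpM2l// lerDl.
  by rewrite ler_wpM2l// lerDr.
have yE : nsq y = ip w f.
  by rewrite /nsq {2}/y ipBr// -Ssym// -Qsym// -ipBl.
have cs2 := cauchy_schwarz hw hf; rewrite -yE in cs2.
have y0 := nsq_ge0 (mu := mu) y; have f0 := nsq_ge0 (mu := mu) f.
have lap := nsq_laplacian_iter N (ltW eps0) lazy hf.
have e0 := nsq_ge0 (mu := mu) (laplacian mu (iter N P f)).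
set Y := nsq y in y0 cs2 cs *; set F := nsq f in f0 cs2 lap *.
set e := nsq (laplacian _ _) in nz e0 lap; set t := ip z y in nw cs e_z.
have K2 : 0 <= 2 * (K + 2) by rewrite mulr_ge0// addr_ge0.
set c := 2 * (K + 2) in K2 nw *.
have t0 : 0 <= t by rewrite e_z addr_ge0.
have h1 : Y ^+ 2 <= c * t * F by apply: le_trans cs2 _; rewrite ler_wpM2r.
have h2 : t ^+ 2 <= e * Y by apply: le_trans cs _; rewrite ler_wpM2r.
have h3 : Y ^+ 4 <= c ^+ 2 * F ^+ 2 * (e * Y).
  have -> : Y ^+ 4 = (Y ^+ 2) ^+ 2 by ring.
  apply: (@le_trans _ _ ((c * t * F) ^+ 2)).
    apply: lerXn2r h1; rewrite nnegrE; first exact: sqr_ge0.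
    exact: mulr_ge0 (mulr_ge0 K2 t0) f0.
  have -> : (c * t * F) ^+ 2 = c ^+ 2 * F ^+ 2 * t ^+ 2 by ring.
  by rewrite ler_wpM2l// mulr_ge0 ?sqr_ge0.
have h4 : Y ^+ 3 <= c ^+ 2 * F ^+ 2 * e.
  have [->|Y0] := eqVneq Y 0; first by rewrite expr0n/= mulr_ge0// mulr_ge0 ?sqr_ge0.
  have {}Y0 : 0 < Y by rewrite lt_def Y0.
  rewrite -(ler_pM2r Y0); apply: le_trans (le_trans h3 _).
    by rewrite -exprSr.
  by rewrite mulrA.
apply: le_trans (ler_wpM2r Ne h4) _.
have -> : c ^+ 2 * F ^+ 2 * e * (N%:R * eps) = c ^+ 2 * F ^+ 2 * (N%:R * (eps * e)).
  by ring.
have -> : c ^+ 2 * F ^+ 3 = c ^+ 2 * F ^+ 2 * F by ring.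
by rewrite ler_wpM2l// mulr_ge0 ?sqr_ge0.
Qed.
End SquareRoot.

End InvRootOperator.

Arguments dinv {R G} mu N f.
Arguments truncated_riesz {R G} mu N f.

(** * Distance and volume *)

Record metric_graph (R : realType) (G : countType) := MetricGraph {
  mg_graph :> reversible_graph R G;
  mg_connected : connected_graph mg_graph }.

Section Distance.
Context {R : realType} {G : countType} {mu : metric_graph R G}.
Implicit Types (x y z : G) (n k : nat) (r : R).

Local Notation d := (gdist mu).
Local Notation m := (vweight mu).

Lemma walk_cat x y z n k : walk mu x y n -> walk mu y z k -> walk mu x z (n + k).
Proof.
move=> [s [ps <- <-]] [t [pt <- <-]]; exists (s ++ t).
by rewrite cat_path ps last_cat size_cat.
Qed.

Lemma walk_sym x y n : walk mu x y n -> walk mu y x n.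
Proof.
move=> [s [ps <- <-]]; exists (rev (belast x s)); split.
- by rewrite (eq_path (e' := fun u v => adj mu v u)) ?rev_path// => u v; exact: adj_sym.
- by case: s {ps} => //= u s; rewrite rev_cons last_rcons.
- by rewrite size_rev size_belast.
Qed.

Lemma gdistP x y : walk mu x y (d x y) /\ forall k, walk mu x y k -> (d x y <= k)%N.
Proof.
have ex : exists n, `[< walk mu x y n >].
  by have [n w] := mg_connected mu x y; exists n; apply/asboolP.
have [n /asboolP wn nmin] := ex_minnP ex.
apply: (xgetPex 0%N (P := [set n | walk mu x y n /\ forall k, walk mu x y k -> (n <= k)%N])).
by exists n; split=> // k wk; apply: nmin; apply/asboolP.
Qed.

Lemma gdist_min x y k : walk mu x y k -> (d x y <= k)%N.
Proof. exact: (gdistP x y).2. Qed.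

Lemma gdist_walk x y : walk mu x y (d x y).
Proof. exact: (gdistP x y).1. Qed.

Lemma gdistxx x : d x x = 0%N.
Proof. by apply/eqP; rewrite -leqn0; apply: gdist_min; exists [::]. Qed.

Lemma gdist0_eq x y : d x y = 0%N -> x = y.
Proof. by move=> e; have := gdist_walk x y; rewrite e => -[[|? ?] [_ ]]. Qed.

Lemma gdistC x y : d x y = d y x.
Proof.
by apply/eqP; rewrite eqn_leq; apply/andP; split; apply: gdist_min;
  exact/walk_sym/gdist_walk.
Qed.

Lemma gdist_triangle y x z : (d x z <= d x y + d y z)%N.
Proof. apply/gdist_min/walk_cat; exact: gdist_walk. Qed.

Lemma gdist_adj x y : adj mu x y -> (d x y <= 1)%N.
Proof. by move=> xy; apply: gdist_min; exists [:: y]; rewrite /= xy. Qed.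

Lemma walk_finite n x : exists B : seq G, forall y, walk mu x y n -> y \in B.
Proof.
elim: n x => [|n IH] x.
  by exists [:: x] => y [[|? ?] [_ <- //]]; rewrite mem_head.
have [B hB] := choice IH.
exists (flatten [seq B z | z <- nbh mu x]) => y [[|z s] [//= /andP[xz ps] <- [sn]]].
apply/flattenP; exists (B z); first by apply: map_f; rewrite mem_nbh.
by apply: hB; exists s.
Qed.

Lemma gball_finite x r : finite_set (gball mu x r).
Proof.
have [B hB] := choice (fun n => walk_finite n x).
have [N rN] : exists N : nat, r <= N%:R.
  exists (Num.bound `|r|); rewrite (le_trans (ler_norm _))// ltW//.
  exact: archi_boundP.
apply: (@sub_finite_set _ _ [set` flatten [seq B i | i <- iota 0 N]]); last first.
  exact: finite_seq.
move=> y /= yr; apply/flattenP; exists (B (d x y)).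
  by apply: map_f; rewrite mem_iota/= -(ltr_nat R) (lt_le_trans yr).
exact/hB/gdist_walk.
Qed.

Definition ball x r : seq G := fset_set (gball mu x r).

Lemma ball_uniq x r : uniq (ball x r). Proof. exact: fset_uniq. Qed.

Lemma mem_ball x r y : (y \in ball x r) = ((d x y)%:R < r).
Proof.
rewrite /ball in_fset_set; last exact: gball_finite.
by apply/idP/idP; rewrite inE.
Qed.

Lemma volumeE x r : volume mu x r = \sum_(y <- ball x r) m y.
Proof.
rewrite /volume /vmeasure esum_fset.
- by rewrite fsbig_finite ?sumEFin//; exact: gball_finite.
- exact: gball_finite.
- by move=> y _; rewrite lee_fin vweight_ge0.
Qed.

Lemma sum_sub_le (F : G -> R) (A B : seq G) : (forall x, 0 <= F x) ->
  uniq A -> uniq B -> {subset A <= B} -> \sum_(x <- A) F x <= \sum_(x <- B) F x.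
Proof.
move=> F0 uA uB AB.
have -> : \sum_(x <- A) F x = \sum_(x <- B | x \in A) F x.
  rewrite -[RHS]big_filter; apply: perm_big; apply: uniq_perm => //.
    exact: filter_uniq.
  move=> x; rewrite mem_filter; case xA : (x \in A) => //=.
  by rewrite AB.
by rewrite [leRHS](bigID (mem A))/= lerDl sumr_ge0.
Qed.

Lemma sum_le_volume x r (A : seq G) : uniq A ->
  (forall y, y \in A -> (d x y)%:R < r) -> \sum_(y <- A) m y <= volume mu x r.
Proof.
move=> uA Ar; rewrite volumeE; apply: sum_sub_le => //.
- by move=> y; exact: vweight_ge0.
- exact: ball_uniq.
- by move=> y /Ar; rewrite mem_ball.
Qed.

Lemma volume_le x y r r' : (forall z, (d x z)%:R < r -> (d y z)%:R < r') ->
  volume mu x r <= volume mu y r'.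
Proof.
move=> h; rewrite volumeE; apply: sum_le_volume; first exact: ball_uniq.
by move=> z; rewrite mem_ball => /h.
Qed.

Lemma volume_mono x r r' : r <= r' -> volume mu x r <= volume mu x r'.
Proof. by move=> rr'; apply: volume_le => z /lt_le_trans; exact. Qed.

Lemma volume_ge x r : 0 < r -> m x <= volume mu x r.
Proof.
move=> r0; have := @sum_le_volume x r [:: x] isT.
by rewrite big_seq1; apply => y; rewrite inE => /eqP ->; rewrite gdistxx.
Qed.

Lemma volume_gt0 x r : 0 < r -> 0 < volume mu x r.
Proof. by move=> r0; apply: lt_le_trans (volume_ge x r0); exact: vweight_gt0. Qed.

End Distance.

Arguments ball {R G} mu x r.

(** The constants obtained below depend on this record only, that is, on the
    graph and the constants of the hypotheses. *)
Record subgaussian_graph (R : realType) (G : countType) := SubgaussianGraph {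
  sg_graph :> metric_graph R G;
  sg_eps : R;
  sg_eps_gt0 : 0 < sg_eps;
  sg_lazy : forall x, sg_eps <= pker sg_graph x x;
  sg_doubling : volume_doubling sg_graph;
  sg_dim : R;
  sg_dim_gt1 : 1 < sg_dim;
  sg_kernel : subgaussian_upper_bound sg_graph sg_dim }.

Section Doubling.
Context {R : realType} {G : countType} {mu : subgaussian_graph R G}.
Implicit Types (x y z : G) (n k : nat) (r rho : R).

Local Notation d := (gdist mu).
Local Notation m := (vweight mu).
Local Notation V := (volume mu).

Lemma doubling_ge1 : exists2 D : R, 1 <= D & forall x r, 0 < r -> V x (2 * r) <= D * V x r.
Proof.
have [C C0 h] := sg_doubling mu; exists (1 + C); first by rewrite lerDl ltW.
move=> x r r0; rewrite (le_trans (h _ _ r0))// ler_wpM2r ?lerDr// ltW//.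
exact: volume_gt0.
Qed.

Lemma doubling_iter (D : R) : 1 <= D -> (forall x r, 0 < r -> V x (2 * r) <= D * V x r) ->
  forall k x r, 0 < r -> V x (2 ^+ k * r) <= D ^+ k * V x r.
Proof.
move=> D1 h; elim=> [|k IH] x r r0; first by rewrite !expr0 !mul1r.
rewrite !exprS -!mulrA (le_trans (h _ _ _))//; first by rewrite mulr_gt0// exprn_gt0.
by rewrite ler_wpM2l ?IH// (le_trans ler01).
Qed.

Definition decay rho x y : R := (1 + (d x y)%:R / rho)^-1.

Lemma decay_gt0 rho x y : 0 < rho -> 0 < decay rho x y.
Proof. by move=> r0; rewrite invr_gt0 ltr_pwDl// divr_ge0// ltW. Qed.

Lemma decay_ge0 rho x y : 0 < rho -> 0 <= decay rho x y.
Proof. by move=> /decay_gt0 /ltW. Qed.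

Lemma decay_le1 rho x y : 0 < rho -> decay rho x y <= 1.
Proof. by move=> r0; rewrite invf_le1 ?lerDl ?ltr_pwDl ?divr_ge0// ltW. Qed.

Lemma decay_far rho x y t : 0 < rho -> 0 < t -> t * rho <= (d x y)%:R ->
  decay rho x y <= t^-1.
Proof.
move=> r0 t0 h; rewrite /decay lef_pV2 ?posrE//; last by rewrite ltr_pwDl// divr_ge0// ltW.
by rewrite -lerBlDl (le_trans (y := t)) ?gerBl// ler_pdivlMr.
Qed.

(** A sufficiently high power of [decay] is integrable: the annulus at
    distance about [2 ^ J * rho] has volume at most [D ^ J] times that of the
    ball, against a factor [2 ^ (- J * M)]. *)
Lemma sum_decay_le : exists M, exists2 C : R, 0 < C &
  forall y rho (A : seq G), 0 < rho -> uniq A ->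
    \sum_(x <- A) decay rho x y ^+ M * m x <= C * V y rho.
Proof.
have [D D1 dbl] := doubling_ge1; have D0 : 0 < D by rewrite (lt_le_trans _ D1).
have dblk := doubling_iter D1 dbl.
pose M := Num.bound (2 * D).
have DM : 2 * D <= 2 ^+ M.
  have /ltW h : 2 * D < M%:R by apply: archi_boundP; rewrite mulr_ge0// ltW.
  by rewrite (le_trans h)// -natrX ler_nat ltnW// ltn_expl.
exists M, (1 + 2 * D); first by rewrite addr_gt0// mulr_gt0.
move=> y rho A rho0 uA; set W := V y rho.
have W0 : 0 < W := volume_gt0 y rho0.
pose S J := \sum_(x <- A | (d x y)%:R < 2 ^+ J * rho) decay rho x y ^+ M * m x.
have SJ J : S J <= W * (1 + 2 * D * (1 - (2 ^+ J)^-1)).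
  elim: J => [|J IH].
    rewrite expr0 invr1 subrr mulr0 addr0 mulr1 /S expr0 mul1r -big_filter.
    apply: (@le_trans _ _ (\sum_(x <- [seq x <- A | (d x y)%:R < rho]) m x)).
      apply: ler_sum => x _; rewrite ler_piMl ?vweight_ge0// exprn_ile1 ?decay_ge0//.
      exact: decay_le1.
    apply: sum_le_volume; first exact: filter_uniq.
    by move=> x; rewrite mem_filter gdistC => /andP[].
  have -> : S J.+1 = S J +
     \sum_(x <- A | 2 ^+ J * rho <= (d x y)%:R < 2 ^+ J.+1 * rho) decay rho x y ^+ M * m x.
    rewrite /S (bigID (fun x => (d x y)%:R < 2 ^+ J * rho))/=; congr (_ + _).
      apply: eq_bigl => x; rewrite andb_idl// => /lt_trans; apply.
      by rewrite ltr_pM2r// exprS ltr_pMl ?exprn_gt0// ltr1n.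
    by apply: eq_bigl => x; rewrite -leNgt andbC.
  set T := \sum_(_ <- _ | _) _.
  have TJ : T <= ((2 ^+ J)^-1) * D * W.
    rewrite /T -big_filter.
    apply: (@le_trans _ _ (\sum_(x <- [seq x <- A | 2 ^+ J * rho <= (d x y)%:R < 2 ^+ J.+1 * rho])
        ((2 ^+ J)^-1) ^+ M * m x)).
      rewrite !big_seq; apply: ler_sum => x.
      rewrite mem_filter => /andP[/andP[h _] _]; rewrite ler_wpM2r ?vweight_ge0//.
      rewrite lerXn2r ?nnegrE ?decay_ge0 ?invr_ge0 ?exprn_ge0//.
      by apply: decay_far => //; rewrite exprn_gt0.
    rewrite -mulr_sumr.
    apply: (@le_trans _ _ ((2 ^+ J)^-1 ^+ M * (D ^+ J.+1 * W))).
      rewrite ler_wpM2l ?exprn_ge0 ?invr_ge0 ?exprn_ge0//.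
      apply: le_trans (dblk J.+1 y rho rho0).
      apply: sum_le_volume; first exact: filter_uniq.
      by move=> x; rewrite mem_filter gdistC => /andP[/andP[]].
    rewrite mulrA ler_wpM2r ?(ltW W0)// exprSr mulrA ler_wpM2r ?(ltW D0)//.
    have J0 : 0 < 2 ^+ J :> R by rewrite exprn_gt0.
    rewrite exprVn -exprM mulnC exprM mulrC ler_pdivrMr ?exprn_gt0//.
    rewrite mulrC ler_pdivlMr// -exprMn lerXn2r ?nnegrE ?exprn_ge0 ?mulr_ge0 ?(ltW D0)//.
    by rewrite mulrC.
  apply: le_trans (lerD IH TJ) _.
  have J0 : 0 < 2 ^+ J :> R by rewrite exprn_gt0.
  rewrite exprS invfM; set t := (2 ^+ J)^-1.
  by rewrite le_eqVlt; apply/orP; left; apply/eqP; field.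
have [n0 hJ] : exists n0, forall x, x \in A -> (d x y)%:R < 2 ^+ n0 * rho.
  pose n := \max_(x <- A) d x y.
  exists (Num.bound (n%:R / rho)) => x xA.
  rewrite -ltr_pdivrMr//.
  have h : n%:R / rho < (Num.bound (n%:R / rho))%:R by apply: archi_boundP; rewrite divr_ge0// ltW.
  apply: (@le_lt_trans _ _ (n%:R / rho)).
    by rewrite ler_pM2r ?invr_gt0// ler_nat /n; apply: leq_bigmax_seq.
  by rewrite (lt_trans h)// -natrX ltr_nat ltn_expl.
have -> : \sum_(x <- A) decay rho x y ^+ M * m x = S n0.
  by rewrite /S [RHS]big_seq_cond [LHS]big_seq; apply: eq_bigl => x; rewrite andb_idr// => /hJ.
apply: le_trans (SJ n0) _; rewrite mulrC ler_wpM2r ?(ltW W0)// lerD2l.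
by rewrite ler_piMr ?mulr_ge0 ?(ltW D0)// gerBl invr_ge0 exprn_ge0.
Qed.

End Doubling.

(** * Polynomially decaying bounds for the transition probabilities *)

Lemma powRVl {R : realType} (x r : R) : 0 <= x -> x^-1 `^ r = (x `^ r)^-1.
Proof. by move=> x0; rewrite -(powR_inv1 x0) -powRrM mulN1r powRN. Qed.

Section Kernel.
Context {R : realType} {G : countType} {mu : subgaussian_graph R G}.
Implicit Types (x y z : G) (n k l M : nat) (r : R).

Local Notation d := (gdist mu).
Local Notation m := (vweight mu).
Local Notation P := (Pop mu).
Local Notation V := (volume mu).
Local Notation a := (sg_dim mu).
Local Notation decay := (@decay R G mu).

Definition dirac_at y : G -> R := fun x => (x == y)%:R.

Definition hk l y : G -> R := iter l P (dirac_at y).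

Lemma pker_iterE l x y : pker_iter mu l x y = hk l y x.
Proof.
elim: l x => //= l IH x; rewrite [RHS]/Pop.
by apply: eq_fsbigr => z _; rewrite IH.
Qed.

Lemma hk_ge0 l y x : 0 <= hk l y x.
Proof. by apply: iterP_ge0 => z; exact: ler0n. Qed.

Lemma hkS l y : hk l.+1 y = P (hk l y). Proof. by []. Qed.

Lemma dirac_supp y x : x \notin [:: y] -> dirac_at y x = 0.
Proof. by rewrite inE /dirac_at => /negPf ->. Qed.

Lemma hk_finsupp l y : exists B : seq G, forall x, x \notin B -> hk l y x = 0.
Proof. exact: iterP_finsupp (@dirac_supp y). Qed.

Lemma mint_dirac y : mint mu (dirac_at y) = m y.
Proof.
rewrite (@mint_finsupp _ _ _ _ [:: y])// ?big_seq1 ?/dirac_at ?eqxx ?mul1r//.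
exact: dirac_supp.
Qed.

Lemma mint_hk l y : mint mu (hk l y) = m y.
Proof.
elim: l => [|l IH]; first exact: mint_dirac.
have [B hB] := hk_finsupp l y.
by rewrite hkS mint_Pop//; exact: integrable_finsupp hB.
Qed.

Lemma hk_sym l x y : hk l y x * m x = hk l x y * m y.
Proof.
have ipE f z : ip mu f (dirac_at z) = f z * m z.
  rewrite /ip (@mint_finsupp _ _ _ _ [:: z])// ?big_seq1 ?/dirac_at ?eqxx ?mulr1//.
  by move=> w; rewrite inE => /negPf ->; rewrite mulr0.
have hd z : L2 mu (dirac_at z) := L2_finsupp (@dirac_supp z).
by rewrite -!ipE /hk ip_iter// ipC.
Qed.

Definition rho l : R := l.+1%:R `^ a^-1.

Lemma dim_gt0 : 0 < a. Proof. by rewrite (lt_trans _ (sg_dim_gt1 mu)). Qed.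

Lemma rho_ge1 l : 1 <= rho l.
Proof.
have {1}<- : (1 : R) `^ a^-1 = 1 by rewrite powR1.
apply: ge0_ler_powR; rewrite ?nnegrE ?ler1n//.
by rewrite invr_ge0 ltW// dim_gt0.
Qed.

Lemma rho_gt0 l : 0 < rho l. Proof. by rewrite (lt_le_trans _ (rho_ge1 l)). Qed.

Lemma rho_powR l : rho l `^ a = l.+1%:R.
Proof. by rewrite -powRrM mulVf ?powRr1// gt_eqF// dim_gt0. Qed.

Lemma rho_mono l k : (l <= k)%N -> rho l <= rho k.
Proof.
move=> lk; apply: ge0_ler_powR; rewrite ?nnegrE ?ler_nat//.
by rewrite invr_ge0 ltW// dim_gt0.
Qed.

Lemma rho_double l k : (k.+1 <= 2 * l.+1)%N -> rho k <= 2 * rho l.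
Proof.
move=> kl; apply: (@le_trans _ _ ((2 * l.+1%:R) `^ a^-1)).
  apply: ge0_ler_powR; rewrite ?nnegrE ?mulr_ge0 -?natrM ?ler_nat//.
  by rewrite invr_ge0 ltW// dim_gt0.
rewrite powRM// ler_wpM2r ?powR_ge0// ler1_powR ?ler1n//.
by rewrite invf_le1 ?dim_gt0// ltW// sg_dim_gt1.
Qed.

Lemma rho_ge r l : 0 <= r -> r `^ a <= l.+1%:R -> r <= rho l.
Proof.
move=> r0 h; have -> : r = (r `^ a) `^ a^-1.
  by rewrite -powRrM mulfV ?powRr1// gt_eqF// dim_gt0.
apply: ge0_ler_powR; rewrite ?nnegrE ?powR_ge0//.
by rewrite invr_ge0 ltW// dim_gt0.
Qed.

Lemma expR_le_decay (c t : R) M : 0 < c -> 0 <= t ->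
  expR (- (c * t)) <= ((1 + M.+1%:R / c) * (1 + t)^-1) ^+ M.
Proof.
move=> c0 t0; have M0 : 0 < M.+1%:R :> R by rewrite ltr0n.
set s := c * t / M.+1%:R; have s0 : 0 <= s by rewrite divr_ge0 ?mulr_ge0 ?(ltW c0) ?(ltW M0).
have k0 : 0 <= M.+1%:R / c by rewrite divr_ge0 ?(ltW c0) ?(ltW M0).
have t1 : 0 < 1 + t by rewrite ltr_pwDl.
have -> : - (c * t) = M.+1%:R * (- s).
  by rewrite /s; field; rewrite addrC natr1 gt_eqF.
rewrite expRM_natl exprS.
apply: (@le_trans _ _ (expR (- s) ^+ M)).
  by rewrite ler_piMl ?exprn_ge0 ?expR_ge0// -expR0 ler_expR oppr_le0.
apply: lerXn2r; rewrite ?nnegrE ?expR_ge0//.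
  by rewrite mulr_ge0 ?invr_ge0 ?(ltW t1) ?addr_ge0.
rewrite expRN ler_pdivlMr// ler_pdivrMl ?expR_gt0//.
apply: (@le_trans _ _ ((1 + s) * (1 + M.+1%:R / c))); last first.
  by rewrite ler_wpM2r ?addr_ge0// expR_ge1Dx.
have -> : (1 + s) * (1 + M.+1%:R / c) = 1 + t + s + M.+1%:R / c.
  by rewrite /s; field; rewrite !gt_eqF.
by rewrite -addrA lerDl addr_ge0.
Qed.

(** In the scale [rho l] the sub-Gaussian factor beats every power of [decay].
    Powers are easier to handle: square roots, changes of time and changes of
    vertex only cost a constant factor. *)
Lemma hk_decay M : exists2 C : R, 0 < C & forall l x y,
  hk l y x <= C * (m y / V y (rho l)) * decay (rho l) x y ^+ M.
Proof.
have [C [c [C0 c0 ker]]] := sg_kernel mu.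
have a1 : 0 < a - 1 by rewrite subr_gt0 sg_dim_gt1.
exists (C * (expR c * (1 + M.+1%:R / c) ^+ M)).
  by rewrite !mulr_gt0 ?expR_gt0 ?exprn_gt0 ?addr_gt0 ?divr_gt0.
move=> l x y; have := ker x y l.+1 isT; rewrite /= pker_iterE => /le_trans; apply.
rewrite -/(rho l) -!mulrA ler_wpM2l ?(ltW C0)//.
set A := m y; set W := V y (rho l).
have A0 : 0 <= A by exact: vweight_ge0.
have W0 : 0 < W by exact/volume_gt0/rho_gt0.
rewrite [leRHS](_ : _ = A * (W^-1 * (expR c * (1 + M.+1%:R / c) ^+ M * decay (rho l) x y ^+ M))); last by ring.
rewrite ler_wpM2l// ler_wpM2l ?invr_ge0 ?(ltW W0)//.
set t := _ `^ (a - 1)^-1; set s := (d x y)%:R / rho l.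
have s0 : 0 <= s by rewrite divr_ge0// ltW// rho_gt0.
have st : s - 1 <= t.
  have [s1|s1] := leP s 1; first by rewrite (le_trans (y := 0)) ?powR_ge0 ?subr_le0.
  apply: (@le_trans _ _ s); first by rewrite gerBl.
  have -> : t = s `^ (a * (a - 1)^-1).
    rewrite /t powRrM; congr (_ `^ _); rewrite -(rho_powR l) /s.
    rewrite powRM ?invr_ge0 ?(ltW (rho_gt0 l))//; congr (_ * _).
    by rewrite powRVl ?(ltW (rho_gt0 l)).
  apply: le1r_powR; first exact: ltW.
  by rewrite ler_pdivlMr// mul1r gerBl.
have := expR_le_decay M c0 s0; rewrite exprMn -/(decay (rho l) x y) => h.
rewrite -mulrA; apply: le_trans (_ : expR c * expR (- (c * s)) <= _); last first.
  by rewrite ler_wpM2l ?expR_ge0.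
by rewrite -expRD ler_expR mulNr; have := ler_wpM2l (ltW c0) st; lra.
Qed.

(** The form in which the distance helps at small times. *)
Lemma decay_time : exists Q, forall l x y r, 0 < r -> r <= (d x y)%:R ->
  decay (rho l) x y ^+ Q <= l.+1%:R / r `^ a.
Proof.
exists (Num.bound a) => l x y r r0 rd.
have aQ : a <= (Num.bound a)%:R by apply/ltW/archi_boundP/ltW/dim_gt0.
set w := 1 + (d x y)%:R / rho l.
have w1 : 1 <= w by rewrite lerDl divr_ge0// ltW// rho_gt0.
have wr : r / rho l <= w.
  by rewrite (le_trans (y := (d x y)%:R / rho l)) ?lerDr// ler_pM2r ?invr_gt0 ?rho_gt0.
have ra : 0 < r `^ a by exact: powR_gt0.
have h : r `^ a / l.+1%:R <= w ^+ Num.bound a.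
  rewrite -powR_mulrn ?(le_trans ler01 w1)//.
  apply: le_trans (ler_powR w1 aQ).
  have -> : r `^ a / l.+1%:R = (r / rho l) `^ a.
    rewrite powRM ?invr_ge0 ?(ltW (rho_gt0 l)) ?(ltW r0)//; congr (_ * _).
    by rewrite powRVl ?(ltW (rho_gt0 l))// rho_powR.
  apply: ge0_ler_powR; rewrite ?nnegrE ?divr_ge0 ?(ltW (rho_gt0 l)) ?(ltW r0) ?(ltW dim_gt0)//.
  exact: le_trans w1.
have hp : 0 < r `^ a / l.+1%:R by rewrite divr_gt0.
rewrite /decay exprVn -/w -[leRHS]invrK lef_pV2 ?posrE ?invf_div//.
by rewrite exprn_gt0// (lt_le_trans ltr01).
Qed.

Lemma decay_adj l x y z : adj mu x z ->
  decay (rho l) z y <= 2 * decay (rho l) x y.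
Proof.
move=> /gdist_adj xz; rewrite /decay.
have r1 := rho_ge1 l; have r0 := rho_gt0 l.
have h w : 0 < 1 + (d w y)%:R / rho l by rewrite ltr_pwDl// divr_ge0// ltW.
rewrite ler_pdivlMr// mulrC ler_pdivrMr//.
have : (d x y)%:R <= 1 + (d z y)%:R :> R.
  rewrite -(natrD _ 1) ler_nat (leq_trans (gdist_triangle z _ _))// leq_add2r//.
rewrite -(ler_pM2r (_ : 0 < (rho l)^-1)) ?invr_gt0// mulrDl mul1r.
have : (rho l)^-1 <= 1 by rewrite invf_le1.
have : 0 <= (d z y)%:R / rho l by rewrite divr_ge0// ltW.
by move=> *; lra.
Qed.

End Kernel.

Arguments hk {R G} mu l y.
Arguments rho {R G} mu l.

(** * Off-diagonal estimates for the gradient of the heat kernel *)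

Section Energy.
Context {R : realType} {G : countType} {mu : subgaussian_graph R G}.
Implicit Types (x y z : G) (n k l M : nat) (r : R) (u : G -> R).

Local Notation d := (gdist mu).
Local Notation m := (vweight mu).
Local Notation P := (Pop mu).
Local Notation V := (volume mu).
Local Notation a := (sg_dim mu).
Local Notation eps := (sg_eps mu).
Local Notation decay := (@decay R G mu).

Lemma adjxx x : adj mu x x.
Proof.
rewrite /adj lt_def mu_ge0 andbT; apply/eqP => e.
have := sg_lazy mu x; rewrite /pker e mul0r leNgt => /negP; apply.
exact: sg_eps_gt0.
Qed.

Definition sqrt3 u : G -> R := fun x => Num.sqrt (u x) ^+ 3.

Definition energy u : R := mint mu (sqrt3 u).

(** Strong convexity of [t |-> t ^ (3/2)] on a bounded interval, written in
    the variables [s = sqrt t]; the remainder is explicit: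
    [s^3 - b^3 - 3/2 * b * (s^2 - b^2) = (s - b)^2 * (s + b / 2)]. *)
Lemma sqrt3_convex (s b M : R) : 0 <= s -> 0 <= b -> s <= M -> b <= M ->
  (s ^+ 2 - b ^+ 2) ^+ 2 <=
  4 * M * (s ^+ 3 - b ^+ 3 - 3 / 2 * b * (s ^+ 2 - b ^+ 2)).
Proof.
move=> s0 b0 sM bM.
have -> : (s ^+ 2 - b ^+ 2) ^+ 2 = (s - b) ^+ 2 * (s + b) ^+ 2 by ring.
have -> : 4 * M * (s ^+ 3 - b ^+ 3 - 3 / 2 * b * (s ^+ 2 - b ^+ 2)) =
  (s - b) ^+ 2 * (M * (4 * s + 2 * b)) by field.
rewrite ler_wpM2l ?sqr_ge0//; nra.
Qed.

(** Where the exponent 3/2 is used: one step of the walk lowers the integral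
    of [u ^ (3/2)] by at least a multiple of the square of the gradient, up to
    the local weight [1 / sqrt u]. Laziness lets the oscillation of [u] around
    its mean at a vertex control its oscillation around its value there. *)
Lemma gradient_sqr_le_energy u x B : (forall z, 0 <= u z) ->
  (forall z, adj mu x z -> Num.sqrt (u z) <= B) ->
  gradient mu u x ^+ 2 <=
  4 * (1 + eps^-1) * B * (P (sqrt3 u) x - sqrt3 (P u) x).
Proof.
move=> u0 uB; set b := Num.sqrt (P u x).
have Pu0 : 0 <= P u x by apply: Pop_ge0 => z _.
have B0 : 0 <= B by rewrite (le_trans _ (uB _ (adjxx x))).
have b0 : 0 <= b by exact: sqrtr_ge0.
have bE : b ^+ 2 = P u x by rewrite sqr_sqrtr.
have bB : b <= B.
  rewrite -(ler_pXn2r (n := 2)) ?nnegrE// bE -(Pop_cst mu (B ^+ 2) x).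
  apply: le_Pop => z /uB zB.
  by rewrite -(sqr_sqrtr (u0 z)) lerXn2r ?nnegrE// sqrtr_ge0.
have var : P (fun z => (u z - P u x) ^+ 2) x <= 4 * B * (P (sqrt3 u) x - sqrt3 (P u) x).
  have -> : P (sqrt3 u) x - sqrt3 (P u) x =
      P (fun z => (sqrt3 u z - b ^+ 3) - 3 / 2 * b * (u z - b ^+ 2)) x.
    by rewrite PopB PopZ !PopB !Pop_cst -bE /sqrt3 bE -/b; ring.
  rewrite -PopZ; apply: le_Pop => z /uB zB; rewrite -bE -{1}(sqr_sqrtr (u0 z)).
  rewrite /sqrt3 -[in X in _ <= X](sqr_sqrtr (u0 z)) sqrtr_sqr ger0_norm ?sqrtr_ge0//.
  by apply: sqrt3_convex => //; exact: sqrtr_ge0.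
set W := P (fun z => (u z - P u x) ^+ 2) x in var.
have W0 : 0 <= W by apply: Pop_ge0 => z _; exact: sqr_ge0.
have ux : (u x - P u x) ^+ 2 <= eps^-1 * W.
  rewrite ler_pdivlMl ?sg_eps_gt0//.
  apply: le_trans (@Pop_point _ _ mu (fun z => (u z - P u x) ^+ 2) x x (fun z => sqr_ge0 _)).
  by rewrite ler_wpM2r ?sqr_ge0// sg_lazy.
have : gradient mu u x ^+ 2 <= W + (u x - P u x) ^+ 2.
  rewrite gradient_sqr -(Pop_cst mu ((u x - P u x) ^+ 2) x) -PopD -PopZ.
  apply: le_Pop => z _.
  have := sqr_ge0 ((u z - P u x) + (u x - P u x)).
  have -> : (u z - u x) ^+ 2 = ((u z - P u x) - (u x - P u x)) ^+ 2 by ring.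
  by move=> *; nra.
move=> /le_trans; apply; apply: (@le_trans _ _ ((1 + eps^-1) * W)).
  by rewrite mulrDl mul1r lerD2l.
have e0 : 0 <= 1 + eps^-1 by rewrite addr_ge0 ?invr_ge0 ?(ltW (sg_eps_gt0 mu)).
have := ler_wpM2l e0 var; set X := P (sqrt3 u) x - _.
by have -> : 4 * (1 + eps^-1) * B * X = (1 + eps^-1) * (4 * B * X) by ring.
Qed.

Lemma sqrt3_finsupp u (A : seq G) : (forall x, x \notin A -> u x = 0) ->
  forall x, x \notin A -> sqrt3 u x = 0.
Proof. by move=> uA x /uA; rewrite /sqrt3 => ->; rewrite sqrtr0 expr0n. Qed.

Lemma sqrt3_Pop_le u x : (forall z, 0 <= u z) -> sqrt3 (P u) x <= P (sqrt3 u) x.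
Proof.
move=> u0; set b := Num.sqrt (P u x).
have Pu0 : 0 <= P u x by apply: Pop_ge0 => z _.
have bE : b ^+ 2 = P u x by rewrite sqr_sqrtr.
rewrite -subr_ge0; have -> : P (sqrt3 u) x - sqrt3 (P u) x =
    P (fun z => (sqrt3 u z - b ^+ 3) - 3 / 2 * b * (u z - b ^+ 2)) x.
  by rewrite PopB PopZ !PopB !Pop_cst bE /sqrt3 -/b; ring.
apply: Pop_ge0 => z _; rewrite -[u z](sqr_sqrtr (u0 z)) /sqrt3.
set s := Num.sqrt (u z).
have -> : s ^+ 3 - b ^+ 3 - 3 / 2 * b * (s ^+ 2 - b ^+ 2) =
  (s - b) ^+ 2 * (s + b / 2) by field.
by rewrite mulr_ge0 ?sqr_ge0 ?addr_ge0 ?divr_ge0 ?sqrtr_ge0.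
Qed.

Lemma gradient_sum_sqr_le u (A E : seq G) (B : G -> R) :
  (forall z, 0 <= u z) -> (forall x, x \notin A -> u x = 0) -> uniq E ->
  (forall x, x \in E -> forall z, adj mu x z -> Num.sqrt (u z) <= B x) ->
  (\sum_(x <- E) gradient mu u x * m x) ^+ 2 <=
  4 * (1 + eps^-1) * (\sum_(x <- E) B x * m x) * (energy u - energy (P u)).
Proof.
move=> u0 uA uE uB.
pose F x := P (sqrt3 u) x - sqrt3 (P u) x.
set K := 4 * (1 + eps^-1).
have e0 : 0 < eps := sg_eps_gt0 mu.
have K0 : 0 < K by rewrite mulr_gt0 ?addr_gt0 ?invr_gt0.
have sq0 z : 0 <= sqrt3 u z by rewrite exprn_ge0// sqrtr_ge0.
have F0 x : 0 <= F x by rewrite subr_ge0 sqrt3_Pop_le.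
have B0 x : x \in E -> 0 <= B x.
  by move=> xE; rewrite (le_trans _ (uB _ xE _ (adjxx x)))// sqrtr_ge0.
have intu : integrable mu (sqrt3 u) := integrable_finsupp (sqrt3_finsupp uA).
have [A' uA'] : exists A' : seq G, forall x, x \notin A' -> P u x = 0.
  by have [A' hA'] := iterP_finsupp (mu := mu) 1 uA; exists A'.
have intPu : integrable mu (sqrt3 (P u)) := integrable_finsupp (sqrt3_finsupp uA').
have intPs := integrable_Pop intu.
have sumF : \sum_(x <- E) F x * m x <= energy u - energy (P u).
  rewrite /energy -{1}(mint_Pop intu) -mintB//.
  by apply: sum_le_mint => //; exact: integrableB.
apply: (@le_trans _ _ ((\sum_(x <- E) Num.sqrt (B x * m x) * Num.sqrt (K * (F x * m x))) ^+ 2)).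
  apply: lerXn2r.
  - by rewrite nnegrE sumr_ge0// => x _; rewrite mulr_ge0 ?vweight_ge0 ?gradient_ge0.
  - by rewrite nnegrE sumr_ge0// => x _; rewrite mulr_ge0 ?sqrtr_ge0.
  rewrite !big_seq; apply: ler_sum => x xE.
  have m0 := vweight_ge0 (mu := mu) x.
  have := gradient_sqr_le_energy u0 (uB _ xE).
  rewrite -/K -/(F x); move: (gradient_ge0 (mu := mu) u x); move: (gradient mu u x) => g g0 hg.
  clear sumF; clearbody K F.
  rewrite -(ler_pXn2r (n := 2)) ?nnegrE ?mulr_ge0 ?sqrtr_ge0//.
  rewrite !exprMn !sqr_sqrtr ?mulr_ge0 ?B0 ?(ltW K0)//.
  have -> : B x * m x * (K * (F x * m x)) = K * B x * F x * m x ^+ 2 by ring.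
  by rewrite ler_wpM2r ?sqr_ge0.
apply: le_trans (sqr_sum_le _ _ _ _) _; clearbody K.
have -> : \sum_(i <- E) Num.sqrt (B i * m i) ^+ 2 = \sum_(x <- E) B x * m x.
  rewrite !big_seq; apply: eq_bigr => x /B0 ?.
  by rewrite sqr_sqrtr// mulr_ge0 ?vweight_ge0.
have -> : \sum_(i <- E) Num.sqrt (K * (F i * m i)) ^+ 2 = K * \sum_(x <- E) F x * m x.
  rewrite mulr_sumr; apply: eq_bigr => x _.
  by rewrite sqr_sqrtr// !mulr_ge0 ?vweight_ge0 ?(ltW K0).
rewrite mulrCA -mulrA ler_wpM2l ?(ltW K0)// ler_wpM2l// big_seq sumr_ge0// => x /B0 ?.
by rewrite mulr_ge0 ?vweight_ge0.
Qed.

Lemma energy_ge0 u : 0 <= energy u.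
Proof. by apply: mint_ge0 => x; rewrite exprn_ge0// sqrtr_ge0. Qed.

Lemma energy_le u (A : seq G) (c : R) : (forall z, 0 <= u z) ->
  (forall x, x \notin A -> u x = 0) -> (forall x, u x <= c) ->
  energy u <= Num.sqrt c * mint mu u.
Proof.
move=> u0 uA uc; have intu := integrable_finsupp (mu := mu) uA.
rewrite /energy -mintZ//; apply: le_mint => [||x].
- exact: integrable_finsupp (sqrt3_finsupp uA).
- exact: integrableZ.
rewrite /sqrt3 exprSr mulrC sqr_sqrtr// ler_wpM2r//.
by apply: ler_wsqrtr.
Qed.

Lemma dyadic_block i : ((2 ^ i).-1 <= (2 ^ i.+1).-1)%N /\
  forall l, (l < (2 ^ i.+1).-1)%N -> (l.+1 <= 2 * (2 ^ i).-1.+1)%N.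
Proof. by have := expn_gt0 2 i; rewrite expnS; split=> [|l]; lia. Qed.

Lemma weight_energy_le (C D c v w : R) : 0 <= C -> 1 <= D -> 0 <= c -> 0 < v -> 0 < w ->
  v <= D * w ->
  Num.sqrt (C * (c / v)) * v * (Num.sqrt (C * (c / w)) * c) <= C * D * c ^+ 2.
Proof.
move=> C0 D1 c0 v0 w0 vw; have D0 : 0 <= D by rewrite (le_trans ler01).
have qv : 0 <= C * (c / v) by rewrite mulr_ge0 ?divr_ge0 ?(ltW v0).
have qw : 0 <= C * (c / w) by rewrite mulr_ge0 ?divr_ge0 ?(ltW w0).
set p := Num.sqrt _; set q := Num.sqrt _.
have -> : p * v * (q * c) = (p * q * v) * c by ring.
have -> : C * D * c ^+ 2 = (C * c * D) * c by ring.
have p0 : 0 <= p by exact: sqrtr_ge0.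
have q0 : 0 <= q by exact: sqrtr_ge0.
rewrite ler_wpM2r// -(ler_pXn2r (n := 2)) ?nnegrE ?mulr_ge0 ?(ltW v0)//.
rewrite !exprMn !sqr_sqrtr//.
have -> : C * (c / v) * (C * (c / w)) * v ^+ 2 = C ^+ 2 * c ^+ 2 * (v / w).
  by field; rewrite !gt_eqF.
rewrite ler_wpM2l ?mulr_ge0 ?sqr_ge0// ler_pdivrMr// (le_trans vw)//.
by rewrite ler_wpM2r ?(ltW w0)// expr2 ler_peMl.
Qed.

(** Only a sum over a dyadic range of times is controlled, but for that the
    energies telescope. In the weight of a vertex, one power of [decay] pays
    for the summation over vertices and another for the factor small when the
    time is small compared with [r ^ a]. *)
Lemma gradient_hk_block : exists2 C : R, 0 < C &
  forall y r (E : seq G) (i : nat), 0 < r -> uniq E ->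
    (forall x, x \in E -> r <= (d x y)%:R) ->
    \sum_((2 ^ i).-1 <= l < (2 ^ i.+1).-1)
        (\sum_(x <- E) gradient mu (hk mu l y) x * m x) ^+ 2 <=
    C * m y ^+ 2 * Num.min 1 (2 ^+ i / r `^ a).
Proof.
have [D D1 dbl] := doubling_ge1 (mu := mu).
have [M0 [C1 C10 sumd]] := sum_decay_le (mu := mu).
have [Q dtime] := decay_time (mu := mu).
pose M := (M0 + Q)%N.
have [C C0 kd] := hk_decay (mu := mu) (M * 2).
set K := 4 * (1 + (sg_eps mu)^-1).
have K0 : 0 < K by rewrite mulr_gt0 ?addr_gt0 ?invr_gt0 ?sg_eps_gt0.
have gsum := @gradient_sum_sqr_le; rewrite -/K in gsum; clearbody K.
have D0 : 0 < D by rewrite (lt_le_trans _ D1).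
exists (K * (2 ^+ M * C1) * C * D * 2).
  by rewrite !mulr_gt0 ?exprn_gt0.
move=> y r E i r0 uE Er.
set my := m y; have my0 : 0 < my := vweight_gt0 mu y.
pose W l := V y (rho mu l).
have W0 l : 0 < W l := volume_gt0 y (rho_gt0 l).
pose A l := Num.sqrt (C * (my / W l)).
have A0 l : 0 <= A l by exact: sqrtr_ge0.
have cW l : 0 <= C * (my / W l) by rewrite mulr_ge0 ?divr_ge0 ?ltW.
have sqrt_hk l z : Num.sqrt (hk mu l y z) <= A l * decay (rho mu l) z y ^+ M.
  have dec0 : 0 <= decay (rho mu l) z y by exact/decay_ge0/rho_gt0.
  rewrite -(ler_pXn2r (n := 2)) ?nnegrE ?mulr_ge0 ?exprn_ge0 ?sqrtr_ge0//.
  by rewrite exprMn !sqr_sqrtr// ?hk_ge0// -exprM kd.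
pose theta := Num.min 1 (2 ^+ i.+1 / r `^ a).
have ra : 0 < r `^ a by exact: powR_gt0.
have theta0 : 0 <= theta by rewrite le_min ler01 divr_ge0 ?exprn_ge0 ?ltW.
pose B l x := A l * (2 ^+ M * decay (rho mu l) x y ^+ M).
have sumB l : (l < (2 ^ i.+1).-1)%N ->
    \sum_(x <- E) B l x * m x <= A l * (2 ^+ M * (theta * (C1 * W l))).
  move=> li; under eq_bigr do rewrite /B -mulrA -mulrA.
  rewrite -!mulr_sumr ler_wpM2l// ler_wpM2l ?exprn_ge0//.
  apply: le_trans (_ : theta * \sum_(x <- E) decay (rho mu l) x y ^+ M0 * m x <= _); last first.
    by rewrite ler_wpM2l// sumd// rho_gt0.
  rewrite mulr_sumr !big_seq; apply: ler_sum => x xE.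
  rewrite mulrA ler_wpM2r ?vweight_ge0// /M exprD mulrC.
  have rl := rho_gt0 (mu := mu) l.
  rewrite ler_wpM2r ?exprn_ge0 ?decay_ge0// le_min exprn_ile1 ?decay_ge0 ?decay_le1//=.
  apply: le_trans (dtime l x y r r0 (Er _ xE)) _.
  have li' : l.+1%:R <= 2 ^+ i.+1 :> R.
    by rewrite -natrX ler_nat; move: li; case: (2 ^ i.+1)%N => // n /ltnW.
  by apply: ler_wpM2r li'; rewrite invr_ge0 ltW.
have Ey l : energy (hk mu l y) <= A l * my.
  have [S hS] := hk_finsupp (mu := mu) l y.
  rewrite -[X in _ * X](mint_hk l y); apply: energy_le hS _ => [z|z]; first exact: hk_ge0.
  apply: le_trans (kd l z y) _; apply: ler_piMr; first exact: cW.
  by rewrite exprn_ile1 ?decay_ge0 ?decay_le1 ?rho_gt0//.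
pose e l := energy (hk mu l y).
have eS l : e l.+1 <= e l.
  have [S hS] := hk_finsupp (mu := mu) l y.
  rewrite /e hkS /energy -(mint_Pop (integrable_finsupp (sqrt3_finsupp hS))).
  apply: le_mint => [||x]; last by apply: sqrt3_Pop_le => z; exact: hk_ge0.
  - have [S' hS'] := hk_finsupp (mu := mu) l.+1 y.
    exact: integrable_finsupp (sqrt3_finsupp hS').
  - exact/integrable_Pop/(integrable_finsupp (sqrt3_finsupp hS)).
set k0 := (2 ^ i).-1; set k1 := (2 ^ i.+1).-1 in sumB *.
have [k01 k10] : (k0 <= k1)%N /\ forall l, (l < k1)%N -> (l.+1 <= 2 * k0.+1)%N := dyadic_block i.
(* The product of the weight and the energy is constant over the block, up to
   the doubling constant. *)
have AW l : (k0 <= l < k1)%N -> A l * W l * (A k0 * my) <= C * D * my ^+ 2.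
  move=> /andP[kl lk].
  have Wl : W l <= D * W k0.
    apply: le_trans (dbl _ _ (rho_gt0 k0)); exact/volume_mono/rho_double/k10.
  exact: (@weight_energy_le C D my (W l) (W k0) (ltW C0) D1 (ltW my0) (W0 l) (W0 k0) Wl).
clearbody k0 k1.
have step l : (k0 <= l < k1)%N ->
    (\sum_(x <- E) gradient mu (hk mu l y) x * m x) ^+ 2 <=
    K * (2 ^+ M * C1 * theta * (A l * W l)) * (e l - e l.+1).
  move=> kl; have [S hS] := hk_finsupp (mu := mu) l y.
  apply: le_trans (gsum _ _ _ (B l) _ hS uE _) _.
  - exact: hk_ge0.
  - move=> x xE z xz; apply: le_trans (sqrt_hk l z) _.
    rewrite /B ler_wpM2l// -exprMn.
    have rl := rho_gt0 (mu := mu) l.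
    by rewrite lerXn2r ?nnegrE ?mulr_ge0 ?decay_ge0// decay_adj.
  - rewrite -hkS -/(e l) -/(e l.+1) ler_wpM2r ?subr_ge0// ler_wpM2l ?(ltW K0)//.
    apply: le_trans (sumB l _) _; first by case/andP: kl.
    by rewrite le_eqVlt; apply/orP; left; apply/eqP; ring.
have Ak0 : 0 < A k0 * my by rewrite mulr_gt0// sqrtr_gt0 mulr_gt0 ?divr_gt0.
pose Z := C * D * my ^+ 2 / (A k0 * my).
have Z0 : 0 <= Z by rewrite divr_ge0 ?(ltW Ak0)// !mulr_ge0 ?sqr_ge0 ?(ltW C0) ?(ltW D0) ?(ltW my0).
have c0 : 0 <= 2 ^+ M * C1 * theta by rewrite !mulr_ge0 ?exprn_ge0 ?(ltW C10).
apply: (@le_trans _ _ (\sum_(k0 <= l < k1) K * (2 ^+ M * C1 * theta * Z) * (e l - e l.+1))).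
  rewrite big_nat_cond [leRHS]big_nat_cond; apply: ler_sum => l /andP[kl _].
  apply: le_trans (step l kl) _; rewrite ler_wpM2r ?subr_ge0// ler_wpM2l ?(ltW K0)//.
  by rewrite ler_wpM2l// ler_pdivlMr// AW.
rewrite -mulr_sumr.
have -> : \sum_(k0 <= l < k1) (e l - e l.+1) = e k0 - e k1.
  by rewrite -[RHS]opprB -(telescope_sumr e k01) -sumrN; apply: eq_bigr => l _; rewrite opprB.
apply: (@le_trans _ _ (K * (2 ^+ M * C1 * theta * Z) * (A k0 * my))).
  apply: ler_wpM2l; first exact: mulr_ge0 (ltW K0) (mulr_ge0 c0 Z0).
  by apply: le_trans (Ey k0); rewrite gerBl energy_ge0.
have -> : K * (2 ^+ M * C1 * theta * Z) * (A k0 * my) =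
    K * (2 ^+ M * C1) * C * D * my ^+ 2 * theta.
  have ZE : Z * (A k0 * my) = C * D * my ^+ 2 by rewrite /Z divfK// gt_eqF.
  rewrite -[LHS]mulrA -[X in K * X]mulrA ZE; ring.
have -> : K * (2 ^+ M * C1) * C * D * 2 * my ^+ 2 * Num.min 1 (2 ^+ i / r `^ a) =
    K * (2 ^+ M * C1) * C * D * my ^+ 2 * (2 * Num.min 1 (2 ^+ i / r `^ a)) by ring.
rewrite ler_wpM2l ?mulr_ge0 ?sqr_ge0 ?exprn_ge0 ?(ltW K0) ?(ltW C10) ?(ltW C0) ?(ltW D0) ?(ltW my0)//.
rewrite minr_pMr// le_min; apply/andP; split.
  by rewrite /theta ge_min; apply/orP; left; rewrite mulr1 ler1n.
by rewrite /theta ge_min; apply/orP; right; rewrite exprS mulrA.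
Qed.

End Energy.

(** * Truncated Riesz kernels after averaging *)

Section Averaging.
Context {R : realType}.
Implicit Types (i j k l n N s : nat) (x : R).

(** Why an average over [s] consecutive times: a single power [z ^ s] would
    bring back the large first coefficients of [invroot N] at the exponents just
    above [s], where the gradient of the kernel is only controlled in mean square
    over time. *)
Definition avgp s : {poly R} := \poly_(k < 2 * s) (if (s <= k)%N then s%:R^-1 else 0).

Lemma coef_avgp s k : (avgp s)`_k = if (s <= k < 2 * s)%N then s%:R^-1 else 0.
Proof. by rewrite coef_poly andbC; case: ltnP => //= _; case: ifP. Qed.

Lemma sum_avgp s (F : nat -> R) :
  \sum_(k < 2 * s) (avgp s)`_k * F k = s%:R^-1 * \sum_(t < s) F (s + t)%N.
Proof.
rewrite -(big_mkord xpredT (fun k => (avgp s)`_k * F k)).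
rewrite (big_cat_nat (n := s)) ?leq_pmull//= big_nat big1 ?add0r; last first.
  by move=> k /andP[_ ks]; rewrite coef_avgp leqNgt ks mul0r.
rewrite -{1}[s]add0n big_addn mul2n -addnn addnK big_mkord mulr_sumr.
apply: eq_bigr => t _; rewrite coef_avgp addnC leq_addr/= mul2n -addnn ltn_add2l.
by rewrite ltn_ord.
Qed.

Lemma size_avgp s : (size (avgp s) <= 2 * s)%N.
Proof. exact: size_poly. Qed.

Lemma pgf_avgp s : (0 < s)%N -> is_pgf (avgp s).
Proof.
move=> s0; split=> [k|].
  by rewrite coef_avgp; case: ifP => // _; rewrite invr_ge0.
rewrite (horner_coef_wide _ (size_avgp s)).
under eq_bigr do rewrite expr1n.
rewrite (sum_avgp s (fun=> 1)) sumr_const card_ord mulVf//.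
by rewrite pnatr_eq0 -lt0n.
Qed.

Definition riesz_coef N s : {poly R} := invroot N * (1 - avgp s).

Let al N l : R := (invroot N)`_l.

Lemma coef_riesz N s l : (riesz_coef N s)`_l =
  al N l - s%:R^-1 * \sum_(t < s) (if (s + t <= l)%N then al N (l - (s + t)) else 0).
Proof.
rewrite /riesz_coef mulrBr mulr1 coefB; congr (_ - _).
rewrite -(sum_avgp s (fun k => if (k <= l)%N then al N (l - k) else 0)).
rewrite mulrC coefM.
rewrite -(big_mkord xpredT (fun k => (avgp s)`_k * al N (l - k))).
rewrite -(big_mkord xpredT (fun k => (avgp s)`_k * (if (k <= l)%N then al N (l - k) else 0))).
have e1 : \sum_(0 <= k < l.+1) (avgp s)`_k * al N (l - k) =
   \sum_(0 <= k < l.+1) (avgp s)`_k * (if (k <= l)%N then al N (l - k) else 0).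
  by apply: eq_big_nat => k; rewrite ltnS => /= ->.
rewrite e1.
have [h|h] := leqP l.+1 (2 * s).
  rewrite [RHS](big_cat_nat (n := l.+1))//= [X in _ + X]big_nat [X in _ + X]big1 ?addr0//.
  by move=> k /andP[lk _]; rewrite leqNgt lk mulr0.
rewrite [LHS](big_cat_nat (n := (2 * s)%N))//=; last exact: ltnW.
rewrite [X in _ + X]big_nat [X in _ + X]big1 ?addr0// => k /andP[sk _].
by rewrite coef_avgp ltnNge sk andbF mul0r.
Qed.

Lemma sum_invroot_le N s : \sum_(i < s) al N i <= 2 * Num.sqrt s%:R.
Proof.
elim: s => [|s IH]; first by rewrite big_ord0 sqrtr0 mulr0.
rewrite big_ord_recr/=; set u := Num.sqrt s%:R in IH *; set v := Num.sqrt s.+1%:R.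
have u0 : 0 <= u by exact: sqrtr_ge0.
have v0 : 0 < v by rewrite sqrtr_gt0 ltr0n.
have u2 : u ^+ 2 = s%:R by rewrite sqr_sqrtr.
have v2 : v ^+ 2 = s%:R + 1 by rewrite sqr_sqrtr// natr1.
have : al N s * v <= 1.
  rewrite -(ler_pXn2r (n := 2)) ?nnegrE ?mulr_ge0 ?invroot_ge0 ?(ltW v0)//.
  by rewrite exprMn sqr_sqrtr// expr1n invroot_sqr.
move=> h; have : al N s <= 2 * (v - u).
  by rewrite -(ler_pM2r v0) (le_trans h)//; have := sqr_ge0 (v - u); lra.
by move=> ?; lra.
Qed.

Lemma avg_invroot_ge0 N s l :
  0 <= s%:R^-1 * \sum_(t < s) (if (s + t <= l)%N then al N (l - (s + t)) else 0).
Proof.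
rewrite mulr_ge0 ?invr_ge0// sumr_ge0// => t _; case: ifP => // _.
exact: invroot_ge0.
Qed.

(** The sum runs over at most [s] values of a decreasing sequence, so it is
    largest over the first [s] of them. *)
Lemma avg_invroot_le N s l : (0 < s)%N ->
  (s%:R^-1 * \sum_(t < s) (if (s + t <= l)%N then al N (l - (s + t)) else 0)) ^+ 2
  <= 4 / s%:R.
Proof.
move=> s0; set X := \sum_(_ < _) _.
have X0 : 0 <= X by apply: sumr_ge0 => t _; case: ifP => // _; exact: invroot_ge0.
have Xle : X <= \sum_(i < s) al N i.
  have [sl|ls] := leqP (2 * s) l.
    rewrite [leRHS](reindex_inj rev_ord_inj)/=; apply: ler_sum => t _.
    case: ifP => _; last exact: invroot_ge0.
    by apply: invroot_le; have := ltn_ord t; lia.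
  have [sl|ls'] := leqP s l; last first.
    rewrite /X big1 => [|t _]; first by apply: sumr_ge0 => i _; exact: invroot_ge0.
    by rewrite leqNgt (leq_trans ls')// leq_addr.
  rewrite /X -(big_mkord xpredT (fun t => if (s + t <= l)%N then al N (l - (s + t)) else 0)).
  rewrite -(big_mkord xpredT (fun t => al N t)).
  have ln : ((l - s).+1 <= s)%N by lia.
  rewrite (big_cat_nat (n := (l - s).+1))//= [X in _ + X]big_nat [X in _ + X]big1 ?addr0; last first.
    by move=> t /andP[lt _]; case: ifP => //; lia.
  rewrite [leRHS](big_cat_nat (n := (l - s).+1))//=.
  rewrite -[leLHS]addr0 lerD//; last first.
    by apply: sumr_ge0 => t _; exact: invroot_ge0.
  rewrite big_nat_rev/= !big_nat; apply: ler_sum => t /andP[_ tl].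
  by rewrite ifT; [apply: invroot_le|]; lia.
have s0' : 0 < s%:R :> R by rewrite ltr0n.
rewrite exprMn exprVn mulrC ler_pdivrMr ?exprn_gt0//.
have -> : 4 / s%:R * s%:R ^+ 2 = (2 * Num.sqrt s%:R) ^+ 2 :> R.
  by rewrite exprMn sqr_sqrtr ?(ltW s0')//; field; rewrite gt_eqF.
by rewrite lerXn2r ?nnegrE ?mulr_ge0 ?sqrtr_ge0// (le_trans Xle)// sum_invroot_le.
Qed.

Lemma riesz_coef_sqr N s l : (0 < s)%N ->
  (riesz_coef N s)`_l ^+ 2 <= l.+1%:R^-1 + 4 / s%:R.
Proof.
move=> s0; rewrite coef_riesz; have := avg_invroot_le N l s0.
have := avg_invroot_ge0 N s l; set X := s%:R^-1 * _ => X0 Xs.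
have a0 := invroot_ge0 (R := R) N l; rewrite -/(al N l) in a0.
have : al N l ^+ 2 <= l.+1%:R^-1.
  by rewrite -[leRHS]mul1r ler_pdivlMr ?ltr0n// invroot_sqr.
move: a0 Xs X0; move: (al N l) X (l.+1%:R^-1) (4 / s%:R) => u w L T u0 wT w0 uL.
have := mulr_ge0 u0 w0; have -> : (u - w) ^+ 2 = u ^+ 2 - 2 * (u * w) + w ^+ 2 by ring.
by move=> ?; lra.
Qed.

Lemma riesz_coef_late N s l : (0 < s)%N -> (2 * s <= l)%N ->
  0 <= - (riesz_coef N s)`_l <= al N (l - 2 * s) - al N l.
Proof.
move=> s0 sl; rewrite coef_riesz opprB.
have s0' : 0 < s%:R :> R by rewrite ltr0n.
have E c : s%:R^-1 * \sum_(t < s) c = c :> R.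
  by rewrite sumr_const card_ord -[c *+ _]mulr_natl mulKf// gt_eqF.
rewrite subr_ge0 lerD2r -{1}(E (al N l)) -(E (al N (l - 2 * s))).
rewrite !ler_pM2l ?invr_gt0//; apply/andP; split; apply: ler_sum => t _;
  have := ltn_ord t => ts; rewrite ifT; try lia; apply: invroot_le; lia.
Qed.

(** Monotonicity of [invroot N] is all that is used: the coefficients of
    [riesz_coef N s] are then differences that telescope. *)
Lemma riesz_coef_block N s i : (0 < s)%N -> (4 * s <= (2 ^ i).-1)%N ->
  \sum_((2 ^ i).-1 <= l < (2 ^ i.+1).-1) (riesz_coef N s)`_l ^+ 2 <=
  4 * s%:R / 2 ^+ i.
Proof.
move=> s0; have [k01 _] := dyadic_block i; rewrite -natrX -(prednK (expn_gt0 2 i)).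
move: k01; set k0 := (2 ^ i).-1; set k1 := (2 ^ i.+1).-1; clearbody k0 k1 => k01 sk.
set q := al N (k0 - 2 * s).
have q0 : 0 <= q by exact: invroot_ge0.
have s0' : 0 < s%:R :> R by rewrite ltr0n.
apply: (@le_trans _ _ (q * \sum_(k0 <= l < k1) (al N (l - 2 * s) - al N l))).
  rewrite mulr_sumr !big_nat; apply: ler_sum => l /andP[kl _].
  have /andP[b0 b1] : 0 <= - (riesz_coef N s)`_l <= al N (l - 2 * s) - al N l.
    by apply: riesz_coef_late => //; lia.
  have : - (riesz_coef N s)`_l <= q.
    apply: le_trans b1 _; rewrite lerBlDr (le_trans (y := q))//.
      by apply: invroot_le; lia.
    by rewrite lerDl invroot_ge0.
  by move: b0 b1; set b := (riesz_coef N s)`_l => *; nra.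
have -> : \sum_(k0 <= l < k1) (al N (l - 2 * s) - al N l) =
    \sum_(k0 - 2 * s <= l < k0) al N l - \sum_(k1 - 2 * s <= l < k1) al N l.
  rewrite sumrB.
  have -> : \sum_(k0 <= l < k1) al N (l - 2 * s) = \sum_(k0 - 2 * s <= l < k1 - 2 * s) al N l.
    rewrite -{1}[k0](@subnK (2 * s)); last by lia.
    rewrite big_addn; apply: eq_big_nat => l _; by rewrite addnK.
  have h1 : \sum_(k0 - 2 * s <= l < k1) al N l =
     \sum_(k0 - 2 * s <= l < k1 - 2 * s) al N l + \sum_(k1 - 2 * s <= l < k1) al N l.
    by rewrite (big_cat_nat (n := (k1 - 2 * s)%N)) //=; lia.
  have h2 : \sum_(k0 - 2 * s <= l < k1) al N l =
     \sum_(k0 - 2 * s <= l < k0) al N l + \sum_(k0 <= l < k1) al N l.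
    by rewrite (big_cat_nat (n := k0)) //=; lia.
  by move: h1; rewrite h2 => ?; lra.
apply: (@le_trans _ _ (q * (2 * s%:R * q))).
  rewrite ler_wpM2l// lerBlDr -[leLHS]addr0 lerD//; last first.
    by apply: sumr_ge0 => l _; exact: invroot_ge0.
  apply: (@le_trans _ _ (\sum_(k0 - 2 * s <= l < k0) q)).
    by rewrite !big_nat; apply: ler_sum => l /andP[kl _]; exact: invroot_le.
  rewrite sumr_const_nat subKn; last by lia.
  by rewrite -[q *+ _]mulr_natl natrM.
have := invroot_sqr (R := R) N (k0 - 2 * s); rewrite -/(al N _) -/q => hq.
have k0' : 0 < k0.+1%:R :> R by rewrite ltr0n.
rewrite ler_pdivlMr//.
have -> : q * (2 * s%:R * q) * k0.+1%:R = 2 * s%:R * (q ^+ 2 * k0.+1%:R) by ring.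
have -> : 4 * s%:R = 2 * s%:R * 2 :> R by ring.
rewrite ler_wpM2l ?mulr_ge0 ?(ltW s0')//.
apply: (@le_trans _ _ (q ^+ 2 * (2 * (k0 - 2 * s).+1%:R))).
  by rewrite ler_wpM2l ?sqr_ge0// -natrM ler_nat; lia.
by have := hq; lra.
Qed.

End Averaging.

(** ** A geometric sum *)

Section Geometric.
Context {R : realType}.
Implicit Types (n i : nat) (x : R).

(** The contribution of a dyadic block of times, as a function of the ratio of
    its time to the averaging time: it decays geometrically in both directions. *)
Definition hump x : R := Num.sqrt (Num.min x x^-1).

Lemma sqrt2_bounds : 7 / 5 <= Num.sqrt 2 :> R.
Proof.
rewrite -(ler_pXn2r (n := 2)) ?nnegrE ?sqrtr_ge0 ?divr_ge0//.
by rewrite sqr_sqrtr//; lra.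
Qed.

Lemma sum_hump_ge1 n x : 1 <= x ->
  \sum_(i < n) hump (2 ^+ i * x) <= 4 / Num.sqrt x.
Proof.
elim: n x => [|n IH] x x1; first by rewrite big_ord0 divr_ge0 ?sqrtr_ge0.
have x0 : 0 < x by rewrite (lt_le_trans _ x1).
rewrite big_ord_recl expr0 mul1r.
have -> : \sum_(i < n) hump (2 ^+ lift ord0 i * x) = \sum_(i < n) hump (2 ^+ i * (2 * x)).
  by apply: eq_bigr => i _; rewrite lift0 exprSr mulrA.
apply: le_trans (lerD (lexx _) (IH (2 * x) _)) _; first by lra.
have -> : hump x = (Num.sqrt x)^-1.
  by rewrite /hump min_r ?sqrtrV ?(ltW x0)// (le_trans _ x1)// invf_le1.
rewrite sqrtrM// invfM mulrA.
have h : 0 < (Num.sqrt x)^-1 by rewrite invr_gt0 sqrtr_gt0.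
set w := (Num.sqrt x)^-1 in h *.
have s2 : 4 / Num.sqrt 2 <= 3 :> R.
  by rewrite ler_pdivrMr ?sqrtr_gt0//; have := sqrt2_bounds; lra.
by nra.
Qed.

(** The potential [7 - 5/2 * sqrt x] decreases, under doubling of [x], by more
    than the current term [sqrt x]. *)
Lemma sum_hump_le2 n x : 0 < x -> x <= 2 ->
  \sum_(i < n) hump (2 ^+ i * x) <= 7 - 5 / 2 * Num.sqrt x.
Proof.
have s2 := sqrt2_bounds; have s2' : Num.sqrt 2 ^+ 2 = 2 :> R by rewrite sqr_sqrtr.
elim: n x => [|n IH] x x0 x2.
  rewrite big_ord0 subr_ge0.
  have : Num.sqrt x <= Num.sqrt 2 by exact: ler_wsqrtr.
  have := sqrtr_ge0 x; nra.
have y0 : 0 < Num.sqrt x by rewrite sqrtr_gt0.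
have [x1|x1] := leP 1 x.
  apply: le_trans (sum_hump_ge1 _ x1) _; rewrite ler_pdivrMr//.
  have y1 : 1 <= Num.sqrt x by rewrite -[leLHS]sqrtr1 ler_wsqrtr.
  have y2 : Num.sqrt x <= 3 / 2.
    rewrite -(ler_pXn2r (n := 2)) ?nnegrE ?divr_ge0 ?(ltW y0)// sqr_sqrtr ?(ltW x0)//; lra.
  by nra.
rewrite big_ord_recl expr0 mul1r.
have -> : \sum_(i < n) hump (2 ^+ lift ord0 i * x) = \sum_(i < n) hump (2 ^+ i * (2 * x)).
  by apply: eq_bigr => i _; rewrite lift0 exprSr mulrA.
apply: le_trans (lerD (lexx _) (IH (2 * x) _ _)) _; [lra|lra|].
have -> : hump x = Num.sqrt x.
  by rewrite /hump min_l// (le_trans (ltW x1))// invf_ge1// ltW.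
rewrite sqrtrM//; nra.
Qed.

Lemma sum_hump_le n x : 0 < x -> \sum_(i < n) hump (2 ^+ i * x) <= 7.
Proof.
move=> x0; have [x1|x1] := leP 1 x.
  apply: le_trans (sum_hump_ge1 _ x1) _.
  rewrite ler_pdivrMr ?sqrtr_gt0//.
  have : 1 <= Num.sqrt x by rewrite -[leLHS]sqrtr1 ler_wsqrtr.
  by move=> *; lra.
apply: le_trans (sum_hump_le2 _ x0 _) _; first by lra.
by have := sqrtr_ge0 x; lra.
Qed.

Lemma sum_dyadic n (F : nat -> R) : \sum_(0 <= l < (2 ^ n).-1) F l =
  \sum_(i < n) \sum_((2 ^ i).-1 <= l < (2 ^ i.+1).-1) F l.
Proof.
elim: n => [|n IH]; first by rewrite big_geq// big_ord0.
rewrite big_ord_recr/= -IH [LHS](big_cat_nat (n := (2 ^ n).-1))//=.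
by have [] := dyadic_block n.
Qed.

End Geometric.

Section FarKernel.
Context {R : realType} {G : countType} {mu : subgaussian_graph R G}.
Implicit Types (x y z : G) (n k l M N s : nat) (r : R) (f : G -> R).

Local Notation d := (gdist mu).
Local Notation m := (vweight mu).
Local Notation P := (Pop mu).
Local Notation a := (sg_dim mu).

Lemma dyadic_block_size i : ((2 ^ i.+1).-1 - (2 ^ i).-1 = 2 ^ i)%N.
Proof. by have := expn_gt0 2 i; rewrite expnS; lia. Qed.

(** Here [t] is the ratio of the time of a dyadic block to the averaging time,
    and [B] the square sum of the coefficients over the block. Early blocks gain
    from the distance, late blocks from the cancellation in the coefficients. *)
Lemma block_product_le (t : R) (B : R) : 0 < t -> 0 <= B -> B <= 1 + 4 * t ->
  (4 < t -> B <= 4 / t) -> B * Num.min 1 t <= 68 * Num.min t t^-1.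
Proof.
move=> t0 B0 B1 B2; have ti : 0 < t^-1 by rewrite invr_gt0.
have [t1|t1] := leP t 1.
  rewrite [in X in _ <= X]min_l; last by rewrite (le_trans t1)// invf_ge1.
  nra.
rewrite mulr1 [in X in _ <= X]min_r; last by rewrite (le_trans _ (ltW t1))// invf_le1// ltW.
have tt : t * t^-1 = 1 by rewrite divff// gt_eqF.
have [t4|t4] := leP t 4; last by have := B2 t4; lra.
nra.
Qed.

(** The off-diagonal estimate that drives the weak-type inequality: away from
    the centre, at the scale of the averaging time, the truncated Riesz
    kernel minus its average is integrable, uniformly in the truncation. On each
    dyadic block, Cauchy-Schwarz pairs the square sum of the coefficients with
    that of the gradients. *)
Lemma riesz_kernel_far : exists2 C : R, 0 < C &
  forall N s y r (E : seq G), (0 < s)%N -> 0 < r -> s%:R <= 2 * r `^ a ->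
    uniq E -> (forall x, x \in E -> r <= (d x y)%:R) ->
    \sum_(x <- E) gradient mu (pop mu (riesz_coef N s) (dirac_at y)) x * m x <= C * m y.
Proof.
have [C C0 blk] := gradient_hk_block (mu := mu).
pose K := Num.sqrt (C * 2 * 68).
have K0 : 0 < K by rewrite sqrtr_gt0 !mulr_gt0.
exists (K * 7); first by rewrite mulr_gt0.
move=> N s y r E s0 r0 sr uE Er.
have my0 : 0 < m y := vweight_gt0 mu y.
pose q : {poly R} := riesz_coef N s.
pose I := (size q).+1.
have szI : (size q <= (2 ^ I).-1)%N.
  by have := ltn_expl I (isT : 1 < 2)%N; rewrite /I; case: (2 ^ _)%N => // k /ltnW.
pose D l := \sum_(x <- E) gradient mu (hk mu l y) x * m x.
have D0 l : 0 <= D l.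
  by apply: sumr_ge0 => x _; rewrite mulr_ge0 ?gradient_ge0 ?vweight_ge0.
have ra : 0 < r `^ a by exact: powR_gt0.
have s0' : 0 < s%:R :> R by rewrite ltr0n.
apply: (@le_trans _ _ (\sum_(0 <= l < (2 ^ I).-1) `|q`_l| * D l)).
  rewrite big_mkord.
  apply: (@le_trans _ _ (\sum_(x <- E) \sum_(l < (2 ^ I).-1)
      (`|q`_l| * gradient mu (hk mu l y) x) * m x)).
    apply: ler_sum => x _; rewrite -mulr_suml ler_wpM2r ?vweight_ge0//.
    rewrite (popE _ szI); apply: le_trans (gradient_sum _ _ _) _.
    by apply: ler_sum => l _; rewrite gradientZ.
  rewrite exchange_big/=; apply: ler_sum => l _.
  by rewrite /D mulr_sumr; apply: ler_sum => x _; rewrite mulrA.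
rewrite sum_dyadic.
have block (i : 'I_I) : \sum_((2 ^ i).-1 <= l < (2 ^ i.+1).-1) `|q`_l| * D l <=
    K * m y * hump (2 ^+ i * s%:R^-1).
  have hb := blk y r E i r0 uE Er.
  set t := 2 ^+ i * s%:R^-1.
  have t0 : 0 < t by rewrite mulr_gt0 ?exprn_gt0 ?invr_gt0.
  pose B := \sum_((2 ^ i).-1 <= l < (2 ^ i.+1).-1) q`_l ^+ 2.
  have B0 : 0 <= B by apply: sumr_ge0 => l _; exact: sqr_ge0.
  have B1 : B <= 1 + 4 * t.
    apply: (@le_trans _ _ (\sum_((2 ^ i).-1 <= l < (2 ^ i.+1).-1) ((2 ^+ i)^-1 + 4 / s%:R))).
      rewrite /B !big_nat; apply: ler_sum => l /andP[il _].
      apply: le_trans (riesz_coef_sqr N l s0) _; rewrite lerD2r.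
      rewrite lef_pV2 ?posrE ?exprn_gt0 ?ltr0n// -natrX ler_nat.
      by have := expn_gt0 2 i; move: il; case: (2 ^ i)%N.
    rewrite sumr_const_nat.
    have -> : ((2 ^ i.+1).-1 - (2 ^ i).-1 = 2 ^ i)%N.
      exact: dyadic_block_size.
    rewrite -[_ *+ _]mulr_natr natrX mulrDl mulVf ?gt_eqF ?exprn_gt0// lerD2l.
    by rewrite /t mulrAC mulrA.
  have B2 : 4 < t -> B <= 4 / t.
    move=> t4; have -> : 4 / t = 4 * s%:R / 2 ^+ i.
      by rewrite /t; field; rewrite !gt_eqF ?exprn_gt0.
    apply: riesz_coef_block => //.
    move: t4; rewrite /t ltr_pdivlMr// -natrX -natrM ltr_nat.
    by case: (2 ^ i)%N => // k; rewrite ltnS.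
  have CS : (\sum_((2 ^ i).-1 <= l < (2 ^ i.+1).-1) `|q`_l| * D l) ^+ 2 <=
      B * (C * m y ^+ 2 * Num.min 1 (2 ^+ i / r `^ a)).
    apply: le_trans (sqr_sum_le _ _ _ _) _.
    have -> : \sum_((2 ^ i).-1 <= l < (2 ^ i.+1).-1) `|q`_l| ^+ 2 = B.
      by apply: eq_bigr => l _; rewrite real_normK ?num_real.
    by rewrite ler_wpM2l.
  have min2 : Num.min 1 (2 ^+ i / r `^ a) <= 2 * Num.min 1 t.
    rewrite minr_pMr// mulr1 le_min; apply/andP; split.
      by rewrite ge_min ler1n.
    rewrite ge_min; apply/orP; right; rewrite /t mulrCA ler_wpM2l ?exprn_ge0//.
    by rewrite ler_pdivlMr// mulrC ler_pdivrMr.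
  have h0 : 0 <= hump t by exact: sqrtr_ge0.
  rewrite -(ler_pXn2r (n := 2)) // ?nnegrE; last 2 first.
  - by apply: sumr_ge0 => l _; rewrite mulr_ge0.
  - by rewrite !mulr_ge0 ?(ltW K0) ?(ltW my0).
  apply: le_trans CS _; rewrite !exprMn /K /hump !sqr_sqrtr; last 2 first.
  - by rewrite le_min (ltW t0) invr_ge0 ltW.
  - by rewrite !mulr_ge0 ?(ltW C0).
  have := block_product_le t0 B0 B1 B2 => h.
  apply: (@le_trans _ _ (B * (C * m y ^+ 2 * (2 * Num.min 1 t)))).
    by rewrite ler_wpM2l// ler_wpM2l// mulr_ge0 ?sqr_ge0 ?(ltW C0).
  have -> : B * (C * m y ^+ 2 * (2 * Num.min 1 t)) =
    (C * 2 * m y ^+ 2) * (B * Num.min 1 t) by ring.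
  have -> : C * 2 * 68 * m y ^+ 2 * Num.min t t^-1 =
    (C * 2 * m y ^+ 2) * (68 * Num.min t t^-1) by ring.
  by rewrite ler_wpM2l// !mulr_ge0 ?sqr_ge0 ?(ltW C0) ?(ltW my0).
apply: le_trans (ler_sum _ (fun i _ => block i)) _.
rewrite -mulr_sumr [leRHS]mulrAC ler_wpM2l ?mulr_ge0 ?(ltW K0) ?(ltW my0)//.
by apply: sum_hump_le; rewrite invr_gt0.
Qed.

Definition norm1 f : R := mint mu (fun x => `|f x|).

Lemma norm1E f (A : seq G) : uniq A -> (forall x, x \notin A -> f x = 0) ->
  norm1 f = \sum_(x <- A) `|f x| * m x.
Proof. by move=> uA fA; apply: mint_finsupp => // x /fA ->; rewrite normr0. Qed.

Lemma sum_dirac f (A : seq G) : uniq A -> (forall x, x \notin A -> f x = 0) ->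
  f = (fun x => \sum_(y <- A) f y * dirac_at y x).
Proof.
move=> uA fA; apply: funext => x; have [xA|xA] := boolP (x \in A).
  rewrite (bigD1_seq x)//= /dirac_at eqxx mulr1 big1 ?addr0// => y.
  by rewrite eq_sym => /negPf ->; rewrite mulr0.
rewrite fA// big1_seq// => y /= yA; rewrite /dirac_at.
by case: eqP => [xy|]; [rewrite xy yA in xA|rewrite mulr0].
Qed.

Lemma pop_sum q I (t : seq I) (c : I -> R) (F : I -> G -> R) :
  pop mu q (fun x => \sum_(i <- t) c i * F i x) =
  (fun x => \sum_(i <- t) c i * pop mu q (F i) x).
Proof.
elim: t => [|i t IH].
  have -> : (fun x => \sum_(i <- [::]) c i * F i x) = (fun x : G => 0 * 0 + 0).
    by apply: funext => x; rewrite big_nil; ring.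
  rewrite (pop_linear q 0 (fun=> 0) (fun=> 0)); apply: funext => x.
  rewrite mul0r add0r big_nil /pop big1// => j _.
  have -> : iter j P (fun=> 0) = (fun=> 0); last by rewrite mulr0.
  by elim: (nat_of_ord j) => //= k ->; apply: funext => w; rewrite Pop_cst.
have -> : (fun x => \sum_(j <- i :: t) c j * F j x) =
    (fun x => c i * F i x + \sum_(j <- t) c j * F j x).
  by apply: funext => x; rewrite big_cons.
by rewrite pop_linear IH; apply: funext => x; rewrite big_cons.
Qed.

Lemma riesz_far : exists2 C : R, 0 < C &
  forall N s f r (A E : seq G), (0 < s)%N -> 0 < r -> s%:R <= 2 * r `^ a ->
    uniq A -> uniq E -> (forall x, x \notin A -> f x = 0) ->
    (forall x y, x \in E -> f y != 0 -> r <= (d x y)%:R) ->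
    \sum_(x <- E) gradient mu (pop mu (riesz_coef N s) f) x * m x <= C * norm1 f.
Proof.
have [C C0 far] := riesz_kernel_far; exists C => // N s f r A E s0 r0 sr uA uE fA Ef.
rewrite (norm1E uA fA) {1}(sum_dirac uA fA) pop_sum.
apply: (@le_trans _ _ (\sum_(x <- E) \sum_(y <- A)
    (`|f y| * gradient mu (pop mu (riesz_coef N s) (dirac_at y)) x) * m x)).
  apply: ler_sum => x _; rewrite -mulr_suml ler_wpM2r ?vweight_ge0//.
  apply: le_trans (gradient_sum _ _ _) _.
  by apply: ler_sum => y _; rewrite gradientZ.
rewrite exchange_big/= mulr_sumr; apply: ler_sum => y _.
under eq_bigr do rewrite -mulrA.
rewrite -mulr_sumr mulrCA.
have [->|fy] := eqVneq (f y) 0; first by rewrite normr0 !mul0r.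
rewrite ler_wpM2l// (far _ _ _ r)// => x xE; exact: Ef.
Qed.

End FarKernel.

Arguments norm1 {R G} mu f.

(** * Averages of functions concentrated on disjoint balls *)

Section Overlap.
Context {R : realType} {G : countType} {mu : subgaussian_graph R G}.
Implicit Types (x y z w : G) (n k l M N s : nat) (f g : G -> R) (rad : G -> nat).

Local Notation d := (gdist mu).
Local Notation m := (vweight mu).
Local Notation P := (Pop mu).
Local Notation V := (volume mu).
Local Notation a := (sg_dim mu).
Local Notation decay := (@decay R G mu).

Definition disjoint_balls (J : seq G) rad := forall z z' w, z \in J -> z' \in J ->
  (d z w < rad z)%N -> (d z' w < rad z')%N -> z = z'.

Lemma uniq_balls J rad : uniq J -> disjoint_balls J rad ->
  uniq (flatten [seq ball mu z (rad z)%:R | z <- J]).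
Proof.
elim: J => //= z J IH /andP[zJ uJ] dJ; rewrite cat_uniq ball_uniq IH//=; last first.
  by move=> u v w uJ' vJ; apply: dJ; rewrite inE ?uJ' ?vJ orbT.
rewrite andbT; apply/hasPn => w /flattenP[_ /mapP[z' z'J ->]].
rewrite !mem_ball !ltr_nat => wz'; apply/negP => wz.
have zz' : z = z' by apply: (dJ z z' w) => //; rewrite inE ?eqxx ?z'J ?orbT.
by rewrite zz' z'J in zJ.
Qed.

Lemma sum_balls J rad (F : G -> R) :
  \sum_(z <- J) \sum_(w <- ball mu z (rad z)%:R) F w =
  \sum_(w <- flatten [seq ball mu z (rad z)%:R | z <- J]) F w.
Proof. by rewrite big_flatten/= big_map. Qed.

Lemma time_scale s k : (k <= 4 * s)%N ->
  (k.+1 <= 2 * (2 * s).+2)%N /\ ((2 * s).+2 <= 2 * s.+1)%N.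
Proof. by split; lia. Qed.

Lemma gdist_two_balls x y z w n : (d z y < 2 * n)%N -> (d z w < n)%N ->
  (d w x <= 3 * n + d y x)%N.
Proof.
have := gdist_triangle (mu := mu) z w x; have := gdist_triangle (mu := mu) y z x.
by rewrite (gdistC w z); lia.
Qed.

(** The function [x |-> iter k P |b| x], for [b] with small mean over a ball of
    radius at most [rho s], is dominated by the integral over that ball of one
    fixed integrable kernel; summing over disjoint balls then costs nothing.
    The kernel must not depend on [k], because the balls are later averaged
    over different times. *)
Lemma overlap : exists2 C : R, 0 < C &
  exists U : nat -> nat -> G -> G -> R,
  [/\ forall s n z x, 0 <= U s n z x,
      forall s k n z x (A : seq G) (b : G -> R) (t : R), (s <= k <= 4 * s)%N ->
        n%:R <= rho mu s -> uniq A -> (forall y, y \notin A -> b y = 0) ->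
        (forall y, b y != 0 -> (d z y < 2 * n)%N) -> 0 <= t ->
        norm1 mu b <= t * V z n%:R ->
        iter k P (fun y => `|b y|) x <= t * U s n z x &
      forall s J rad x, uniq J -> disjoint_balls J rad ->
        \sum_(z <- J) U s (rad z) z x <= C].
Proof.
have [M [C1 C10 sumd]] := sum_decay_le (mu := mu).
have [C C0 kd] := hk_decay (mu := mu) M.
pose K := C * 4 ^+ M * 4 ^+ M.
have K0 : 0 < K by rewrite !mulr_gt0 ?exprn_gt0.
pose U s n z x := K / V x (rho mu s) *
  \sum_(w <- ball mu z n%:R) decay (rho mu s) w x ^+ M * m w.
have U0 s n z x : 0 <= U s n z x.
  rewrite mulr_ge0 ?divr_ge0 ?(ltW K0) ?(ltW (volume_gt0 _ (rho_gt0 _)))//.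
  apply: sumr_ge0 => w _; rewrite mulr_ge0 ?vweight_ge0 ?exprn_ge0// decay_ge0//.
  exact: rho_gt0.
exists (K * C1); first by rewrite mulr_gt0.
exists U; split => //.
- move=> s k n z x A b t /andP[sk ks] ns uA bA bz t0 bt.
  have rs0 := rho_gt0 (mu := mu) s; have rk0 := rho_gt0 (mu := mu) k.
  have Vx0 := volume_gt0 (mu := mu) x rs0; have mx0 := vweight_gt0 mu x.
  have rsk : rho mu s <= rho mu k by exact: rho_mono.
  have rks : rho mu k <= 4 * rho mu s.
    have h1 : rho mu k <= 2 * rho mu (2 * s).+1 by apply: rho_double; exact: (time_scale ks).1.
    have h2 : rho mu (2 * s).+1 <= 2 * rho mu s by apply: rho_double; exact: (time_scale ks).2.
    by lra.
  (* The time k is replaced by s, and a vertex y of the support by any w in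
     the ball; each change of argument costs a factor 4 in the decay. *)
  have dk y : decay (rho mu k) y x <= 4 * decay (rho mu s) y x.
    rewrite /decay ler_pdivlMr; last by rewrite ltr_pwDl// divr_ge0// ltW.
    rewrite mulrC ler_pdivrMr; last by rewrite ltr_pwDl// divr_ge0// ltW.
    rewrite mulrDr mulr1 lerD ?ler1n//.
    rewrite mulrCA ler_wpM2l// ler_pdivlMr// mulrC ler_pdivrMr//.
  have dw y w : (d z y < 2 * n)%N -> (d z w < n)%N ->
      decay (rho mu s) y x <= 4 * decay (rho mu s) w x.
    move=> zy zw; rewrite /decay ler_pdivlMr; last by rewrite ltr_pwDl// divr_ge0// ltW.
    rewrite mulrC ler_pdivrMr; last by rewrite ltr_pwDl// divr_ge0// ltW.
    have : (d w x)%:R <= 3 * n%:R + (d y x)%:R :> R.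
      by rewrite -(natrM _ 3) -natrD ler_nat; exact: gdist_two_balls zy zw.
    rewrite -(ler_pM2r (_ : 0 < (rho mu s)^-1)) ?invr_gt0// mulrDl -mulrA.
    have : n%:R / rho mu s <= 1 by rewrite ler_pdivrMr// mul1r.
    have : 0 <= (d y x)%:R / rho mu s by rewrite divr_ge0// ltW.
    by move=> *; lra.
  have hkb y w : (d z y < 2 * n)%N -> (d z w < n)%N ->
      hk mu k y x <= K / V x (rho mu s) * (decay (rho mu s) w x ^+ M) * m y.
    move=> zy zw.
    have -> : hk mu k y x = hk mu k x y * m y / m x.
      by rewrite -(hk_sym k x y) mulfK// gt_eqF.
    rewrite ler_pdivrMr// mulrAC ler_wpM2r ?vweight_ge0//.
    apply: le_trans (kd k y x) _.
    have e1 : decay (rho mu k) y x ^+ M <= 4 ^+ M * 4 ^+ M * decay (rho mu s) w x ^+ M.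
      rewrite -!exprMn lerXn2r ?nnegrE ?mulr_ge0 ?decay_ge0//.
      apply: le_trans (dk y) _; rewrite -mulrA ler_wpM2l//; exact: dw.
    have e2 : m x / V x (rho mu k) <= m x / V x (rho mu s).
      rewrite ler_wpM2l ?(ltW mx0)// lef_pV2 ?posrE ?volume_gt0//.
      exact: volume_mono.
    apply: (@le_trans _ _ (C * (m x / V x (rho mu s)) *
       (4 ^+ M * 4 ^+ M * decay (rho mu s) w x ^+ M))).
      apply: ler_pM => //.
      + by rewrite mulr_ge0 ?divr_ge0 ?(ltW C0) ?(ltW mx0) ?(ltW (volume_gt0 _ rk0)).
      + by rewrite exprn_ge0// decay_ge0.
      + by rewrite ler_wpM2l ?(ltW C0).
    by rewrite le_eqVlt; apply/orP; left; apply/eqP; rewrite /K; ring.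
  have bE : iter k P (fun y => `|b y|) x = \sum_(y <- A) `|b y| * hk mu k y x.
    have bA' y : y \notin A -> `|b y| = 0 by move=> /bA ->; rewrite normr0.
    rewrite (sum_dirac uA bA') iterP_sum; apply: eq_bigr => y _.
    by rewrite iterPZ.
  have one w : (d z w < n)%N -> iter k P (fun y => `|b y|) x <=
      K / V x (rho mu s) * decay (rho mu s) w x ^+ M * norm1 mu b.
    move=> zw; rewrite bE (norm1E uA bA) mulr_sumr; apply: ler_sum => y _.
    have [->|by0] := eqVneq (b y) 0; first by rewrite normr0 !mul0r mulr0.
    by rewrite mulrCA ler_wpM2l// hkb// bz.
  have n0 : (0 < n)%N \/ norm1 mu b = 0.
    case: n bz {ns bt dw hkb one} => [|n] bz; [right|by left].
    rewrite (norm1E uA bA) big1// => y _.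
    have [->|/bz] := eqVneq (b y) 0; first by rewrite normr0 mul0r.
    by rewrite muln0 ltn0.
  have it0 : 0 <= iter k P (fun y => `|b y|) x by apply: iterP_ge0.
  case: n0 => [n0|b0]; last first.
    have -> : iter k P (fun y => `|b y|) x = 0.
      rewrite bE big1_seq// => y /= yA.
      have : `|b y| * m y <= 0.
        rewrite -b0; apply: (mint_point (f := fun y => `|b y|)) => //.
        by apply: (integrable_finsupp (A := A)) => w /bA ->; rewrite normr0.
      rewrite pmulr_lle0 ?vweight_gt0// normr_le0 => /eqP ->.
      by rewrite normr0 mul0r.
    exact: mulr_ge0 t0 (U0 _ _ _ _).
  have Vz0 : 0 < V z n%:R by rewrite volume_gt0// ltr0n.
  rewrite -(ler_pM2r Vz0) {1}volumeE mulr_sumr /U.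
  have -> : t * (K / V x (rho mu s) * \sum_(w <- ball mu z n%:R) decay (rho mu s) w x ^+ M * m w) * V z n%:R
     = \sum_(w <- ball mu z n%:R) K / V x (rho mu s) * decay (rho mu s) w x ^+ M * (t * V z n%:R) * m w.
    rewrite !mulr_sumr mulr_suml; apply: eq_bigr => w _; ring.
  rewrite !big_seq; apply: ler_sum => w; rewrite mem_ball ltr_nat => zw.
  rewrite ler_wpM2r ?vweight_ge0//; apply: le_trans (one w zw) _.
  have KV0 : 0 <= K / V x (rho mu s) by exact: divr_ge0 (ltW K0) (ltW Vx0).
  apply: ler_wpM2l bt; apply: mulr_ge0; first exact: KV0.
  by rewrite exprn_ge0// decay_ge0.
- move=> s J rad x uJ dJ.
  have Vx0 := volume_gt0 (mu := mu) x (rho_gt0 (mu := mu) s).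
  rewrite /U -mulr_sumr sum_balls -mulrA ler_wpM2l ?(ltW K0)//.
  rewrite mulrC ler_pdivrMr// sumd ?rho_gt0//; exact: uniq_balls.
Qed.

End Overlap.

Section Averages.
Context {R : realType} {G : countType} {mu : subgaussian_graph R G}.
Implicit Types (x y z w : G) (n k l M N : nat) (f g : G -> R) (rad : G -> nat).

Local Notation d := (gdist mu).
Local Notation m := (vweight mu).
Local Notation P := (Pop mu).
Local Notation V := (volume mu).

Lemma pgfM (p q : {poly R}) : is_pgf p -> is_pgf q -> is_pgf (p * q).
Proof.
move=> [p0 p1] [q0 q1]; split=> [k|]; last by rewrite hornerM p1 q1 mulr1.
by rewrite coefM sumr_ge0// => i _; rewrite mulr_ge0.
Qed.

Lemma avgpM_supp s s' k : (s' <= s)%N -> (avgp s * avgp s' : {poly R})`_k != 0 ->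
  (s <= k <= 4 * s)%N.
Proof.
move=> ss; apply: contraR => hk; rewrite coefM big1// => i _.
rewrite !coef_avgp; case: ifP => h1; last by rewrite mul0r.
case: ifP => h2; last by rewrite mulr0.
by exfalso; have := ltn_ord i; move: h1 h2 hk ss => /andP[? ?] /andP[? ?]; lia.
Qed.

Lemma pop_pgf_le (w : {poly R}) f x (c : R) : is_pgf w ->
  (forall k, w`_k != 0 -> iter k P (fun y => `|f y|) x <= c) ->
  `|pop mu w f x| <= c.
Proof.
move=> wP h; have [w0 _] := wP.
rewrite -[c]mul1r -(pgf_sum wP (leqnn _)) mulr_suml.
apply: le_trans (ler_norm_sum _ _ _) _; apply: ler_sum => k _.
have [->|wk] := eqVneq (w`_k) 0; first by rewrite !mul0r normr0.
rewrite normrM (ger0_norm (w0 _)) ler_wpM2l// (le_trans (iterP_norm _ _ _))//.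
exact: h.
Qed.

(** The averaged pieces are almost orthogonal: in the double sum, the ball with
    the larger radius fixes the scale at which the smaller ones are seen. *)
Lemma nsq_averages : exists2 C : R, 0 < C &
  forall (J : seq G) rad (s : G -> nat) (b : G -> G -> R) (A : seq G) (t : R),
  uniq J -> disjoint_balls (mu := mu) J rad -> 0 <= t -> uniq A ->
  (forall z, z \in J -> (0 < s z)%N /\ (rad z)%:R <= rho mu (s z)) ->
  (forall z z', (rad z' <= rad z)%N -> (s z' <= s z)%N) ->
  (forall z y, y \notin A -> b z y = 0) ->
  (forall z y, b z y != 0 -> (d z y < 2 * rad z)%N) ->
  (forall z, z \in J -> norm1 mu (b z) <= t * V z (rad z)%:R) ->
  nsq mu (fun x => \sum_(z <- J) pop mu (avgp (s z)) (b z) x) <=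
  C * t * \sum_(z <- J) norm1 mu (b z).
Proof.
have [C C0 [U [U0 Ub Usum]]] := overlap (mu := mu).
exists (2 * C); first by rewrite mulr_gt0.
move=> J rad s b A t uJ dJ t0 uA sJ sm bA brad bn.
pose h z := pop mu (avgp (s z)) (b z).
have hb z : L2 mu (b z) := L2_finsupp (bA z).
have hh z : L2 mu (h z) := L2_pop _ (hb z).
have pair z z' : z \in J -> z' \in J -> (rad z' <= rad z)%N ->
    `|ip mu (h z) (h z')| <= \sum_(x <- A) (`|b z x| * m x) * (t * U (s z) (rad z') z' x).
  move=> zJ z'J zz'; have [sz rz] := sJ _ zJ; have [sz' _] := sJ _ z'J.
  rewrite /h ip_pop; [rewrite -popM /ip|exact: hb|exact: hh].
  rewrite (@mint_finsupp _ _ _ _ A)//; last by move=> x /bA ->; rewrite mul0r.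
  apply: le_trans (ler_norm_sum _ _ _) _; apply: ler_sum => x _.
  rewrite !normrM mulrAC (ger0_norm (vweight_ge0 x)) ler_wpM2l//.
    by rewrite mulr_ge0// vweight_ge0.
  apply: pop_pgf_le; first by apply: pgfM; exact: pgf_avgp.
  move=> k /(avgpM_supp (sm _ _ zz')) sk.
  apply: (Ub _ _ _ _ _ A _ _ sk _ uA (bA z') (brad z') t0 (bn _ z'J)).
  by apply: le_trans rz; rewrite ler_nat.
have -> : nsq mu (fun x => \sum_(z <- J) h z x) =
    \sum_(z <- J) \sum_(z' <- J) ip mu (h z) (h z').
  rewrite /nsq ip_suml//; last exact: L2_sum.
  apply: eq_bigr => z _; rewrite ipC ip_suml//.
  by apply: eq_bigr => z' _; rewrite ipC.
pose S := \sum_(z <- J) \sum_(z' <- J | (rad z' <= rad z)%N) `|ip mu (h z) (h z')|.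
apply: (@le_trans _ _ (2 * S)).
  have S1 : S = \sum_(z <- J) \sum_(z' <- J)
      (if (rad z' <= rad z)%N then `|ip mu (h z) (h z')| else 0).
    by rewrite /S; apply: eq_bigr => z _; rewrite big_mkcond.
  have S2 : S = \sum_(z <- J) \sum_(z' <- J)
      (if (rad z <= rad z')%N then `|ip mu (h z) (h z')| else 0).
    rewrite S1 exchange_big/=; apply: eq_bigr => z _; apply: eq_bigr => z' _.
    by rewrite ipC.
  have -> : 2 * S = S + S by ring.
  rewrite {1}S1 S2 -big_split/=; apply: ler_sum => z _; rewrite -big_split/=.
  apply: ler_sum => z' _.
  have n0 := normr_ge0 (ip mu (h z) (h z')); have n1 := ler_norm (ip mu (h z) (h z')).
  case: (leqP (rad z') (rad z)) => h1; first by case: ifP => _; lra.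
  by rewrite (ltnW h1); lra.
rewrite -!mulrA ler_wpM2l// /S !mulr_sumr !big_seq; apply: ler_sum => z zJ.
apply: (@le_trans _ _ (\sum_(z' <- J) \sum_(x <- A)
    (`|b z x| * m x) * (t * U (s z) (rad z') z' x))).
  rewrite big_mkcond !big_seq; apply: ler_sum => z' z'J.
  case: ifP => zz'; first exact: pair.
  by apply: sumr_ge0 => x _; rewrite !mulr_ge0 ?vweight_ge0.
rewrite exchange_big/= (norm1E uA (bA z)).
have -> : C * (t * \sum_(x <- A) `|b z x| * m x) =
    \sum_(x <- A) (`|b z x| * m x) * (t * C).
  by rewrite mulrA mulr_sumr; apply: eq_bigr => x _; ring.
apply: ler_sum => x _; rewrite -!mulr_sumr.
apply: ler_wpM2l; first by rewrite mulr_ge0 ?vweight_ge0.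
by rewrite ler_wpM2l// Usum.
Qed.

End Averages.

(** * The Calderon-Zygmund decomposition *)

Section CalderonZygmund.
Context {R : realType} {G : countType} {mu : subgaussian_graph R G}.
Implicit Types (x y z w : G) (n k l : nat) (f g : G -> R) (rad : G -> nat) (lam : R).

Local Notation d := (gdist mu).
Local Notation m := (vweight mu).
Local Notation V := (volume mu).

(** Greedy selection of balls, largest radius first. *)
Lemma vitali (L : seq G) rad : (forall x, x \in L -> (0 < rad x)%N) ->
  exists J : seq G, [/\ uniq J, {subset J <= L}, disjoint_balls (mu := mu) J rad &
    forall x, x \in L -> exists2 z, z \in J &
      (rad x <= rad z)%N /\ exists w, (d x w < rad x)%N /\ (d z w < rad z)%N].
Proof.
pose le x y := (rad x <= rad y)%N.
have le_tr : transitive le by move=> y x z; exact: leq_trans.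
have le_tot : total le by move=> x y; exact: leq_total.
move=> L0; have := sort_sorted le_tot L; have := mem_sort le L.
move: L0 (sort le L) => + L' eL; rewrite sorted_pairwise//.
have -> : (forall x, x \in L -> (0 < rad x)%N) <-> forall x, x \in L' -> (0 < rad x)%N.
  by split=> h x; [rewrite eL|rewrite -eL] => /h.
suff : forall L', (forall x, x \in L' -> (0 < rad x)%N) -> pairwise le L' ->
    exists J : seq G, [/\ uniq J, {subset J <= L'}, disjoint_balls (mu := mu) J rad &
    forall x, x \in L' -> exists2 z, z \in J &
      (rad x <= rad z)%N /\ exists w, (d x w < rad x)%N /\ (d z w < rad z)%N].
  move=> h L0 sL; have [J [uJ JL dJ hJ]] := h _ L0 sL; exists J; split=> // x.
    by move=> /JL; rewrite eL.
  by rewrite -eL => /hJ.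
elim=> [|x L1 IH] L0 /=; first by exists [::].
move=> /andP[xL /(IH (fun y yL => L0 y (mem_behead (s := x :: L1) yL)))[J [uJ JL dJ hJ]]].
have x0 : (0 < rad x)%N by apply: L0; rewrite mem_head.
have [[z zJ [w [xw zw]]]|nz] := pselect (exists2 z, z \in J &
    exists w, (d x w < rad x)%N /\ (d z w < rad z)%N).
  exists J; split=> // [y /JL yL|y]; first by rewrite inE yL orbT.
  rewrite inE => /orP[/eqP ->|/hJ//]; exists z => //; split; last by exists w.
  by move/allP: xL => /(_ z (JL _ zJ)).
have nz' z w : z \in J -> (d x w < rad x)%N -> (d z w < rad z)%N -> False.
  by move=> zJ xw zw; apply: nz; exists z => //; exists w.
exists (x :: J); split.
- rewrite /= uJ andbT; apply/negP => xJ.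
  by apply: (nz' x x) => //; rewrite gdistxx.
- by move=> y; rewrite !inE => /orP[->//|/JL ->]; rewrite orbT.
- move=> z z' w; rewrite !inE => /orP[/eqP->|zJ] /orP[/eqP->|z'J] zw z'w //.
  + by exfalso; apply: (nz' z' w).
  + by exfalso; apply: (nz' z w).
  + exact: (dJ z z' w).
- move=> y; rewrite inE => /orP[/eqP ->|/hJ[z zJ h]]; last first.
    by exists z => //; rewrite inE zJ orbT.
  by exists x; [rewrite mem_head|split=> //; exists x; rewrite gdistxx].
Qed.

Lemma sum_unique_le (J : seq G) (Q : pred G) (c : R) : uniq J -> 0 <= c ->
  (forall z z', z \in J -> z' \in J -> Q z -> Q z' -> z = z') ->
  \sum_(z <- J | Q z) c <= c.
Proof.
elim: J => [|z J IH] /=; first by rewrite big_nil.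
move=> /andP[zJ uJ] c0 h; rewrite big_cons; case: ifP => Qz; last first.
  by apply: IH => // u v uJ' vJ; apply: h; rewrite inE ?uJ' ?vJ orbT.
rewrite big1_seq ?addr0// => z' /andP[Qz' z'J]; exfalso.
by move: zJ; rewrite (h z z') ?mem_head ?inE ?z'J ?orbT.
Qed.

Lemma volume1 x : V x 1 = m x.
Proof.
apply/eqP; rewrite eq_le volume_ge// andbT volumeE.
have -> : m x = \sum_(y <- [:: x]) m y by rewrite big_seq1.
apply: sum_sub_le => //; first by move=> y; exact: vweight_ge0.
  exact: ball_uniq.
by move=> y; rewrite mem_ball (ltr_nat R _ 1) ltnS leqn0 inE => /eqP/gdist0_eq ->.
Qed.

(** The bad function is [f] restricted to small balls where its mean is about
    [lam]; since the pieces are smoothed rather than corrected, they need not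
    have mean zero. The first alternative covers the case where the means
    exceed [lam] on arbitrarily large balls. *)
Lemma calderon_zygmund : exists2 C : R, 0 < C & forall f (A : seq G) lam,
  0 < lam -> uniq A -> (forall x, x \notin A -> f x = 0) ->
  (forall E : seq G, uniq E -> \sum_(x <- E) m x <= C / lam * norm1 mu f) \/
  exists (J : seq G) rad (b : G -> G -> R) g,
  [/\ [/\ uniq J, disjoint_balls (mu := mu) J rad & forall z, z \in J -> (0 < rad z)%N],
      [/\ forall x, f x = g x + \sum_(z <- J) b z x,
          forall x, `|g x| <= lam /\ `|g x| <= `|f x|,
          forall x, \sum_(z <- J) `|b z x| <= `|f x| &
          forall z x, `|b z x| <= `|f x|],
      forall z x, b z x != 0 -> (d z x < 2 * rad z)%N,
      forall z, z \in J -> norm1 mu (b z) <= lam * V z (2 * rad z)%:R &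
      \sum_(z <- J) lam * V z (rad z)%:R <= norm1 mu f].
Proof.
have [D D1 dbl] := doubling_ge1 (mu := mu).
have D0 : 0 < D by rewrite (lt_le_trans _ D1).
have dblk := doubling_iter D1 dbl.
exists (D ^+ 2); first by rewrite exprn_gt0.
move=> f A lam lam0 uA fA.
pose mass x n := \sum_(y <- A | (d x y < n)%N) `|f y| * m y.
pose bad x n := lam * V x n%:R < mass x n.
have fm0 y : 0 <= `|f y| * m y by rewrite mulr_ge0// vweight_ge0.
have massle x n : mass x n <= norm1 mu f.
  rewrite (norm1E uA fA) /mass [leRHS](bigID (fun y => (d x y < n)%N))/= lerDl.
  by apply: sumr_ge0 => y _.
have badA x n : bad x n -> exists2 y, y \in A & (d x y < n)%N.
  move=> bx; have : mass x n != 0.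
    rewrite gt_eqF// (le_lt_trans _ bx)// mulr_ge0 ?(ltW lam0)// volumeE sumr_ge0//.
    by move=> y _; exact: vweight_ge0.
  apply: contra_neqP => h; rewrite /mass big1_seq// => y /andP[xy yA].
  by exfalso; apply: h; exists y.
have [[K hK]|large] := pselect (exists K, forall x n, bad x n -> (n < K)%N); last first.
  left=> E uE; have [[x0 _]|nG] := pselect (exists x : G, True); last first.
    case: E uE => [|x E] _; last by exfalso; apply: nG; exists x.
    by rewrite big_nil mulr_ge0 ?divr_ge0 ?exprn_ge0 ?(ltW D0) ?(ltW lam0) ?mint_ge0.
  pose K := \max_(x <- E ++ A) (d x0 x).+1.
  have hK x : x \in E ++ A -> (d x0 x < K)%N.
    by move=> xE; rewrite /K; apply: (leq_bigmax_seq (F := fun x => (d x0 x).+1)).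
  have [x [n [bx Kn]]] : exists x n, bad x n /\ (K <= n)%N.
    apply: contrapT => h; apply: large; exists K => x n bx.
    by rewrite ltnNge; apply/negP => Kn; apply: h; exists x, n.
  have [y yA xy] := badA _ _ bx.
  have n0 : (0 < n)%N by case: n xy {bx Kn}.
  apply: (@le_trans _ _ (V x (2 ^+ 2 * n%:R))).
    apply: sum_le_volume => // z zE; rewrite -natrX -natrM ltr_nat.
    have h1 : (d x0 z < K)%N by apply: hK; rewrite mem_cat zE.
    have h2 : (d x0 y < K)%N by apply: hK; rewrite mem_cat yA orbT.
    have := gdist_triangle (mu := mu) y x z; have := gdist_triangle (mu := mu) x0 y z.
    by rewrite (gdistC y x0); lia.
  apply: le_trans (dblk 2 x n%:R _) _; first by rewrite ltr0n.
  rewrite -mulrA ler_wpM2l ?exprn_ge0 ?(ltW D0)// ler_pdivlMl//.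
  exact: le_trans (ltW bx) (massle _ _).
right.
pose Om := [seq x <- undup (flatten [seq ball mu y K%:R | y <- A]) | `[< exists n, bad x n >]].
have memOm x : (x \in Om) <-> exists n, bad x n.
  rewrite /Om mem_filter; split=> [/andP[/asboolP]//|h].
  apply/andP; split; first exact/asboolP.
  have [n bx] := h; have [y yA xy] := badA _ _ bx.
  rewrite mem_undup; apply/flattenP; exists (ball mu y K%:R); first exact: map_f.
  by rewrite mem_ball ltr_nat gdistC (ltn_trans xy)// (hK _ _ bx).
have /choice[rad hrad] x : exists n, x \in Om -> bad x n /\ forall k, bad x k -> (k <= n)%N.
  have [/memOm [n0 bx]|_] := boolP (x \in Om); last by exists 0%N.
  have ex : exists n, `[< bad x n >] by exists n0; apply/asboolP.
  have ub n : `[< bad x n >] -> (n <= K)%N by move=> /asboolP /hK /ltnW.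
  have [n /asboolP bn nmax] := ex_maxnP ex ub.
  by exists n => _; split=> // k bk; apply: nmax; apply/asboolP.
have rad0 x : x \in Om -> (0 < rad x)%N.
  move=> /hrad[/badA[y _]]; by case: (rad x).
have [J [uJ JOm dJ hJ]] := vitali rad0.
have /choice[c hc] x : exists z, x \in Om -> z \in J /\ (d z x < 2 * rad z)%N.
  have [xOm|_] := boolP (x \in Om); last by exists x.
  have [z zJ [xz [w [xw zw]]]] := hJ _ xOm; exists z => _; split=> //.
  have := gdist_triangle (mu := mu) w z x; rewrite (gdistC w x); lia.
pose b z x := if (x \in Om) && (c x == z) then f x else 0.
pose g x := if x \in Om then 0 else f x.
have bf z x : `|b z x| <= `|f x| by rewrite /b; case: ifP => _ //; rewrite normr0.
have brad z x : b z x != 0 -> (d z x < 2 * rad z)%N.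
  rewrite /b; case: ifP => [/andP[xOm /eqP <-] _|_]; last by rewrite eqxx.
  by have [] := hc _ xOm.
have bA z y : y \notin A -> b z y = 0.
  by move=> /fA fy; apply/eqP; rewrite -normr_le0 (le_trans (bf z y))// fy normr0.
have sumb (F : R -> R) x : F 0 = 0 ->
    \sum_(z <- J) F (b z x) = if x \in Om then F (f x) else 0.
  move=> F0; case: ifP => xOm; last by rewrite big1// => z _; rewrite /b xOm.
  have [cJ _] := hc _ xOm.
  rewrite (bigD1_seq (c x))//= /b xOm eqxx big1 ?addr0// => z.
  by rewrite eq_sym => /negPf ->.
exists J, rad, b, g; split => //.
- by split=> // z /JOm; exact: rad0.
- split=> // x.
  + by rewrite (sumb id)// /g; case: ifP => _; rewrite ?add0r ?addr0.
  + rewrite /g; case: ifP => xOm; first by rewrite normr0 (ltW lam0).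
    split=> //; have [xA|/fA ->] := boolP (x \in A); last by rewrite normr0 ltW.
    have : ~ bad x 1%N by move=> bx; move/negP: xOm; apply; apply/memOm; exists 1%N.
    move/negP; rewrite -leNgt volume1 => h.
    rewrite -(ler_pM2r (vweight_gt0 mu x)) (le_trans _ h)// /mass.
    rewrite (big_rem x)//= gdistxx/= lerDl sumr_ge0//.
  + by rewrite (sumb (fun u => `|u|)) ?normr0//; case: ifP.
- move=> z zJ; rewrite (norm1E uA (bA z)).
  have zOm := JOm _ zJ; have [bz zmax] := hrad _ zOm.
  apply: (@le_trans _ _ (mass z (2 * rad z))).
    rewrite /mass [leRHS]big_mkcond/=; apply: ler_sum => y _.
    case: ifP => zy; first by rewrite ler_wpM2r ?vweight_ge0.
    have [->|/brad] := eqVneq (b z y) 0; first by rewrite normr0 mul0r.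
    by rewrite zy.
  rewrite leNgt; apply/negP => /zmax; have := rad0 _ zOm; lia.
- apply: (@le_trans _ _ (\sum_(z <- J) mass z (rad z))).
    rewrite !big_seq; apply: ler_sum => z zJ; apply: ltW.
    by have [] := hrad _ (JOm _ zJ).
  rewrite (norm1E uA fA) /mass; under eq_bigr do rewrite big_mkcond.
  rewrite exchange_big/=; apply: ler_sum => y _; rewrite -big_mkcond/=.
  apply: sum_unique_le => // z z' zJ z'J; exact: dJ.
Qed.

End CalderonZygmund.

(** * The weak type inequality for the truncated Riesz transforms *)

Section WeakType.
Context {R : realType} {G : countType} {mu : subgaussian_graph R G}.
Implicit Types (x y z w : G) (n k l N : nat) (f g : G -> R) (lam : R).

Local Notation d := (gdist mu).
Local Notation m := (vweight mu).
Local Notation V := (volume mu).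
Local Notation a := (sg_dim mu).
Local Notation T := (@truncated_riesz R G mu).

(** The time at which the walk travels a distance about [n]. *)
Definition scale n : nat := (Num.truncn (n%:R `^ a : R)).+1.

Lemma scale_ge n : n%:R `^ a <= (scale n)%:R :> R.
Proof. by rewrite ltW// /scale truncnS_gt. Qed.

Lemma scale_le n : (0 < n)%N -> (scale n)%:R <= 2 * n%:R `^ a :> R.
Proof.
move=> n0; have n1 : 1 <= n%:R `^ a :> R.
  have {1}<- : (1 : R) `^ a = 1 by rewrite powR1.
  by apply: ge0_ler_powR; rewrite ?nnegrE ?ler1n// ltW// dim_gt0.
rewrite /scale -natr1 mulr2n mulrDl mul1r lerD//.
by rewrite truncn_le// powR_ge0.
Qed.

Lemma scale_mono n k : (n <= k)%N -> (scale n <= scale k)%N.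
Proof.
move=> nk; rewrite /scale ltnS; apply: le_truncn.
by apply: ge0_ler_powR; rewrite ?nnegrE ?ler_nat// ltW// dim_gt0.
Qed.

Lemma rho_scale n : n%:R <= rho mu (scale n).
Proof.
by apply: rho_ge => //; rewrite (le_trans (scale_ge n))// ler_nat.
Qed.

Lemma gdist_outside x y z n : (4 * n <= d z x)%N -> (d z y < 2 * n)%N ->
  (n <= d x y)%N.
Proof.
by have := gdist_triangle (mu := mu) y z x; rewrite (gdistC x y); lia.
Qed.

Lemma chebyshev (F : G -> R) (E : seq G) (t : R) : L2 mu F -> uniq E -> 0 < t ->
  \sum_(x <- E | t < F x) m x <= nsq mu F / t ^+ 2.
Proof.
move=> hF uE t0; rewrite ler_pdivlMr ?exprn_gt0// mulr_suml -big_filter.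
rewrite nsqE; apply: le_trans (sum_le_mint (filter_uniq _ uE) _ hF); last first.
  by move=> x; exact: sqr_ge0.
rewrite !big_seq; apply: ler_sum => x; rewrite mem_filter => /andP[tF _].
rewrite mulrC ler_wpM2r ?vweight_ge0// lerXn2r ?nnegrE ?ltW//.
exact: lt_trans tF.
Qed.

Lemma sum_union_le (E : seq G) (Q Q1 Q2 : pred G) (F : G -> R) : (forall x, 0 <= F x) ->
  (forall x, x \in E -> Q x -> Q1 x || Q2 x) ->
  \sum_(x <- E | Q x) F x <= \sum_(x <- E | Q1 x) F x + \sum_(x <- E | Q2 x) F x.
Proof.
move=> F0 h; rewrite big_mkcond [X in _ <= X + _]big_mkcond [X in _ <= _ + X]big_mkcond.
rewrite -big_split/= !big_seq; apply: ler_sum => x xE.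
have := F0 x; have := h x xE; case: (Q x) => [/(_ isT)|_]; last first.
  by move=> ?; case: ifP => _; case: ifP => _; lra.
by case: (Q1 x); case: (Q2 x) => //= _ ?; lra.
Qed.

Lemma sum_has_le (E J : seq G) (Q : G -> pred G) (F : G -> R) : (forall x, 0 <= F x) ->
  \sum_(x <- E | has (Q^~ x) J) F x <= \sum_(z <- J) \sum_(x <- E | Q z x) F x.
Proof.
move=> F0; elim: J => [|z J IH]; first by rewrite big_nil big_pred0.
rewrite big_cons/=; apply: le_trans (sum_union_le (Q1 := Q z) (Q2 := fun x => has (Q^~ x) J) F0 _) _.
  by [].
by rewrite lerD2l.
Qed.

(** The good part and the averages of the bad pieces are treated in [L^2]. The
    differences between the bad pieces and their averages are integrable away
    from the balls, by [riesz_far]. *)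
Lemma weak_truncated : exists2 C : R, 0 < C & forall N f (A E : seq G) lam,
  (0 < N)%N -> 0 < lam -> uniq A -> (forall x, x \notin A -> f x = 0) -> uniq E ->
  (forall x, x \in E -> lam < T N f x) ->
  \sum_(x <- E) m x <= C / lam * norm1 mu f.
Proof.
have [Ccz Ccz0 cz] := calderon_zygmund (mu := mu).
have [Ca Ca0 hav] := nsq_averages (mu := mu).
have [Cf Cf0 far] := riesz_far (mu := mu).
have [D D1 dbl] := doubling_ge1 (mu := mu).
have D0 : 0 < D by rewrite (lt_le_trans _ D1).
have dblk := doubling_iter D1 dbl.
exists (Ccz + (D ^+ 2 + (18 + (18 * Ca * D + 3 * Cf)))).
  by rewrite !addr_gt0 ?exprn_gt0 ?mulr_gt0.
move=> N f A E lam N0 lam0 uA fA uE ET.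
have nf0 : 0 <= norm1 mu f by apply: mint_ge0.
have nfl0 : 0 <= norm1 mu f / lam by rewrite divr_ge0 ?(ltW lam0).
rewrite mulrAC -mulrA mulrDl.
have [h|[J [rad [b [g [[uJ dJ rad0] [fE gle sb bf] brad bn vol]]]]]] := cz f A lam lam0 uA fA.
  apply: le_trans (h E uE) _; rewrite mulrAC -mulrA lerDl.
  by rewrite mulr_ge0// !addr_ge0 ?exprn_ge0 ?mulr_ge0 ?(ltW D0) ?(ltW Ca0) ?(ltW Cf0).
apply: le_trans (_ : _ <= (D ^+ 2 + (18 + (18 * Ca * D + 3 * Cf))) * (norm1 mu f / lam)) _; last first.
  by rewrite lerDr mulr_ge0 ?(ltW Ccz0).
have bA z y : y \notin A -> b z y = 0.
  by move=> /fA fy; apply/eqP; rewrite -normr_le0 (le_trans (bf z y))// fy normr0.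
have gA y : y \notin A -> g y = 0.
  by move=> /fA fy; apply/eqP; rewrite -normr_le0 (le_trans (gle y).2)// fy normr0.
have m0 x : 0 <= m x by exact: vweight_ge0.
pose s z := scale (rad z).
pose h x := \sum_(z <- J) pop mu (avgp (s z)) (b z) x.
pose W x := \sum_(z <- J) gradient mu (pop mu (riesz_coef N (s z)) (b z)) x.
have hg : L2 mu g := L2_finsupp gA.
have hb z : L2 mu (b z) := L2_finsupp (bA z).
have hh : L2 mu h by apply: L2_sum => z; exact: L2_pop.
have fE' : f = (fun x => 1 * g x + (1 * h x + \sum_(z <- J) 1 * (b z x - pop mu (avgp (s z)) (b z) x))).
  apply: funext => x; rewrite fE !mul1r; congr (_ + _).
  rewrite /h -big_split/=; apply: eq_bigr => z _; ring.
have Tle x : T N f x <= T N g x + (T N h x + W x).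
  have -> : T N f x = gradient mu (fun x => dinv mu N g x + (dinv mu N h x +
      \sum_(z <- J) pop mu (riesz_coef N (s z)) (b z) x)) x.
    rewrite /truncated_riesz; congr (gradient _ _ x); rewrite {1}/dinv fE'.
    rewrite !pop_linear pop_sum; apply: funext => w; rewrite !mul1r; congr (_ + (_ + _)).
    apply: eq_bigr => z _; rewrite mul1r /riesz_coef popM; congr (pop _ _ _ _).
    by rewrite pop1B.
  apply: le_trans (gradientD _ _ _) _; rewrite lerD2l.
  by apply: le_trans (gradientD _ _ _) _; rewrite lerD2l gradient_sum.
have lam30 : 0 < lam / 3 by rewrite divr_gt0.
(* A vertex of E lies close to a ball, or one of the three parts is large. *)
pose Q1 x := has (fun z => (d z x < 4 * rad z)%N) J.
have split4 : \sum_(x <- E) m x <= \sum_(x <- E | Q1 x) m x +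
   (\sum_(x <- E | lam / 3 < T N g x) m x + (\sum_(x <- E | lam / 3 < T N h x) m x +
    \sum_(x <- E | ~~ Q1 x && (lam / 3 < W x)) m x)).
  apply: le_trans (sum_union_le (Q1 := Q1) (Q2 := fun x => ~~ Q1 x) m0 _) _.
    by move=> x _ _; case: (Q1 x).
  rewrite lerD2l; apply: le_trans (sum_union_le (Q1 := fun x => lam / 3 < T N g x)
     (Q2 := fun x => ~~ Q1 x && ~~ (lam / 3 < T N g x)) m0 _) _.
    by move=> x _ ->; case: (_ < _).
  rewrite lerD2l; apply: (sum_union_le m0) => x xE /andP[-> /=].
  rewrite -leNgt => h1; have := ET x xE; have := Tle x.
  case: (ltP (lam / 3) (T N h x)) => //= h2; rewrite ltNge => *.
  by apply/negP => h3; lra.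
apply: le_trans split4 _; rewrite mulrDl lerD//.
  apply: le_trans (sum_has_le _ _ (fun z x => (d z x < 4 * rad z)%N) m0) _.
  apply: (@le_trans _ _ (\sum_(z <- J) D ^+ 2 * V z (rad z)%:R)).
    rewrite !big_seq; apply: ler_sum => z zJ.
    apply: le_trans (dblk 2 z (rad z)%:R _); last by rewrite ltr0n rad0.
    rewrite -big_filter; apply: sum_le_volume; first exact: filter_uniq.
    by move=> x; rewrite mem_filter -natrX -natrM ltr_nat => /andP[].
  rewrite -mulr_sumr ler_wpM2l ?exprn_ge0 ?(ltW D0)// ler_pdivlMr// mulrC mulr_sumr.
  exact: vol.
have ng : nsq mu g <= lam * norm1 mu f.
  rewrite nsqE /norm1 -mintZ; last first.
    by apply: (integrable_finsupp (A := A)) => y /fA ->; rewrite normr0.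
  apply: le_mint => [||x]; first exact: hg.
    by apply: (integrable_finsupp (A := A)) => y /fA ->; rewrite normr0 mulr0.
  have [g1 g2] := gle x; rewrite -real_normK ?num_real// expr2.
  exact: ler_pM.
have nh : nsq mu h <= Ca * D * lam * norm1 mu f.
  apply: le_trans (hav J rad s b A (D * lam) uJ dJ _ uA _ _ bA brad _) _.
  - by rewrite mulr_ge0 ?(ltW D0) ?(ltW lam0).
  - by move=> z zJ; split=> //; exact: rho_scale.
  - by move=> z z' zz'; exact: scale_mono.
  - move=> z zJ; apply: le_trans (bn z zJ) _; rewrite [D * lam]mulrC -mulrA.
    by rewrite ler_wpM2l ?(ltW lam0)// natrM dbl// ltr0n; exact: rad0.
  - rewrite -!mulrA ler_wpM2l ?(ltW Ca0)// ler_wpM2l ?(ltW D0)// ler_wpM2l ?(ltW lam0)//.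
    under eq_bigr => z _ do rewrite (norm1E uA (bA z)).
    rewrite exchange_big/= (norm1E uA fA); apply: ler_sum => y _.
    by rewrite -mulr_suml ler_wpM2r.
have l2 : lam ^+ 2 != 0 by rewrite gt_eqF ?exprn_gt0.
rewrite mulrDl lerD//.
  apply: le_trans (chebyshev _ uE lam30) _; first exact/L2_gradient/L2_pop.
  rewrite ler_pdivrMr ?exprn_gt0//; apply: le_trans (nsq_truncated_riesz N0 hg) _.
  have -> : 18 * (norm1 mu f / lam) * (lam / 3) ^+ 2 = 2 * (lam * norm1 mu f).
    by field; rewrite gt_eqF.
  by rewrite ler_wpM2l.
rewrite mulrDl lerD//.
  apply: le_trans (chebyshev _ uE lam30) _; first exact/L2_gradient/L2_pop.
  rewrite ler_pdivrMr ?exprn_gt0//; apply: le_trans (nsq_truncated_riesz N0 hh) _.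
  have -> : 18 * Ca * D * (norm1 mu f / lam) * (lam / 3) ^+ 2 = 2 * (Ca * D * lam * norm1 mu f).
    by field; rewrite gt_eqF.
  by rewrite ler_wpM2l.
rewrite -big_filter; set E' := [seq x <- E | _].
have uE' : uniq E' by exact: filter_uniq.
apply: (@le_trans _ _ (3 / lam * \sum_(x <- E') W x * m x)).
  rewrite mulr_sumr !big_seq; apply: ler_sum => x.
  rewrite mem_filter => /andP[/andP[_ hW] _]; rewrite mulrA.
  rewrite -[leLHS]mul1r ler_wpM2r// mulrAC ler_pdivlMr// mul1r; lra.
have -> : 3 * Cf * (norm1 mu f / lam) = 3 / lam * (Cf * norm1 mu f) by field; rewrite gt_eqF.
rewrite ler_wpM2l ?divr_ge0 ?(ltW lam0)//.
have -> : \sum_(x <- E') W x * m x = \sum_(z <- J) \sum_(x <- E')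
    gradient mu (pop mu (riesz_coef N (s z)) (b z)) x * m x.
  by rewrite exchange_big/=; apply: eq_bigr => x _; rewrite mulr_suml.
apply: (@le_trans _ _ (\sum_(z <- J) Cf * norm1 mu (b z))).
  rewrite !big_seq; apply: ler_sum => z zJ; have r0 := rad0 _ zJ.
  apply: (far N (s z) (b z) (rad z)%:R A E') => //.
  - by rewrite ltr0n.
  - exact: scale_le.
  - exact: bA.
  - move=> x y; rewrite mem_filter => /andP[/andP[/hasPn/(_ z zJ) hz _] _] /brad hy.
    rewrite ler_nat; move: hz; rewrite -leqNgt => hz.
    exact: gdist_outside hz hy.
rewrite -mulr_sumr ler_wpM2l ?(ltW Cf0)//.
under eq_bigr => z _ do rewrite (norm1E uA (bA z)).
rewrite exchange_big/= (norm1E uA fA); apply: ler_sum => y _.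
by rewrite -mulr_suml ler_wpM2r.
Qed.

End WeakType.

(** * Interpolation *)

Section Dyadic.
Context {R : realType}.
Implicit Types (b t eta q : R) (j n : nat).

Lemma powR2_gt1 b : 0 < b -> 1 < 2 `^ b :> R.
Proof.
move=> b0; have {1}<- : (1 : R) `^ b = 1 by rewrite powR1.
by apply: gt0_ltr_powR; rewrite ?nnegrE// ltr1n.
Qed.

Definition geom_const b : R := 2 `^ b / (2 `^ b - 1).

Lemma geom_const_gt0 b : 0 < b -> 0 < geom_const b.
Proof. by move=> /powR2_gt1 h; rewrite divr_gt0 ?subr_gt0// (lt_trans ltr01). Qed.

Lemma geom_constE b : 0 < b -> geom_const b + 2 `^ b = geom_const b * 2 `^ b.
Proof.
move=> /powR2_gt1 h; rewrite /geom_const; field.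
by rewrite subr_eq0 gt_eqF.
Qed.

Lemma geom_const_ge1 b : 0 < b -> 1 <= geom_const b.
Proof.
by move=> /powR2_gt1 h; rewrite /geom_const ler_pdivlMr ?subr_gt0// mul1r gerBl.
Qed.

Lemma powR_dyadicS eta j b : 0 < eta ->
  (eta * 2 ^+ j.+1) `^ b = 2 `^ b * (eta * 2 ^+ j) `^ b.
Proof.
move=> e0; have h : 0 <= eta * 2 ^+ j by rewrite mulr_ge0 ?exprn_ge0 ?(ltW e0).
by rewrite -powRM// mulrCA -exprS.
Qed.

Lemma sum_dyadic_lt eta n t b : 0 < eta -> 0 < b ->
  \sum_(j < n | eta * 2 ^+ j < t) (eta * 2 ^+ j) `^ b <= geom_const b * t `^ b.
Proof.
move=> e0 b0; have K0 := geom_const_gt0 b0; have q1 := powR2_gt1 b0.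
have full k : \sum_(j < k.+1) (eta * 2 ^+ j) `^ b <= geom_const b * (eta * 2 ^+ k) `^ b.
  elim: k => [|k IH].
    by rewrite big_ord1 ler_peMl ?powR_ge0// geom_const_ge1.
  rewrite big_ord_recr/=; apply: le_trans (lerD IH (lexx _)) _.
  by rewrite powR_dyadicS// mulrA -geom_constE// mulrDl.
elim: n => [|n IH]; first by rewrite big_ord0 mulr_ge0 ?powR_ge0 ?(ltW K0).
rewrite big_mkcond big_ord_recr/=; case: ifP => [h|_]; last first.
  by rewrite addr0 -big_mkcond.
apply: (@le_trans _ _ (\sum_(j < n.+1) (eta * 2 ^+ j) `^ b)).
  rewrite big_ord_recr/= lerD2r; apply: ler_sum => j _.
  by case: ifP => // _; exact: powR_ge0.
apply: le_trans (full n) _; rewrite ler_wpM2l ?(ltW K0)//.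
have en : 0 <= eta * 2 ^+ n by rewrite mulr_ge0 ?exprn_ge0 ?(ltW e0).
by apply: ge0_ler_powR; rewrite ?nnegrE ?(ltW b0) ?(ltW h)// (le_trans en) ?(ltW h).
Qed.

Lemma sum_dyadic_ge eta n t b : 0 < eta -> 0 < t -> 0 < b ->
  \sum_(j < n | t <= eta * 2 ^+ j) (eta * 2 ^+ j) `^ (- b) <= geom_const b * t `^ (- b).
Proof.
move=> e0 t0 b0; have K0 := geom_const_gt0 b0; have q1 := powR2_gt1 b0.
have q0 : 0 < 2 `^ b :> R by rewrite (lt_trans ltr01).
have shift k (Q : pred R) eta' : \sum_(j < k | Q (eta' * 2 ^+ (lift ord0 j))) (eta' * 2 ^+ (lift ord0 j)) `^ (- b)
    = \sum_(j < k | Q ((2 * eta') * 2 ^+ j)) ((2 * eta') * 2 ^+ j) `^ (- b).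
  have e (j : 'I_k) : eta' * 2 ^+ (lift ord0 j) = (2 * eta') * 2 ^+ j.
    by rewrite lift0 exprS mulrCA mulrA.
  by apply: eq_big => j; rewrite e.
have full k eta' : 0 < eta' ->
    \sum_(j < k) (eta' * 2 ^+ j) `^ (- b) <= geom_const b * eta' `^ (- b).
  elim: k eta' => [|k IH] eta' e0'; first by rewrite big_ord0 mulr_ge0 ?powR_ge0 ?(ltW K0).
  rewrite big_ord_recl expr0 mulr1 (shift k xpredT).
  have e2 : 0 < 2 * eta' by rewrite mulr_gt0.
  apply: le_trans (lerD (lexx _) (IH _ e2)) _.
  have -> : (2 * eta') `^ (- b) = (2 `^ b)^-1 * eta' `^ (- b).
    by rewrite powRM ?(ltW e0')// powRN.
  have Kq : 1 + geom_const b / 2 `^ b = geom_const b.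
    apply: (mulIf (lt0r_neq0 q0)); rewrite mulrDl mul1r divfK ?gt_eqF//.
    by rewrite -geom_constE// addrC.
  by rewrite -{2}Kq mulrDl mul1r mulrA.
elim: n eta e0 => [|n IH] eta e0; first by rewrite big_ord0 mulr_ge0 ?powR_ge0 ?(ltW K0).
have [te|te] := leP t eta.
  apply: (@le_trans _ _ (\sum_(j < n.+1) (eta * 2 ^+ j) `^ (- b))).
    rewrite big_mkcond/=; apply: ler_sum => j _.
    by case: ifP => // _; exact: powR_ge0.
  apply: le_trans (full _ _ e0) _; rewrite ler_wpM2l ?(ltW K0)// !powRN.
  rewrite lef_pV2 ?posrE ?powR_gt0//; apply: ge0_ler_powR; rewrite ?nnegrE ?(ltW b0)//.
    exact: ltW.
  exact: ltW.
rewrite big_mkcond big_ord_recl expr0 mulr1 (leNgt t eta) te/= add0r -big_mkcond/=.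
by rewrite (shift n (fun u => t <= u)); apply: IH; rewrite mulr_gt0.
Qed.

Lemma dyadic_locate eta t n : 0 < eta -> eta < t -> t <= eta * 2 ^+ n ->
  exists2 j, (j < n)%N & eta * 2 ^+ j < t <= eta * 2 ^+ j.+1.
Proof.
move=> e0 et; elim: n => [|n IH]; first by rewrite expr0 mulr1 leNgt et.
move=> tn; have [h|h] := leP t (eta * 2 ^+ n).
  by have [j jn hj] := IH h; exists j => //; exact: ltnW.
by exists n; rewrite ?h.
Qed.

Lemma dyadic_range (I : eqType) (E : seq I) (F : I -> R) : (forall x, 0 <= F x) ->
  exists eta n, 0 < eta /\
    forall x, x \in E -> F x != 0 -> eta < F x <= eta * 2 ^+ n.
Proof.
move=> F0; have [eta [e0 he]] : exists eta, 0 < eta /\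
    forall x, x \in E -> F x != 0 -> eta < F x.
  elim: E => [|y E [eta [e0 he]]]; first by exists 1.
  have [Fy|Fy] := eqVneq (F y) 0.
    exists eta; split=> // x; rewrite inE => /orP[/eqP ->|]; last exact: he.
    by rewrite Fy eqxx.
  have Fy0 : 0 < F y by rewrite lt_def Fy F0.
  exists (Num.min eta (F y / 2)); split; first by rewrite lt_min e0 divr_gt0.
  move=> x; rewrite inE => /orP[/eqP -> _|xE Fx].
    by rewrite gt_min; apply/orP; right; lra.
  by rewrite gt_min (he _ xE Fx).
have [n hn] : exists n, forall x, x \in E -> F x <= eta * 2 ^+ n.
  exists (Num.bound ((\sum_(x <- E) F x) / eta)) => x xE.
  have h : (\sum_(x <- E) F x) / eta < (Num.bound ((\sum_(x <- E) F x) / eta))%:R.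
    by apply: archi_boundP; rewrite divr_ge0 ?(ltW e0)// sumr_ge0.
  rewrite mulrC -ler_pdivrMr//; apply: (@le_trans _ _ ((\sum_(x <- E) F x) / eta)).
    by rewrite ler_pM2r ?invr_gt0// (big_rem x)//= lerDl sumr_ge0.
  by rewrite (le_trans (ltW h))// -natrX ler_nat ltnW// ltn_expl.
by exists eta, n; split=> // x xE Fx; rewrite he// hn.
Qed.

End Dyadic.

Section Interpolation.
Context {R : realType} {G : countType} {mu : subgaussian_graph R G}.
Implicit Types (x y z : G) (n k l N j : nat) (f g : G -> R) (lam p : R).

Local Notation m := (vweight mu).
Local Notation T := (truncated_riesz mu).

Lemma truncated_rieszD N f g x :
  T N (fun y => f y + g y) x <= T N f x + T N g x.
Proof.
have -> : (fun y => f y + g y) = (fun y => 1 * f y + g y).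
  by apply: funext => y; rewrite mul1r.
rewrite /truncated_riesz /dinv pop_linear.
by under [X in gradient _ X]funext do rewrite mul1r; exact: gradientD.
Qed.

Lemma truncated_riesz_ge0 N f x : 0 <= T N f x.
Proof. exact: gradient_ge0. Qed.

(** Marcinkiewicz interpolation between the weak type (1,1) and the [L^2]
    bounds, on the dyadic levels [eta * 2 ^ j]. *)
Lemma strong_truncated p : 1 < p -> p < 2 -> exists2 C : R, 0 < C &
  forall N f (A E : seq G), (0 < N)%N -> uniq A -> (forall x, x \notin A -> f x = 0) ->
    uniq E ->
    \sum_(x <- E) T N f x `^ p * m x <= C * \sum_(x <- A) `|f x| `^ p * m x.
Proof.
move=> p1 p2; have [C C0 weak] := weak_truncated (mu := mu).
have b0 : 0 < p - 1 by rewrite subr_gt0.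
have c0 : 0 < 2 - p by rewrite subr_gt0.
have p0 : 0 < p by rewrite (lt_trans ltr01).
have K1 := geom_const_gt0 b0; have K2 := geom_const_gt0 c0.
have q0 : 0 < 2 `^ p :> R by exact: powR_gt0.
exists (2 `^ p * (2 * C * geom_const (p - 1) + 8 * geom_const (2 - p))).
  by rewrite mulr_gt0// addr_gt0// mulr_gt0// mulr_gt0.
move=> N f A E N0 uA fA uE.
have m0 x : 0 <= m x by exact: vweight_ge0.
have [eta [n [e0 hE]]] := dyadic_range E (F := T N f) (truncated_riesz_ge0 N f).
pose L j : R := eta * 2 ^+ j.
have L0 j : 0 < L j by rewrite mulr_gt0 ?exprn_gt0.
have level j : \sum_(x <- E | L j < T N f x) m x <=
    2 * C / L j * (\sum_(y <- A | L j < `|f y|) `|f y| * m y) +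
    8 / L j ^+ 2 * (\sum_(y <- A | `|f y| <= L j) f y ^+ 2 * m y).
  pose f1 y := if L j < `|f y| then f y else 0.
  pose f2 y := if L j < `|f y| then 0 else f y.
  have f1A y : y \notin A -> f1 y = 0 by move=> /fA fy; rewrite /f1 fy if_same.
  have f2A y : y \notin A -> f2 y = 0 by move=> /fA fy; rewrite /f2 fy if_same.
  have fE : f = (fun y => f1 y + f2 y).
    by apply: funext => y; rewrite /f1 /f2; case: ifP; rewrite ?addr0 ?add0r.
  have h0 : 0 < L j / 2 by rewrite divr_gt0.
  apply: le_trans (sum_union_le (Q1 := fun x => L j / 2 < T N f1 x)
     (Q2 := fun x => L j / 2 < T N f2 x) m0 _) _.
    move=> x _; rewrite {1}fE => h; have := truncated_rieszD N f1 f2 x.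
    case: (ltP (L j / 2) (T N f1 x)) => //= h1; rewrite ltNge => h2.
    by apply/negP => h3; lra.
  apply: lerD.
    rewrite -big_filter; apply: le_trans (weak N f1 A _ (L j / 2) N0 h0 uA f1A _ _) _.
    - exact: filter_uniq.
    - by move=> x; rewrite mem_filter => /andP[].
    rewrite (norm1E uA f1A) [X in _ <= _ * X]big_mkcond/=.
    have -> : C / (L j / 2) = 2 * C / L j by field; rewrite gt_eqF.
    rewrite ler_wpM2l ?divr_ge0 ?(ltW (L0 _)) ?mulr_ge0 ?(ltW C0)//.
    by apply: ler_sum => y _; rewrite /f1; case: ifP; rewrite ?normr0 ?mul0r.
  apply: le_trans (chebyshev _ uE h0) _; first exact/L2_gradient/L2_pop/(L2_finsupp f2A).
  have -> : 8 / L j ^+ 2 * (\sum_(y <- A | `|f y| <= L j) f y ^+ 2 * m y) =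
     (2 * \sum_(y <- A | `|f y| <= L j) f y ^+ 2 * m y) / (L j / 2) ^+ 2.
    by field; rewrite gt_eqF.
  rewrite ler_wpM2r ?invr_ge0 ?sqr_ge0//.
  apply: le_trans (nsq_truncated_riesz N0 (L2_finsupp f2A)) _.
  rewrite ler_wpM2l// nsqE (mint_finsupp uA); last first.
    by move=> y /f2A ->; rewrite expr0n.
  rewrite [leRHS]big_mkcond/=; apply: ler_sum => y _.
  by rewrite /f2 ltNge; case: (`|f y| <= L j) => //=; rewrite expr0n mul0r.
apply: (@le_trans _ _ (2 `^ p * \sum_(j < n) L j `^ p * \sum_(x <- E | L j < T N f x) m x)).
  have -> : \sum_(j < n) L j `^ p * \sum_(x <- E | L j < T N f x) m x =
      \sum_(x <- E) (\sum_(j < n | L j < T N f x) L j `^ p) * m x.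
    under eq_bigr do rewrite mulr_sumr big_mkcond/=.
    rewrite exchange_big/=; apply: eq_bigr => x _.
    by rewrite mulr_suml [RHS]big_mkcond.
  rewrite mulr_sumr !big_seq; apply: ler_sum => x xE; rewrite mulrA ler_wpM2r//.
  have S0 : 0 <= \sum_(j < n | L j < T N f x) L j `^ p.
    by apply: sumr_ge0 => j _; exact: powR_ge0.
  have [Fx|Fx] := eqVneq (T N f x) 0.
    by rewrite {1}Fx powR0 ?gt_eqF//; exact: mulr_ge0 (ltW q0) S0.
  have /andP[h1 h2] := hE x xE Fx.
  have [j jn /andP[jl jr]] := dyadic_locate e0 h1 h2.
  apply: (@le_trans _ _ (2 `^ p * L j `^ p)).
    rewrite /L -powR_dyadicS//; apply: ge0_ler_powR; rewrite ?nnegrE ?(ltW p0) ?truncated_riesz_ge0//.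
    exact: ltW (L0 j.+1).
  rewrite ler_wpM2l ?(ltW q0)// (bigD1 (Ordinal jn))//= lerDl sumr_ge0// => i _.
  exact: powR_ge0.
rewrite -mulrA ler_wpM2l ?(ltW q0)//.
pose X j := \sum_(y <- A | L j < `|f y|) L j `^ (p - 1) * (`|f y| * m y).
pose Y j := \sum_(y <- A | `|f y| <= L j) L j `^ (- (2 - p)) * (f y ^+ 2 * m y).
apply: (@le_trans _ _ (\sum_(j < n) (2 * C * X j + 8 * Y j))).
  apply: ler_sum => j _; apply: le_trans (ler_wpM2l (powR_ge0 _ _) (level j)) _.
  rewrite /X /Y -!mulr_sumr mulrDr.
  have e1 : L j `^ (p - 1) = L j `^ p / L j.
    rewrite powRB ?powRr1 ?(ltW (L0 j))//; apply/implyP => _; exact: lt0r_neq0.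
  have e2 : L j `^ (- (2 - p)) = L j `^ p / L j ^+ 2.
    rewrite opprB powRB ?powR_mulrn ?(ltW (L0 j))//; apply/implyP => _; exact: lt0r_neq0.
  rewrite e1 e2 le_eqVlt; apply/orP; left; apply/eqP.
  by field; rewrite gt_eqF.
rewrite big_split/= -!mulr_sumr (mulrDl (2 * C * _)).
have swap (Q : nat -> G -> bool) (u : nat -> R) (v : G -> R) :
    \sum_(j < n) \sum_(y <- A | Q j y) u j * v y =
    \sum_(y <- A) (\sum_(j < n | Q j y) u j) * v y.
  under eq_bigr do rewrite big_mkcond/=.
  rewrite exchange_big/=; apply: eq_bigr => y _.
  by rewrite mulr_suml [RHS]big_mkcond.
apply: lerD.
  rewrite /X (swap (fun j y => L j < `|f y|) (fun j => L j `^ (p - 1))).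
  rewrite -[leRHS]mulrA; apply: ler_wpM2l; first by rewrite mulr_ge0 ?(ltW C0).
  rewrite mulr_sumr; apply: ler_sum => y _.
  rewrite !mulrA ler_wpM2r// -(mulr_powRB1 (normr_ge0 (f y)) p0) [X in _ <= _ * X]mulrC mulrA.
  by rewrite ler_wpM2r// sum_dyadic_lt.
rewrite /Y (swap (fun j y => `|f y| <= L j) (fun j => L j `^ (- (2 - p)))).
rewrite -[leRHS]mulrA ler_wpM2l// mulr_sumr; apply: ler_sum => y _.
rewrite [leLHS]mulrA [leRHS]mulrA ler_wpM2r//.
have [->|fy] := eqVneq (f y) 0.
  by rewrite expr0n mulr0 mulr_ge0 ?powR_ge0// ltW.
have fy0 : 0 < `|f y| by rewrite normr_gt0.
have -> : `|f y| `^ p = `|f y| `^ (- (2 - p)) * f y ^+ 2.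
  rewrite -[f y ^+ 2]real_normK ?num_real// -powR_mulrn// -powRD; last first.
    by apply/implyP => _; exact: lt0r_neq0.
  by congr (_ `^ _); ring.
rewrite mulrA ler_wpM2r ?sqr_ge0//.
exact: sum_dyadic_ge.
Qed.

Lemma truncated_riesz_local N (E : seq G) : exists2 D : seq G, uniq D &
  forall f g, {in D, f =1 g} -> {in E, T N f =1 T N g}.
Proof.
have [D hD] := choice (fun x => pop_local (mu := mu) (invroot N) x).
exists (undup (flatten [seq D y | y <- flatten [seq x :: nbh mu x | x <- E]])).
  exact: undup_uniq.
move=> f g fg x xE; rewrite /truncated_riesz !gradientE.
have h y : y \in x :: nbh mu x -> dinv mu N f y = dinv mu N g y.
  move=> yx; apply: hD => w wD; apply: fg; rewrite mem_undup.
  apply/flattenP; exists (D y) => //; apply: map_f.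
  by apply/flattenP; exists (x :: nbh mu x) => //; exact: map_f.
rewrite (h x) ?mem_head//; congr (Num.sqrt (_ * _)); apply: eq_Pop => y xy.
by rewrite h// inE mem_nbh xy orbT.
Qed.

Lemma truncated_riesz_restrict N (E : seq G) f : exists D g,
  [/\ uniq D, forall x, x \notin D -> g x = 0, {in D, g =1 f} & {in E, T N f =1 T N g}].
Proof.
have [D uD loc] := truncated_riesz_local N E.
pose g x := if x \in D then f x else 0.
have gD : {in D, g =1 f} by move=> x xD; rewrite /g xD.
exists D, g; split=> // [x /negPf xD|]; first by rewrite /g xD.
by apply: loc => x /gD ->.
Qed.

Lemma weak_truncated_L1 : exists2 C : R, 0 < C & forall N f (E : seq G) lam,
  (0 < N)%N -> 0 < lam -> integrable mu f -> uniq E ->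
  (forall x, x \in E -> lam < T N f x) ->
  \sum_(x <- E) m x <= C / lam * norm1 mu f.
Proof.
have [C C0 weak] := weak_truncated (mu := mu); exists C => //.
move=> N f E lam N0 lam0 hf uE ET.
have [D [g [uD gD gf Tg]]] := truncated_riesz_restrict N E f.
apply: le_trans (weak N g D E lam N0 lam0 uD gD uE _) _.
  by move=> x xE; rewrite -Tg// ET.
rewrite ler_wpM2l ?divr_ge0 ?(ltW C0) ?(ltW lam0)// (norm1E uD gD).
apply: le_trans (sum_le_mint uD _ (integrable_abs hf)); last by [].
by rewrite !big_seq; apply: ler_sum => y /gf ->.
Qed.

Lemma truncated_Lp p : 1 < p <= 2 -> exists2 C : R, 0 < C &
  forall N f (E : seq G), (0 < N)%N -> uniq E -> exists2 D : seq G, uniq D &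
    \sum_(x <- E) T N f x `^ p * m x <= C * \sum_(x <- D) `|f x| `^ p * m x.
Proof.
move=> /andP[p1 p2].
suff [C C0 strong] : exists2 C : R, 0 < C & forall N f (A E : seq G), (0 < N)%N ->
    uniq A -> (forall x, x \notin A -> f x = 0) -> uniq E ->
    \sum_(x <- E) T N f x `^ p * m x <= C * \sum_(x <- A) `|f x| `^ p * m x.
  exists C => // N f E N0 uE.
  have [D [g [uD gD gf Tg]]] := truncated_riesz_restrict N E f; exists D => //.
  have -> : \sum_(x <- E) T N f x `^ p * m x = \sum_(x <- E) T N g x `^ p * m x.
    by apply: eq_big_seq => x /Tg ->.
  have -> : \sum_(x <- D) `|f x| `^ p * m x = \sum_(x <- D) `|g x| `^ p * m x.
    by apply: eq_big_seq => x /gf ->.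
  exact: strong.
move: p2; rewrite le_eqVlt => /orP[/eqP ->|]; last exact: strong_truncated.
exists 2 => // N f A E N0 uA fA uE.
have hf : L2 mu f := L2_finsupp fA.
have hT : L2 mu (T N f) by exact/L2_gradient/L2_pop.
apply: (@le_trans _ _ (nsq mu (T N f))).
  rewrite nsqE; apply: le_trans (sum_le_mint uE _ hT); last by move=> x; exact: sqr_ge0.
  by apply: ler_sum => x _; rewrite powR_mulrn ?truncated_riesz_ge0.
apply: le_trans (nsq_truncated_riesz N0 hf) _; rewrite ler_wpM2l//.
rewrite nsqE (mint_finsupp uA); last by move=> x /fA ->; rewrite expr0n.
by apply: ler_sum => x _; rewrite powR_mulrn// real_normK ?num_real.
Qed.

End Interpolation.

(** * Passage to the Riesz transform *)

Section Norms.
Context {R : realType} {G : countType} {mu : subgaussian_graph R G}.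
Implicit Types (f g h : G -> R) (p K : R).

Local Notation m := (vweight mu).

Lemma Lp_pow_ge0 p f x : 0 <= `|f x| `^ p * m x.
Proof. by rewrite mulr_ge0 ?powR_ge0 ?vweight_ge0. Qed.

Lemma LpnormE p f : integrable mu (fun x => `|f x| `^ p) ->
  Lpnorm mu p f = ((mint mu (fun x => `|f x| `^ p)) `^ p^-1)%:E.
Proof.
move=> hf; rewrite /Lpnorm -tsum_esum ?poweR_EFin// => x; exact: Lp_pow_ge0.
Qed.

Lemma Lpnorm_pinfty p f : 0 < p -> ~ integrable mu (fun x => `|f x| `^ p) ->
  Lpnorm mu p f = +oo%E.
Proof.
move=> p0 hf; rewrite /Lpnorm; apply: eqy_poweR; first by rewrite invr_gt0.
set S := esum _ _; have S0 : (0 <= S)%E.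
  by apply: esum_ge0 => x _; rewrite lee_fin Lp_pow_ge0.
case E : S S0 => [r||//] // _; exfalso; apply: hf.
apply/absum_ge0P; first exact: Lp_pow_ge0.
exists r; apply/esum_leP; first exact: Lp_pow_ge0.
by rewrite -/S E.
Qed.

Lemma inLpP p f : 0 < p -> inLp mu p f <-> integrable mu (fun x => `|f x| `^ p).
Proof.
move=> p0; split=> [h|h]; last by rewrite /inLp LpnormE// ltry.
by apply: contrapT => /(Lpnorm_pinfty p0) e; move: h; rewrite /inLp e ltxx.
Qed.

Lemma pow2E f : (fun x => `|f x| `^ 2) = (fun x => f x ^+ 2).
Proof. by apply: funext => x; rewrite powR_mulrn// real_normK ?num_real. Qed.

Lemma inL2P f : inLp mu 2 f <-> L2 mu f.
Proof. by rewrite inLpP// pow2E. Qed.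

Lemma L2normE f : L2 mu f -> Lpnorm mu 2 f = (Num.sqrt (nsq mu f))%:E.
Proof.
move=> hf; rewrite LpnormE pow2E// -nsqE powR12_sqrt//; exact: nsq_ge0.
Qed.

Lemma pow1E f : (fun x => `|f x| `^ 1) = (fun x => `|f x|).
Proof. by apply: funext => x; rewrite powRr1. Qed.

Lemma inL1P f : inLp mu 1 f -> integrable mu f.
Proof.
rewrite inLpP// pow1E; apply: integrable_leabs => x; by rewrite normr_id.
Qed.

Lemma L1normE f : integrable mu f -> Lpnorm mu 1 f = (norm1 mu f)%:E.
Proof.
move=> hf; rewrite LpnormE pow1E; last exact: integrable_abs.
by rewrite invr1 powRr1// mint_ge0.
Qed.

Lemma dotL2E f g : dotL2 mu f g = ip mu f g.
Proof. by rewrite /ip /mint tsum.unlock. Qed.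

Lemma sqrt_op_bounded S : is_sqrt_op mu (laplacian mu) S ->
  exists2 K, 0 <= K & bounded_positive (mu := mu) S K.
Proof.
move=> [SL2 Slin [K SK] [Ssym Spos] SS]; exists `|K| => //.
have SL2' f : L2 mu f -> L2 mu (S f) by rewrite -!inL2P; exact: SL2.
split=> //.
- by move=> c f g /inL2P hf /inL2P hg; exact: Slin.
- move=> f hf; have := SK f ((inL2P f).2 hf).
  rewrite !L2normE ?lee_fin//; last exact: SL2'.
  move=> h; rewrite -(sqr_sqrtr (nsq_ge0 (S f))) -(sqr_sqrtr (nsq_ge0 f)).
  rewrite real_normK ?num_real// -exprMn lerXn2r ?nnegrE ?sqrtr_ge0//.
  exact: le_trans (sqrtr_ge0 _) h.
- by move=> f g /inL2P hf /inL2P hg; rewrite -!dotL2E; exact: Ssym.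
- by move=> f /inL2P hf; rewrite -dotL2E; exact: Spos.
Qed.

End Norms.

Section Main.
Context {R : realType} {G : countType} {mu : subgaussian_graph R G}.
Implicit Types (x : G) (f g h : G -> R) (E : seq G) (p : R).

Local Notation m := (vweight mu).
Local Notation T := (truncated_riesz mu).
Local Notation S := (sqrt_laplacian mu).

(** What the proof uses about [Delta^(1/2)]. This also holds when
    [sqrt_laplacian] takes its default value, the identity, because the first
    truncation is [gradient] itself. *)
Lemma sqrt_laplacian_approx : (forall f, L2 mu f -> L2 mu (S f)) /\
  forall g (eta : R), L2 mu g -> 0 < eta -> exists2 N, (0 < N)%N &
    nsq mu (fun x => gradient mu g x - T N (S g) x) <= eta.
Proof.
rewrite /sqrt_laplacian; case: xgetP => [S _ SP|_]; last first.
  split=> // g eta hg eta0; exists 1%N => //.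
  rewrite /truncated_riesz dinv1 nsqE (@mint_finsupp _ _ _ _ [::])// ?big_nil ?ltW// => x _.
  by rewrite subrr expr0n.
have [K K0 bS] := sqrt_op_bounded SP.
have [SL2 _ _ _ SS] := SP.
split=> [f|g eta hg eta0]; first by rewrite -!inL2P; exact: SL2.
have SS' f : L2 mu f -> S (S f) = laplacian mu f by move=> /inL2P; exact: SS.
have e0 := sg_eps_gt0 mu.
set c := (2 * (K + 2)) ^+ 2 * nsq mu g ^+ 3.
have c0 : 0 <= c by rewrite mulr_ge0 ?sqr_ge0 ?exprn_ge0 ?nsq_ge0.
pose N := (Num.bound (c / (eta ^+ 3 * sg_eps mu))).+1; exists N => //.
have ee : 0 < eta ^+ 3 * sg_eps mu by rewrite mulr_gt0 ?exprn_gt0.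
have cN : c < N%:R * (eta ^+ 3 * sg_eps mu).
  rewrite -ltr_pdivrMr// (@lt_trans _ _ (Num.bound (c / (eta ^+ 3 * sg_eps mu)))%:R)//.
    by apply: archi_boundP; rewrite divr_ge0// ltW.
  by rewrite ltr_nat.
have := sqrt_dinv_cvg K0 bS SS' e0 (sg_lazy mu) (isT : (0 < N)%N) hg.
rewrite -/c leNgt; set Y := nsq mu _ => h; rewrite leNgt; apply: contra h => Yeta.
apply: lt_le_trans cN _; rewrite mulrCA ler_wpM2r ?mulr_ge0 ?(ltW e0)//.
by rewrite lerXn2r ?nnegrE ?(ltW eta0) ?(ltW Yeta) ?(le_trans (ltW eta0) (ltW Yeta)).
Qed.

(** Every vertex has positive mass. *)
Lemma nsq_small_on E (delta : R) : 0 < delta -> exists2 eta : R, 0 < eta &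
  forall f, L2 mu f -> nsq mu f <= eta -> forall x, x \in E -> `|f x| < delta.
Proof.
move=> d0; have [eta [e0 he]] : exists eta : R, 0 < eta /\
    forall x, x \in E -> eta < delta ^+ 2 * m x.
  elim: E => [|y E [eta [e0 he]]]; first by exists 1.
  have y0 : 0 < delta ^+ 2 * m y by rewrite mulr_gt0 ?exprn_gt0 ?vweight_gt0.
  exists (Num.min eta (delta ^+ 2 * m y / 2)); split.
    by rewrite lt_min e0 divr_gt0.
  move=> x; rewrite inE => /orP[/eqP ->|xE]; last by rewrite gt_min he.
  by rewrite gt_min; apply/orP; right; lra.
exists eta => // f hf fe x xE.
rewrite -(ltr_pXn2r (n := 2)) ?nnegrE ?(ltW d0)// real_normK ?num_real//.
rewrite -(ltr_pM2r (vweight_gt0 mu x)).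
by apply: le_lt_trans (nsq_point x hf) _; apply: le_lt_trans fe (he x xE).
Qed.

Lemma Lpnorm_cvg0 (u : nat -> G -> R) (eta : R) : (forall n, L2 mu (u n)) -> 0 < eta ->
  (fun n => Lpnorm mu 2 (u n)) @ \oo --> 0%E ->
  \forall n \near \oo, nsq mu (u n) <= eta.
Proof.
move=> hu eta0; have -> : (fun n => Lpnorm mu 2 (u n)) =
    (fun n => (Num.sqrt (nsq mu (u n)))%:E) by apply: funext => n; rewrite L2normE.
move=> /fine_cvgP[_ /cvgr0_norm_lt h].
have s0 : 0 < Num.sqrt eta by rewrite sqrtr_gt0.
near=> n.
have : `|Num.sqrt (nsq mu (u n))| < Num.sqrt eta by near: n; exact: h.
rewrite ger0_norm ?sqrtr_ge0// => hn.
by apply: ltW; move: hn; rewrite ltr_sqrt.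
Unshelve. all: by end_near. Qed.

Lemma nsqD3_le f g h : L2 mu f -> L2 mu g -> L2 mu h ->
  nsq mu (fun x => f x + (g x + h x)) <= 4 * (nsq mu f + nsq mu g + nsq mu h).
Proof.
move=> hf hg hh; apply: le_trans (nsqD_le hf (L2D hg hh)) _.
by have := nsqD_le hg hh; have := nsq_ge0 (mu := mu) f; lra.
Qed.

Lemma L2_truncated_riesz N f : L2 mu f -> L2 mu (T N f).
Proof. by move=> hf; exact/L2_gradient/L2_pop. Qed.

Lemma truncated_riesz_dist N f g x :
  `|T N f x - T N g x| <= T N (fun y => f y - g y) x.
Proof.
have -> : T N (fun y => f y - g y) x =
    gradient mu (fun y => dinv mu N f y - dinv mu N g y) x.
  have -> : (fun y => f y - g y) = (fun y => -1 * g y + f y).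
    by apply: funext => y; ring.
  rewrite /truncated_riesz; congr (gradient _ _ x).
  by rewrite /dinv pop_linear; apply: funext => y; ring.
exact: gradient_dist.
Qed.

(** The truncations are bounded on [L^2] uniformly in [N], and they converge on
    the range of [Delta^(1/2)], to the gradients that define [h]. *)
Lemma riesz_truncated_approx f h E (delta : R) : L2 mu f -> is_riesz mu f h -> 0 < delta ->
  exists2 N, (0 < N)%N & forall x, x \in E -> `|T N f x - h x| < delta.
Proof.
move=> hf [/inL2P hh [g [hg cv1 cv2]]] d0.
have [SL2 Sapp] := sqrt_laplacian_approx.
have {}hg n : L2 mu (g n) by apply/inL2P.
have [eta eta0 small] := nsq_small_on E d0.
have e16 : 0 < eta / 16 by rewrite divr_gt0.
have hS n : L2 mu (fun x => S (g n) x - f x) by apply: L2B => //; exact: SL2.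
have hG n : L2 mu (fun x => gradient mu (g n) x - h x).
  by apply: L2B => //; exact: L2_gradient.
near \oo => n.
have n1 : nsq mu (fun x => S (g n) x - f x) <= eta / 16.
  by near: n; exact: Lpnorm_cvg0.
have n2 : nsq mu (fun x => gradient mu (g n) x - h x) <= eta / 16.
  by near: n; exact: Lpnorm_cvg0.
have [N N0 hN] := Sapp (g n) (eta / 16) (hg n) e16.
exists N => //; have hTf := L2_truncated_riesz N hf.
have hTS := L2_truncated_riesz N (SL2 _ (hg n)).
have hgr := L2_gradient (hg n).
apply: small; first exact: L2B.
have -> : (fun x => T N f x - h x) = (fun x => (T N f x - T N (S (g n)) x) +
    (-1 * (gradient mu (g n) x - T N (S (g n)) x) + (gradient mu (g n) x - h x))).
  by apply: funext => x; ring.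
have hd : L2 mu (fun x => gradient mu (g n) x - T N (S (g n)) x) by exact: L2B.
apply: le_trans (nsqD3_le (L2B hTf hTS) (L2Z (-1) hd) (hG n)) _.
rewrite nsqZ// sqrrN expr1n mul1r.
have : nsq mu (fun x => T N f x - T N (S (g n)) x) <= 2 * (eta / 16).
  pose u x := S (g n) x - f x.
  apply: le_trans (_ : nsq mu (T N u) <= _); last first.
    by apply: le_trans (nsq_truncated_riesz N0 (hS n)) _; rewrite ler_wpM2l.
  rewrite !nsqE; apply: le_mint => [||x].
  - exact: L2B.
  - exact: L2_truncated_riesz (hS n).
  rewrite -real_normK ?num_real// distrC lerXn2r ?nnegrE ?truncated_riesz_ge0//.
  exact: truncated_riesz_dist.
by move=> ?; lra.
Unshelve. all: by end_near. Qed.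

Lemma weak11_riesz : weak11 mu (riesz mu).
Proof.
have [C C0 weak] := weak_truncated_L1 (mu := mu).
exists C => lam f lam0 /inL1P hf1 /inL2P hf2; rewrite L1normE//.
have nf0 : 0 <= norm1 mu f by exact: mint_ge0.
have rhs0 : 0 <= C / lam * norm1 mu f by rewrite mulr_ge0 ?divr_ge0 ?(ltW C0) ?(ltW lam0).
rewrite -EFinM /vmeasure; apply: ge_ereal_sup => _ [X [finX XE] <-].
rewrite fsbig_finite//= sumEFin lee_fin.
set E : seq G := fset_set X.
have EX x : x \in E -> lam < `|riesz mu f x|.
  by move=> xE; apply: XE; move: xE; rewrite /E in_fset_set// inE.
move: EX; rewrite /riesz; case: xgetP => [h _ hh|_] EX; last first.
  rewrite big1_seq// => x /= /EX; rewrite normr0 => /(lt_trans lam0).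
  by rewrite ltxx.
have uE : uniq E by exact: fset_uniq.
clearbody E.
have [delta d0 hd] : exists2 delta : R, 0 < delta &
    forall x, x \in E -> lam + delta <= `|h x|.
  elim: E EX {uE} => [|y E IH] EX; first by exists 1.
  have [delta d0 hd] := IH (fun x xE => EX x (mem_behead (s := y :: E) xE)).
  have hy := EX y (mem_head _ _).
  exists (Num.min delta (`|h y| - lam)); first by rewrite lt_min d0 subr_gt0.
  move=> x; rewrite inE => /orP[/eqP ->|xE].
    by rewrite -lerBrDl ge_min lexx orbT.
  by apply: le_trans (hd x xE); rewrite lerD2l ge_min lexx.
have [N N0 hN] := riesz_truncated_approx E hf2 hh d0.
apply: (weak N f E lam N0 lam0 hf1 uE) => x xE.
have := hN x xE; have := hd x xE; rewrite distrC.
have := ler_distD (T N f x) (h x) 0; rewrite !subr0.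
by rewrite (ger0_norm (truncated_riesz_ge0 N f x)) => *; lra.
Qed.

Lemma powR_addl_le p (u v : R) : 0 < p -> 0 <= u -> 0 <= v ->
  (u + v) `^ p <= 2 `^ p * (u `^ p + v `^ p).
Proof.
move=> p0 u0 v0; set w := Num.max u v.
have w0 : 0 <= w by rewrite le_max u0.
apply: (@le_trans _ _ ((2 * w) `^ p)).
  apply: ge0_ler_powR; rewrite ?nnegrE ?(ltW p0) ?addr_ge0 ?mulr_ge0//.
  have : u <= w by rewrite le_max lexx.
  have : v <= w by rewrite le_max lexx orbT.
  by move=> *; lra.
rewrite powRM// ler_wpM2l ?powR_ge0// /w; case: (leP u v) => _.
  by rewrite lerDr powR_ge0.
by rewrite lerDl powR_ge0.
Qed.

Lemma riesz_bounded p : 1 < p <= 2 -> riesz_Lp_bounded mu p.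
Proof.
move=> p12; have /andP[p1 p2] := p12; have p0 : 0 < p by rewrite (lt_trans ltr01).
have [C C0 strong] := truncated_Lp (mu := mu) p12.
have [SL2 Sapp] := sqrt_laplacian_approx.
have q0 : 0 < 2 `^ p :> R by exact: powR_gt0.
exists ((2 `^ p * C) `^ p^-1) => g gfin.
have cst0 : 0 < (2 `^ p * C) `^ p^-1 by apply: powR_gt0; exact: mulr_gt0.
have hg : L2 mu g.
  apply: (L2_finsupp (A := fset_set [set x | g x != 0])) => x.
  move=> xg; apply/eqP; apply: contraNT xg => gx.
  by rewrite in_fset_set//; exact/mem_set.
have [intS|nS] := pselect (integrable mu (fun x => `|S g x| `^ p)); last first.
  by rewrite (Lpnorm_pinfty p0 nS) gt0_muley ?lte_fin// leey.
set I := mint mu (fun x => `|S g x| `^ p).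
have I0 : 0 <= I by apply: mint_ge0 => x; exact: powR_ge0.
have gp0 x : 0 <= `|gradient mu g x| `^ p by exact: powR_ge0.
have bound E : uniq E -> \sum_(x <- E) `|gradient mu g x| `^ p * m x <= 2 `^ p * C * I.
  move=> uE; set M := \sum_(x <- E) m x.
  have M0 : 0 <= M by apply: sumr_ge0 => x _; exact: vweight_ge0.
  apply/ler_addgt0Pr => e e0.
  pose delta := Num.min 1 (e / (2 `^ p * (M + 1))).
  have M1 : 0 < 2 `^ p * (M + 1) by rewrite mulr_gt0// ltr_wpDl.
  have d0 : 0 < delta by rewrite lt_min ltr01 divr_gt0.
  have [eta eta0 small] := nsq_small_on E d0.
  have [N N0 hN] := Sapp g eta hg eta0.
  have hd : L2 mu (fun x => gradient mu g x - T N (S g) x).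
    by apply: L2B; [exact: L2_gradient|apply: L2_truncated_riesz; exact: SL2].
  have close := small _ hd hN.
  have dp : delta `^ p <= delta.
    by apply: ge1r_powR; rewrite ?d0 ?ge_min ?lexx// ltW.
  have [D uD hD] := strong N (S g) E N0 uE.
  apply: (@le_trans _ _ (\sum_(x <- E) 2 `^ p * (T N (S g) x `^ p + delta `^ p) * m x)).
    rewrite !big_seq; apply: ler_sum => x xE; rewrite ler_wpM2r ?vweight_ge0//.
    apply: le_trans (powR_addl_le p0 (truncated_riesz_ge0 _ _ _) (ltW d0)).
    apply: ge0_ler_powR; rewrite ?nnegrE ?(ltW p0) ?addr_ge0 ?truncated_riesz_ge0 ?(ltW d0)//.
    rewrite (ger0_norm (gradient_ge0 _ _)).
    by have := close x xE; rewrite ltr_norml => /andP[_ ?]; lra.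
  have -> : \sum_(x <- E) 2 `^ p * (T N (S g) x `^ p + delta `^ p) * m x =
      2 `^ p * (\sum_(x <- E) T N (S g) x `^ p * m x + delta `^ p * M).
    rewrite /M [delta `^ p * _]mulr_sumr -big_split mulr_sumr; apply: eq_bigr => x _.
    by rewrite /=; ring.
  rewrite mulrDr lerD//.
    rewrite -mulrA ler_wpM2l ?(ltW q0)//; apply: le_trans hD _.
    rewrite ler_wpM2l ?(ltW C0)//.
    by apply: (sum_le_mint uD _ intS) => x; exact: powR_ge0.
  apply: (@le_trans _ _ (2 `^ p * (delta * (M + 1)))).
    rewrite ler_wpM2l ?(ltW q0)//; apply: ler_pM => //; first exact: powR_ge0.
    by rewrite lerDl.
  rewrite mulrCA -ler_pdivlMr//; rewrite ge_min; apply/orP; right; exact: lexx.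
have intg : integrable mu (fun x => `|gradient mu g x| `^ p).
  by apply: integrable_ge0P => //; exists (2 `^ p * C * I).
rewrite !LpnormE// -EFinM lee_fin -powRM ?mulr_ge0 ?(ltW q0) ?(ltW C0)//.
apply: ge0_ler_powR; rewrite ?nnegrE ?invr_ge0 ?(ltW p0)//.
- exact: mint_ge0.
- by rewrite !mulr_ge0 ?(ltW q0) ?(ltW C0).
- exact: mint_le.
Qed.

End Main.

Lemma uniformly_lazy_vweight_gt0 {R : realType} {G : countType} (mu : G -> G -> R) :
  (forall x y, 0 <= mu x y) -> uniformly_lazy mu -> forall x, 0 < vweight mu x.
Proof.
move=> mu0 [eps e0 lazy] x; rewrite lt_def; apply/andP; split; last first.
  by apply: fsumr_ge0 => y _.
apply/eqP => vx; have := lt_trans e0 (lazy x).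
by rewrite /pker vx invr0 mulr0 ltxx.
Qed.

Theorem theorem4p2 (R : realType) (G : countType) (mu : G -> G -> R)
    (hG : weighted_graph mu)
    (hconn : connected_graph mu)
    (hluf : locally_uniformly_finite mu)
    (hlazy : uniformly_lazy mu)
    (hdoubling : volume_doubling mu)
    (hker : exists2 m : R, 2 < m & subgaussian_upper_bound mu m) :
  weak11 mu (riesz mu) /\
  forall p : R, 1 < p <= 2 -> riesz_Lp_bounded mu p.
Proof.
have [_ sym pos] := hG; have [M0 fin] := hluf; have [m m2 ker] := hker.
have vpos := uniformly_lazy_vweight_gt0 pos hlazy.
have [eps e0 lazy] := hlazy.
have nfin x : finite_set [set y | adj mu x y].
  by apply/finite_set_leP; exists M0; exact: fin.
pose rg := ReversibleGraph sym pos nfin vpos.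
pose mg := @MetricGraph R G rg hconn.
have m1 : 1 < m by rewrite (lt_trans _ m2)// ltr1n.
pose sg := @SubgaussianGraph R G mg eps e0 (fun x => ltW (lazy x)) hdoubling m m1 ker.
split; first exact: (weak11_riesz (mu := sg)).
exact: (riesz_bounded (mu := sg)).
Qed.
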